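(* Let $X$ be the nilpotent $N\times N$ complex matrix in Jordan form of Jordan type $(n,N-n)$, and let $\mathcal{M}$ be a standard noncrossing matching on $\{1,2,\ldots,N\}$ with at most $n$ arc starts and at most $N-n$ arc ends (i.e. $|\mathcal{M}|\le\min(n,N-n)$), with associated Springer Schubert cell $\mathcal{C}^X_{\mathcal{M}}$. Then the closure $\overline{\mathcal{C}^X_{\mathcal{M}}}$ in the flag variety is the disjoint union \[\overline{\mathcal{C}^X_{\mathcal{M}}}=\bigcup_{\mathcal{A}\subseteq\mathcal{M}} cut(\mathcal{C}^X_{\mathcal{M}},\mathcal{A}),\] where $\mathcal{A}$ ranges over all subsets of the set of arcs of $\mathcal{M}$ and $cut(\mathcal{C}^X_{\mathcal{M}},\mathcal{A})$ is the subspace, defined in the context, of the Springer Schubert cell of the matching $cut(\mathcal{M},\mathcal{A})$ obtained by cutting the arcs $\mathcal{A}$ inside $\mathcal{M}$.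
   Context: Flags. Let $1\le n\le N-1$. $B\subset GL_N(\mathbb{C})$ is the group of invertible upper-triangular matrices; $GL_N(\mathbb{C})/B$ is the flag variety, and $gB$ corresponds to the flag $V_\bullet=(V_1\subset\cdots\subset V_N=\mathbb{C}^N)$ with $V_i$ the span of the first $i$ columns of $g$. Each flag has a unique canonical representative $g$: each row and column has a pivot entry equal to $1$, and all entries below a pivot and to the right of a pivot are $0$; the pivots form a permutation matrix. For a permutation $w$ (with matrix $w\vec{e}_i=\vec{e}_{w(i)}$), the Schubert cell $\mathcal{C}_w$ is the set of flags whose canonical representative has pivots at $w$. $X$ is given by $X\vec{e}_1=X\vec{e}_{n+1}=\vec{0}$ and $X\vec{e}_j=\vec{e}_{j-1}$ otherwise. The Springer fiber is $\mathcal{S}_X=\{V_\bullet: XV_i\subseteq V_i\ \forall i\}$. Matchings. An arc $\alpha$ is a pair of integers $init(\alpha)<term(\alpha)$, also written $(init(\alpha),term(\alpha))$. A matching on $\{1,\ldots,N\}$ is a set of arcs whose endpoints are pairwise distinct elements of $\{1,\ldots,N\}$; $|\mathcal{M}|$ is its number of arcs. It is noncrossing if no two arcs satisfy $init(\alpha')<init(\alpha)<term(\alpha')<term(\alpha)$, and standard if every integer $i$ with $init(\alpha)<i<term(\alpha)$ for some arc $\alpha$ is an endpoint of some arc. In a noncrossing matching, $\alpha'$ is nested above $\alpha$ if $init(\alpha')<init(\alpha)$ and $term(\alpha)<term(\alpha')$; the parent of $\alpha$ is the arc nested above $\alpha$ with the largest $init$. Write $anc(\alpha)$ for the parent of $\alpha$,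 or $0$ if there is none, $anc(0)=0$, $anc^j$ for the $j$-fold composition, $anc^0=\mathrm{id}$. Permutation and word. Let $k=|\mathcal{M}|$. For $1\le i\le N$ let $\mathcal{J}_{beg}(i),\mathcal{J}_{end}(i),\mathcal{J}_{not}(i)$ be the number of $j$ with $1\le j\le i-1$ that start an arc, end an arc, are on no arc, respectively. Define \[w_{\mathcal{M}}(i)=\begin{cases}\mathcal{J}_{end}(i)+\mathcal{J}_{not}(i)+1 & i\text{ on no arc},\ \mathcal{J}_{not}(i)<n-k,\\ n+\mathcal{J}_{beg}(i)+(\mathcal{J}_{not}(i)-(n-k))+1 & i\text{ on no arc},\ \mathcal{J}_{not}(i)\ge n-k,\\ n+\mathcal{J}_{beg}(i)+\max\{0,\mathcal{J}_{not}(i)-(n-k)\}+1 & i\text{ starts an arc},\\ \mathcal{J}_{end}(i)+\min\{\mathcal{J}_{not}(i),n-k\}+1 & i\text{ ends an arc}.\end{cases}\] The Springer Schubert cell of $\mathcal{M}$ is $\mathcal{C}^X_{\mathcal{M}}=\mathcal{S}_X\cap\mathcal{C}_{w_{\mathcal{M}}}$. The $\{B,T\}$-word $m_1\cdots m_N$ of $\mathcal{M}$ has $m_i=T$ if $w_{\mathcal{M}}(i)\le n$ and $m_i=B$ if $w_{\mathcal{M}}(i)>n$. This is a bijection from standard noncrossing matchings on $\{1,\ldots,N\}$ with at most $\min(n,N-n)$ arcs to words of length $N$ in $\{B,T\}$ with exactly $n$ letters $T$; the inverse repeatedly chooses adjacent letters $BT$ (after deleting already matched letters), joins their positions by an arc,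 and deletes them. The map $f_{\mathcal{M}}$. For $\vec{v}\in\mathbb{C}^{|\mathcal{M}|}$, with coordinates $v_\alpha$ indexed by arcs and $v_0=0$, $f_{\mathcal{M}}(\vec{v})$ is the matrix obtained from the permutation matrix $w_{\mathcal{M}}$ by adding, for every arc $\alpha$, the vector $\sum_{j\ge1}v_{anc^{j-1}(\alpha)}\vec{e}_{r_0+j}$ to column $init(\alpha)$, where $r_0=\mathcal{J}_{end}(init(\alpha))+\min\{\mathcal{J}_{not}(init(\alpha)),n-k\}$. It is identified with the flag $f_{\mathcal{M}}(\vec{v})B$. Cutting. For $\mathcal{A}\subseteq\mathcal{M}$, $cut(\mathcal{M},\mathcal{A})$ is the standard noncrossing matching whose $\{B,T\}$-word is obtained from that of $\mathcal{M}$ by exchanging the letters in positions $init(\alpha)$ and $term(\alpha)$ for every $\alpha\in\mathcal{A}$. Choose any ordering $\alpha_1,\ldots,\alpha_j$ of $\mathcal{A}$ such that if $\alpha_p$ is nested above $\alpha_q$ then $p<q$. Put $\mathcal{M}_s=cut(\mathcal{M},\{\alpha_1,\ldots,\alpha_s\})$, so $\mathcal{M}_0=\mathcal{M}$; then $\alpha_s\in\mathcal{M}_{s-1}$. Define $\lambda_s:\mathcal{M}_s\cup\{0\}\to\mathcal{M}\cup\{0\}$ recursively: $\lambda_s(0)=0$, $\lambda_0(\beta)=\beta$, and for $s\ge1$: $\lambda_s(\beta)=\lambda_{s-1}(\beta)$ if $\beta\in\mathcal{M}_{s-1}\setminus\{\alpha_s\}$; $\lambda_s(\beta)=\lambda_{s-1}(p)$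 if $\beta\notin\mathcal{M}_{s-1}$, $\alpha_s$ has a parent $p$ in $\mathcal{M}_{s-1}$, and $init(\beta)=init(p)$ or $term(\beta)=term(p)$; and $\lambda_s(\beta)=0$ otherwise. The nonzero values of $\lambda_j$ lie in $\mathcal{M}\setminus\mathcal{A}$. Then \[cut(\mathcal{C}^X_{\mathcal{M}},\mathcal{A})=\{f_{cut(\mathcal{M},\mathcal{A})}(\vec{u})B:\ \vec{v}\in\mathbb{C}^{\mathcal{M}\setminus\mathcal{A}},\ u_\beta=v_{\lambda_j(\beta)}\text{ for all }\beta\in cut(\mathcal{M},\mathcal{A})\},\quad v_0=0.\] *)

(* Defs.v *)
From HB Require Import structures.
From mathcomp Require Import all_boot all_order all_algebra all_fingroup.
From mathcomp Require Import complex.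
From mathcomp Require Import all_classical all_reals topology normedtype.

Set Implicit Arguments.
Unset Strict Implicit.
Unset Printing Implicit Defensive.

Import Order.TTheory GRing.Theory Num.Theory.
Import numFieldNormedType.Exports.
Local Open Scope quotient_scope.
Local Open Scope ring_scope.

(* Conventions. Positions, rows and columns are counted from 0 ('I_N) instead
   of from 1, so the summand "+ 1" disappears from the formulas giving row
   indices, and "w(i) <= n" becomes "w i < n". *)

(* R[i] seen as a numClosedFieldType, so that MathComp-Analysis supplies the
   usual topology of C. *)
Definition Cplx (R : realType) : numClosedFieldType := R[i].

Section Flags.
Local Open Scope classical_set_scope.
Variables (R : realType) (N : nat).
Local Notation C := (Cplx R).

(* As a type, GL carries the topology induced from 'M[C]_N. *)
Definition GL : set 'M[C]_N := [set g | g \in unitmx].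

Lemma GL_unit (g : GL) : set_val g \in unitmx.
Proof. exact: (set_mem (valP g)). Qed.

Definition upper_mx (b : 'M[C]_N) : bool := is_trig_mx b^T.

Lemma upper_mxP (b : 'M[C]_N) :
  reflect (forall i j : 'I_N, (j < i)%N -> b i j = 0) (upper_mx b).
Proof.
apply: (iffP is_trig_mxP) => h i j ij; first by have := h j i ij; rewrite mxE.
by rewrite mxE h.
Qed.

Lemma upper_mxM (a b : 'M[C]_N) : upper_mx a -> upper_mx b -> upper_mx (a *m b).
Proof.
move=> /upper_mxP ua /upper_mxP ub; apply/upper_mxP => i j ji.
rewrite mxE big1 // => k _; have [ki|ik] := ltnP k i; first by rewrite ua ?mul0r.
by rewrite [b k j]ub ?mulr0 // (leq_trans ji).
Qed.

Lemma upper_mxV (b : 'M[C]_N) : b \in unitmx -> upper_mx b -> upper_mx (invmx b).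
Proof.
move=> bU bu; have bd k : b k k != 0.
  have : \det b != 0 by rewrite -unitfE -unitmxE.
  rewrite -det_tr (det_trig bu) => /prodf_neq0 /(_ k isT).
  by rewrite mxE.
apply/upper_mxP => i j ji; apply/eqP/negP => /negP nz.
have Pi : [pred k : 'I_N | (j < k)%N && (invmx b k j != 0)] i by rewrite /= ji.
case: (@arg_maxnP _ i [pred k : 'I_N | (j < k)%N && (invmx b k j != 0)]
  (fun k : 'I_N => k : nat) Pi) => m /andP[jm mnz] mmax.
have /matrixP /(_ m j) := mulmxV bU.
rewrite !mxE (bigD1 m) //= big1 ?addr0 => [|k km].
  rewrite -[m == j]val_eqE /= gtn_eqF // => /eqP.
  by rewrite mulf_eq0 (negbTE (bd m)) (negbTE mnz).
have [lkm|mk] := ltnP k m; first by rewrite (upper_mxP _ bu) ?mul0r.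
have lmk : (m < k)%N by rewrite ltn_neqAle eq_sym mk andbT km.
apply/eqP; rewrite mulf_eq0; apply/orP; right; apply/negPn/negP => knz.
have := mmax k; rewrite /= (ltn_trans jm lmk) knz => /(_ isT).
by rewrite /geq /= leqNgt lmk.
Qed.

(* gB = hB *)
Definition eqB (g h : GL) : bool := upper_mx (invmx (set_val g) *m set_val h).

Lemma eqB_refl : reflexive eqB.
Proof.
move=> g; rewrite /eqB mulVmx ?GL_unit //.
by apply/upper_mxP => i j ji; rewrite mxE -val_eqE /= gtn_eqF.
Qed.

Lemma eqB_sym : symmetric eqB.
Proof.
suff h g k : eqB g k -> eqB k g by move=> g k; apply/idP/idP; exact: h.
rewrite /eqB => /upper_mxV; rewrite unitmx_mul unitmx_inv !GL_unit => /(_ isT).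
set a := set_val g; set b := set_val k.
have aU : a \in unitmx := GL_unit g; have bU : b \in unitmx := GL_unit k.
suff -> : invmx (invmx a *m b) = invmx b *m a by [].
have abU : invmx a *m b \in unitmx by rewrite unitmx_mul unitmx_inv aU bU.
rewrite -[LHS]mul1mx; have <- : (invmx b *m a) *m (invmx a *m b) = 1%:M.
  by rewrite mulmxA -(mulmxA _ a) mulmxV // mulmx1 mulVmx.
by rewrite -mulmxA mulmxV // mulmx1.
Qed.

Lemma eqB_trans : transitive eqB.
Proof.
move=> k g h; rewrite /eqB => gk kh; have := upper_mxM gk kh.
have kU : set_val k \in unitmx := GL_unit k.
move: (set_val g) (set_val k) (set_val h) kU => a b c bU.
suff -> : (invmx a *m b) *m (invmx b *m c) = invmx a *m c by [].
by rewrite -mulmxA (mulmxA b) mulmxV // mul1mx.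
Qed.

Canonical eqB_equiv := EquivRel eqB eqB_refl eqB_sym eqB_trans.

(* GL_N(C)/B with the quotient of the usual (analytic) topology. *)
Definition flag := quotient_topology {eq_quot eqB_equiv}.
HB.instance Definition _ := Topological.on flag.
HB.instance Definition _ := Quotient.on flag.

(* The flag g B of a matrix g; a one-point or empty set, as g need not be
   invertible. *)
Definition flag_of (g : 'M[C]_N) : set flag :=
  [set x | exists h : GL, set_val h = g /\ x = \pi_flag h].

Definition colspan (g : 'M[C]_N) (i : nat) : {vspace 'cV[C]_N} :=
  <<[seq col j g | j : 'I_N <- enum 'I_N & (j < i)%N]>>%VS.

(* V_i *)
Definition flag_space (x : flag) (i : nat) : {vspace 'cV[C]_N} :=
  colspan (set_val (generic_quotient.repr x)) i.

Lemma flag_spaceE (g : GL) i :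
  flag_space (\pi_flag g) i = colspan (set_val g) i.
Proof.
suff sub (h k : GL) : eqB h k ->
    (colspan (set_val k) i <= colspan (set_val h) i)%VS.
  have e : eqB (generic_quotient.repr (\pi_flag g)) g.
    by apply/(@eqquotP _ _ {eq_quot eqB_equiv}); rewrite reprK.
  by apply/eqP; rewrite eqEsubv !sub // eqB_sym.
move=> /upper_mxP hk; apply/span_subvP => _ /mapP[j + ->].
rewrite mem_filter => /andP[ji _].
set a := set_val h; set b := set_val k.
have -> : col j b = \sum_l (invmx a *m b) l j *: col l a.
  rewrite -[b in LHS]mul1mx -(mulmxV (GL_unit h)) -mulmxA.
  apply/colP => r; rewrite mxE mxE summxE; apply: eq_bigr => l _.
  by rewrite !mxE mulrC.
apply: memv_suml => l _; have [lj|jl] := leqP l j; last first.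
  by rewrite hk // scale0r mem0v.
apply/memvZ/memv_span/map_f; rewrite mem_filter mem_enum andbT.
exact: leq_ltn_trans ji.
Qed.

(* Jordan form of type (n, N - n) *)
Definition springer_X (n : nat) : 'M[C]_N :=
  \matrix_(r, c) ((c == r.+1 :> nat) && (c != n :> nat))%:R.

Definition springer_fiber (X : 'M[C]_N) : set flag :=
  [set x | forall (i : nat) (u : 'cV[C]_N), (1 <= i <= N)%N ->
     u \in flag_space x i -> X *m u \in flag_space x i].

(* g is a canonical representative with pivots at w *)
Definition canonical_rep (w : 'S_N) (g : 'M[C]_N) : Prop :=
  [/\ forall c, g (w c) c = 1,
      forall r c : 'I_N, (w c < r)%N -> g r c = 0
    & forall c c' : 'I_N, (c < c')%N -> g (w c) c' = 0].

Definition schubert_cell (w : 'S_N) : set flag :=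
  [set x | exists2 g, canonical_rep w g & flag_of g x].

End Flags.

(* An arc a is the pair (init a, term a). *)
Notation Arc N := ('I_N * 'I_N)%type.

Section Matchings.
Variable N : nat.
Implicit Types (M A : {set Arc N}) (a b : Arc N) (i : 'I_N).

Definition is_matching M : bool :=
  [forall a in M, (a.1 < a.2)%N] &&
  [forall a in M, forall b in M, (a != b) ==>
     [&& a.1 != b.1, a.1 != b.2, a.2 != b.1 & a.2 != b.2]].

Definition noncrossing M : bool :=
  [forall a in M, forall b in M,
     ~~ [&& (b.1 < a.1)%N, (a.1 < b.2)%N & (b.2 < a.2)%N]].

Definition starts M i : bool := [exists a in M, a.1 == i].
Definition ends M i : bool := [exists a in M, a.2 == i].
Definition on_no_arc M i : bool := ~~ starts M i && ~~ ends M i.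

Definition standard M : bool :=
  [forall a in M, forall i : 'I_N,
     ((a.1 < i)%N && (i < a.2)%N) ==> ~~ on_no_arc M i].

Definition std_noncrossing M : bool :=
  [&& is_matching M, noncrossing M & standard M].

Definition nested_above b a : bool := (b.1 < a.1)%N && (a.2 < b.2)%N.

(* None plays the role of the value 0, for parents as well as for the maps
   lambda below. *)
Definition parent M a : option (Arc N) :=
  [pick b in M | nested_above b a &&
     [forall c in M, nested_above c a ==> (c.1 <= b.1)%N]].

Definition anc M (j : nat) a : option (Arc N) :=
  iter j (obind (parent M)) (Some a).

Definition J_beg M i : nat := #|[set j : 'I_N | (j < i)%N && starts M j]|.
Definition J_end M i : nat := #|[set j : 'I_N | (j < i)%N && ends M j]|.
Definition J_not M i : nat := #|[set j : 'I_N | (j < i)%N && on_no_arc M j]|.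

(* max {0, J_not - (n - k)} is the truncated subtraction of nat. *)
Definition wM (n : nat) M i : nat :=
  let k := #|M| in
  if starts M i then (n + J_beg M i + (J_not M i - (n - k)))%N
  else if ends M i then (J_end M i + minn (J_not M i) (n - k))%N
  else if (J_not M i < n - k)%N then (J_end M i + J_not M i)%N
  else (n + J_beg M i + (J_not M i - (n - k)))%N.

(* The {B,T}-word: true is T, false is B. *)
Definition word (n : nat) M : {ffun 'I_N -> bool} :=
  [ffun i => (wM n M i < n)%N].

Definition cut_word (n : nat) M A : {ffun 'I_N -> bool} :=
  [ffun i => word n M ((\prod_(a in A) tperm a.1 a.2)%g i)].

(* cut (M, A), selected by the property defining it; set0 is a dummy value,
   never reached when M is standard noncrossing with #|M| <= min (n, N - n)
   and A \subset M. *)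
Definition cut (n : nat) M A : {set Arc N} :=
  odflt finset.set0 [pick M' : {set Arc N} |
    [&& std_noncrossing M', (#|M'| <= minn n (N - n))%N
      & word n M' == cut_word n M A]].

(* s enumerates A so that an arc nested above another one comes first *)
Definition nesting_order A (s : seq (Arc N)) : Prop :=
  [/\ uniq s, s =i A & pairwise (fun a b => ~~ nested_above b a) s].

(* lambda_s, for the reversed sequence rs = [:: alpha_s; ...; alpha_1] *)
Fixpoint lambda_rev (n : nat) M (rs : seq (Arc N)) b : option (Arc N) :=
  if rs is a :: rs' then
    let M' := cut n M [set x in rs'] in
    if b \in M' then
      if b == a then None else lambda_rev n M rs' b
    else if parent M' a is Some p then
      if (b.1 == p.1) || (b.2 == p.2) then lambda_rev n M rs' p else None
    else None
  else Some b.

Definition lambda (n : nat) M (s : seq (Arc N)) b : option (Arc N) :=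
  lambda_rev n M (rev s) b.

End Matchings.

Section Cells.
Local Open Scope classical_set_scope.
Variables (R : realType) (N n : nat).
Local Notation C := (Cplx R).
Implicit Types (M A : {set Arc N}).

Definition springer_schubert_cell M : set (flag R N) :=
  [set x | springer_fiber (springer_X R N n) x /\
     exists2 w : 'S_N, (forall i, w i = wM n M i :> nat) & schubert_cell w x].

(* v_0 = 0 *)
Definition vcoord (v : Arc N -> C) (o : option (Arc N)) : C := oapp v 0 o.

Definition r0 M (a : Arc N) : nat :=
  (J_end M a.1 + minn (J_not M a.1) (n - #|M|))%N.

(* Rows being counted from 0, v_(anc^j a) goes to row r0 + j, from j = 0 on; the
   sum may stop at N since an arc has fewer than N ancestors. *)
Definition f_mx M (v : Arc N -> C) : 'M[C]_N :=
  \matrix_(r, c) ((r == wM n M c :> nat)%:R +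
    \sum_(a in M | a.1 == c) \sum_(j < N | r == (r0 M a + j)%N :> nat)
       vcoord v (anc M j a)).

(* The elements of C^(M \ A) are the functions on arcs vanishing outside of
   M \ A. *)
Definition cut_cell M A (s : seq (Arc N)) : set (flag R N) :=
  \bigcup_(v in [set v : Arc N -> C | forall a, a \notin M :\: A -> v a = 0])
    flag_of (f_mx (cut n M A) (fun b => vcoord v (lambda n M s b))).

End Cells.

Arguments springer_schubert_cell R {N} n M.
Arguments cut_cell R {N} n M A s.

(* Main.v *)
Require Import Defs.
From mathcomp Require Import all_boot all_order all_algebra all_fingroup.
From mathcomp Require Import complex zify.
From mathcomp Require Import all_classical all_reals topology normedtype.

(* The closure is the set K of the X-stable flags such that V_(term a) lies in
   X^(-m) V_(init a - 1) for every arc a, with m half the number of positions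
   from init a to term a, and such that V_c is a fixed coordinate space whenever
   no arc encloses the gap c between the positions c and c + 1. These conditions
   are polynomial, so K is closed.

   An X-stable flag meets the first Jordan block E in coordinate spaces, and
   the dimensions of V_c :&: E are recorded by a word in B and T that determines
   its Schubert cell. On K the letters at the two ends of an arc of M differ, and
   the arcs that read T .. B instead of B .. T form the set A of cut arcs. Thus K
   is partitioned according to A.

   Reading the word, let B push a value on a stack and T pop one: then V_c depends
   only on the numbers of B and T read so far and on the stack. Cutting an arc a
   does not change these data outside of a, provided that the letter B now at
   term a pushes back the value popped at init a; this is the recursion that
   defines lambda. As a flag in K is determined by A and by the values pushed at
   the uncut arcs, the part of K of given A is the cut cell.

   For the density of the cell, let a be the cut arc with the least init. Then
   X^(-m) V_(init a - 1) / V_(init a - 1) is free of rank 2 over C[X] / X^m, and a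
   nilpotent endomorphism Y of it yields flags (1 + t Y) V in K, for t near 0, in
   which a is uncut and the letters before init a are the same. *)

(** The stack comes from the shape of V_c: modulo the first t basis vectors of E, it is generated by
    the X^j h for a single vector h. A letter T adds the next basis vector of E, so that the
    coordinates of h count from one row further down, which is a pop; a letter B replaces h by a
    vector that X sends to h, with one new coordinate in front, which is a push. That the letters at
    the ends of an arc differ is a count: the condition on V_(term a) bounds by m both the number of
    T and the number of B read along the arc, which together are 2m, and the same holds for the arcs
    directly under it. The deformation controls the letters up to init a only: arcs that start
    further right may become cut. Therefore density is proved by induction on how far to the left a
    cut arc may start, and not on the number of cut arcs. *)

Set Implicit Arguments.
Unset Strict Implicit.
Unset Printing Implicit Defensive.

(** * Words in B and T, and noncrossing matchings *)

Section Counting.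
Variable N : nat.
Implicit Types (P Q : pred 'I_N) (i : 'I_N) (c d : nat).

(** The argument is a gap from 0 to [N], so that [cnt P N] counts everything; [J_beg], [J_end] and
    [J_not] are instances up to conversion. *)
Definition cnt P c := #|[set j : 'I_N | (j < c) && P j]|.

Lemma gap_ind (Q : nat -> Prop) :
  Q 0 -> (forall i, Q i -> Q i.+1) -> forall c, c <= N -> Q c.
Proof.
move=> Q0 QS; elim=> [//|c IH cN].
by apply: (QS (Ordinal cN)); apply: IH; apply: ltnW.
Qed.

Lemma cnt0 P : cnt P 0 = 0.
Proof. by apply: eq_card0 => j; rewrite !inE. Qed.

Lemma cntS P i : cnt P i.+1 = cnt P i + P i.
Proof.
rewrite /cnt (cardsD1 i) !inE ltnSn addnC; congr (_ + _).
apply: eq_card => j; rewrite !inE ltnS leq_eqVlt -val_eqE /=.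
by case: ltngtP.
Qed.

Lemma cnt_leq P c : c <= N -> cnt P c <= c.
Proof.
move: c; apply: gap_ind; first by rewrite cnt0.
by move=> i; rewrite cntS; case: (P i); lia.
Qed.

Lemma cnt_mono P c d : c <= d -> cnt P c <= cnt P d.
Proof.
move=> cd; apply/subset_leq_card/fintype.subsetP => j; rewrite !inE => /andP[jc ->].
by rewrite (leq_trans jc).
Qed.

Lemma cnt_sub P c d : c <= d <= N -> cnt P d + c <= cnt P c + d.
Proof.
case/andP=> cd dN.
have : forall e, e <= N -> c <= e -> cnt P e + c <= cnt P c + e.
  apply: gap_ind => [|i IH ci]; first by rewrite leqn0 => /eqP->.
  have [ic|/IH] : c = i.+1 \/ c <= i by lia.
    by rewrite ic.
  by rewrite cntS; case: (P i); lia.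
by apply.
Qed.

Lemma eq_cnt_out P c d :
  c <= d -> (forall i, P i -> c <= i < d -> False) -> cnt P c = cnt P d.
Proof.
move=> cd h; apply: eq_card => j; rewrite !inE.
case Pj: (P j); rewrite ?andbF // !andbT.
by have := h j Pj; case: (ltnP j c); case: (ltnP j d) => //; lia.
Qed.

Lemma eq_cnt P Q c : (forall i, i < c -> P i = Q i) -> cnt P c = cnt Q c.
Proof.
move=> h; apply: eq_card => j; rewrite !inE.
by case: ltnP => //= /h ->.
Qed.

End Counting.

Section WordArcs.
Variable N : nat.
Implicit Types (m : pred 'I_N) (i t : 'I_N) (c d : nat).

(* With the height H(c) = c - 2 cnt m c of the lattice path of the word
   (B up, T down), an arc joins i to t when H(t + 1) = H(i) and H stays above
   H(i) in between. *)
Definition warc m i t : bool :=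
  [&& i < t, t.+1 + 2 * cnt m i == i + 2 * cnt m t.+1
    & [forall c : 'I_N, (i < c <= t) ==> (i + 2 * cnt m c < c + 2 * cnt m i)]].

Definition arcs m : {set Arc N} := [set a | warc m a.1 a.2].

Lemma warcP m i t :
  reflect [/\ i < t, t.+1 + 2 * cnt m i = i + 2 * cnt m t.+1 &
     forall c, i < c <= t -> i + 2 * cnt m c < c + 2 * cnt m i] (warc m i t).
Proof.
apply: (iffP and3P) => [[it /eqP e /'forall_implyP h]|[it e h]]; split => //.
- move=> c ict; have cN : c < N by case/andP: ict => _ /leq_ltn_trans->.
  exact: h (Ordinal cN) ict.
- by apply/eqP.
- by apply/'forall_implyP => c; apply: h.
Qed.

Lemma warc_letters m i t : warc m i t -> ~~ m i /\ m t.
Proof.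
case/warcP => it e h; split.
  by have := h i.+1; rewrite cntS; case: (m i) => //; lia.
by move: e; have := h t; rewrite cntS; case: (m t) => //; lia.
Qed.

Lemma warc_first m i t t' : warc m i t -> warc m i t' -> t = t'.
Proof.
move=> /warcP[it e h] /warcP[it' e' h']; apply/val_inj => /=.
by case: (ltngtP t t') => // tt'; [have := h' t.+1|have := h t'.+1]; lia.
Qed.

Lemma warc_last m i i' t : warc m i t -> warc m i' t -> i = i'.
Proof.
move=> /warcP[it e h] /warcP[it' e' h']; apply/val_inj => /=.
by case: (ltngtP i i') => // tt'; [have := h i'|have := h' i]; lia.
Qed.

Lemma warc_nc m i t i' t' :
  warc m i t -> warc m i' t' -> i' < i -> i < t' -> t' < t -> False.
Proof.
move=> /warcP[it e h] /warcP[it' e' h'] i'i it'' t't.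
have := h' i; have := h t'.+1; lia.
Qed.

(** Heights depend on the whole prefix, but the two counts differ by a constant from [i] on, and
    [warc] involves differences of heights only. *)
Lemma eq_warc m m' i t :
  (forall j : 'I_N, i <= j <= t -> m j = m' j) -> warc m i t -> warc m' i t.
Proof.
move=> mm' /warcP[it e h].
have dif : forall c, c <= N -> i <= c <= t.+1 ->
    cnt m c + cnt m' i = cnt m' c + cnt m i.
  apply: gap_ind => [|j IH jt]; first by rewrite leqn0 => /andP[/eqP->] _; lia.
  have [->|ji] : j.+1 = i \/ i <= j by lia.
    by lia.
  by rewrite !cntS (mm' j); lia.
apply/warcP; split => //.
  by have := dif t.+1 (ltn_ord t); lia.
by move=> c ct; have := dif c; have := h c ct; have := ltn_ord t; lia.
Qed.

(** The partner of [i] is read just before the first gap after [i] whose height is at most H(i); as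
    a letter changes the height by 1, equality holds there. *)
Lemma warc_start m i c : ~~ m i -> i < c <= N -> c + 2 * cnt m i <= i + 2 * cnt m c ->
  exists2 t, warc m i t & t < c.
Proof.
move=> mi ic hc.
pose P := [pred d | (i < d) && (d + 2 * cnt m i <= i + 2 * cnt m d)].
have exP : exists d, P d by exists c; rewrite /= hc; case/andP: ic => ->.
case: (ex_minnP exP) => d /andP[id hd] dmin.
have dc : d <= c by apply: dmin; rewrite /= hc; case/andP: ic => ->.
case: d => [//|d] in id hd dmin dc *.
have dN : d < N by case/andP: ic => _; apply: leq_trans.
have i_d : i < d.
  have [//|/esym/esym di] : i < d \/ d = i by lia.
  by move: hd; rewrite di cntS (negbTE mi); lia.
exists (Ordinal dN) => //; apply/warcP; split => //=.
  have := @dmin d; rewrite /= i_d /=; have := cntS m (Ordinal dN) => /= e.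
  by move: hd; rewrite !e; case: (m _); lia.
move=> e /andP[ie ed]; rewrite ltnNge; apply/negP => he.
by have := dmin e; rewrite /= ie he => /(_ isT); lia.
Qed.

(** Mirror image: the partner follows the last gap up to [t] whose height is at most H(t + 1). *)
Lemma warc_end m t c : m t -> c <= t -> c + 2 * cnt m t.+1 <= t.+1 + 2 * cnt m c ->
  exists2 i, warc m i t & c <= i.
Proof.
move=> mt ct hc.
pose P := [pred d | (d <= t) && (d + 2 * cnt m t.+1 <= t.+1 + 2 * cnt m d)].
have exP : exists d, P d by exists c; rewrite /= hc ct.
have ubP d : P d -> d <= t by case/andP.
case: (ex_maxnP exP ubP) => d /andP[dt hd] dmax.
have dc : c <= d by apply: dmax; rewrite /= hc ct.
have dN : d < N by apply: leq_ltn_trans dt _.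
have d_t : d < t.
  have [//|di] : d < t \/ d = t by lia.
  by move: hd; rewrite di cntS mt; lia.
exists (Ordinal dN) => //.
have e : t.+1 + 2 * cnt m d = d + 2 * cnt m t.+1.
  have := @dmax d.+1; rewrite /= d_t /=; have := cntS m (Ordinal dN) => /= e.
  by move: hd; rewrite !e; case: (m _); lia.
apply/warcP; split => //=.
move=> f /andP[df ft]; rewrite ltnNge; apply/negP => he.
have := dmax f; rewrite /= ft /=; lia.
Qed.

(** The last gap before [c] that is lower than [c] precedes the innermost letter B still open at
    [c]; [parent_height] recognizes it as the start of the parent. *)
Lemma height_start m c0 c : c0 < c <= N -> c0 + 2 * cnt m c < c + 2 * cnt m c0 ->
  exists i, [/\ c0 <= i < c, ~~ m i, c + 2 * cnt m i = (i + 2 * cnt m c).+1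
    & forall e, i < e <= c -> c + 2 * cnt m e <= e + 2 * cnt m c].
Proof.
move=> /andP[c0c cN] h.
pose P := [pred d | (d < c) && (d + 2 * cnt m c < c + 2 * cnt m d)].
have exP : exists d, P d by exists c0; rewrite /= c0c h.
have ubP d : P d -> d <= c by case/andP => /ltnW.
case: (ex_maxnP exP ubP) => d /andP[dc hd] dmax.
have c0d : c0 <= d by apply: dmax; rewrite /= c0c h.
have [i id] : exists i : 'I_N, i = d :> nat by exists (Ordinal (leq_trans dc cN)).
have hmax e : i < e <= c -> c + 2 * cnt m e <= e + 2 * cnt m c.
  rewrite id => /andP[de]; rewrite leq_eqVlt => /orP[/eqP->|ec]; first by lia.
  by rewrite leqNgt; apply/negP => he; have := dmax e; rewrite /= ec he => /(_ isT); lia.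
have {dmax ubP exP P} hS := hmax i.+1; rewrite id in hS.
exists i; split => //; first by rewrite id c0d.
  by move: hS; rewrite -id cntS id; case: (m i) => // hS; lia.
by move: hS; rewrite -id cntS id; case: (m i) => /= hS; lia.
Qed.

End WordArcs.

Section Matching.
Variables (N : nat) (M : {set Arc N}).
Hypothesis stdM : std_noncrossing M.
Implicit Types (a b : Arc N) (i : 'I_N) (c d : nat).

Lemma arc_lt a : a \in M -> a.1 < a.2.
Proof.
by case/and3P: stdM => /andP[/'forall_implyP h _] _ _; apply: h.
Qed.

Lemma arc_eq a b : a \in M -> b \in M ->
  [\/ a.1 = b.1 :> nat, a.1 = b.2 :> nat, a.2 = b.1 :> nat | a.2 = b.2 :> nat] -> a = b.
Proof.
case/and3P: stdM => /andP[_ /'forall_implyP h] _ _ aM bM.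
have /'forall_implyP /(_ b bM) /implyP := h a aM.
move=> h' e; apply/eqP; apply/negPn/negP => /h'.
by rewrite -!val_eqE /=; case: e => ->; rewrite eqxx ?andbF.
Qed.

Lemma arc_eq1 a b : a \in M -> b \in M -> a.1 = b.1 :> nat -> a = b.
Proof. by move=> aM bM e; apply: arc_eq => //; constructor 1. Qed.

Lemma arc_eq2 a b : a \in M -> b \in M -> a.2 = b.2 :> nat -> a = b.
Proof. by move=> aM bM e; apply: arc_eq => //; constructor 4. Qed.

Lemma arc_neq12 a b : a \in M -> b \in M -> a.1 <> b.2 :> nat.
Proof.
move=> aM bM e; have ab : a = b by apply: arc_eq => //; constructor 2.
by have := arc_lt aM; rewrite e ab; lia.
Qed.

Lemma arc_nc a b : a \in M -> b \in M -> b.1 < a.1 -> a.1 < b.2 -> a.2 < b.2.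
Proof.
case/and3P: stdM => _ /'forall_implyP h _ aM bM ba ab.
have /'forall_implyP /(_ b bM) := h a aM.
rewrite ba ab /= -leqNgt leq_eqVlt => /orP[/eqP e|//].
by move: ba; rewrite (@arc_eq2 a b) ?ltnn.
Qed.

Lemma startsP i : reflect (exists2 a : Arc N, a \in M & a.1 = i) (starts M i).
Proof.
apply: (iffP existsP) => [[a /andP[aM /eqP e]]|[a aM e]]; exists a => //.
by rewrite aM e eqxx.
Qed.

Lemma endsP i : reflect (exists2 a : Arc N, a \in M & a.2 = i) (ends M i).
Proof.
apply: (iffP existsP) => [[a /andP[aM /eqP e]]|[a aM e]]; exists a => //.
by rewrite aM e eqxx.
Qed.

Lemma starts_arc a : a \in M -> starts M a.1.
Proof. by move=> aM; apply/startsP; exists a. Qed.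

Lemma ends_arc a : a \in M -> ends M a.2.
Proof. by move=> aM; apply/endsP; exists a. Qed.

Lemma starts_ends i : starts M i -> ends M i = false.
Proof.
case/startsP => a aM <-; apply/negbTE/negP => /endsP[b bM e].
by have := arc_neq12 aM bM; rewrite e.
Qed.

Lemma arc_std a i : a \in M -> a.1 < i < a.2 -> on_no_arc M i = false.
Proof.
case/and3P: stdM => _ _ /'forall_implyP h aM ai.
by have /'forall_implyP /(_ i ai) /negbTE := h a aM.
Qed.

(** Positions count from 0, so the gap [c] separates the positions c - 1 and [c]. *)
Definition covers b c := (b.1 < c) && (c <= b.2).

Lemma covers_start a b : a \in M -> b \in M ->
  covers b a.1.+1 = (b == a) || covers b a.1.
Proof.
move=> aM bM; rewrite /covers; have := arc_neq12 aM bM.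
have := arc_lt aM; case: eqVneq => [->|ba] /=; first lia.
have : b.1 <> a.1 :> nat by move=> /(arc_eq1 bM aM) /eqP; apply/negP.
lia.
Qed.

Lemma covers_end a b : a \in M -> b \in M ->
  covers b a.2 = (b == a) || covers b a.2.+1.
Proof.
move=> aM bM; rewrite /covers; have := arc_neq12 bM aM.
have := arc_lt aM; case: eqVneq => [->|ba] /=; first lia.
have : b.2 <> a.2 :> nat by move=> /(arc_eq2 bM aM) /eqP; apply/negP.
lia.
Qed.

Lemma covers_unmatched b i : on_no_arc M i -> b \in M -> covers b i = false.
Proof.
move=> ni bM; apply/negP => /andP[b1 b2].
have e2 : i <> b.2 :> nat.
  by move=> /val_inj e; move: ni; rewrite /on_no_arc e ends_arc // andbF.
have := @arc_std b i bM; rewrite ni; lia.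
Qed.

Lemma covers_unmatchedS b i : on_no_arc M i -> b \in M -> covers b i.+1 = false.
Proof.
move=> ni bM; apply/negP => /andP[b1 b2].
have e1 : i <> b.1 :> nat.
  by move=> /val_inj e; move: ni; rewrite /on_no_arc e starts_arc.
have := @arc_std b i bM; rewrite ni; lia.
Qed.

Lemma covers_arc a b : a \in M -> b \in M -> covers b a.1 = covers b a.2.+1.
Proof.
move=> aM bM; rewrite /covers.
have [->|/eqP ba] := eqVneq b a; first by have := arc_lt aM; lia.
have := arc_lt aM; have := arc_lt bM.
have := @arc_nc a b aM bM; have := @arc_nc b a bM aM.
have := arc_neq12 aM bM; have := arc_neq12 bM aM.
have : b.1 <> a.1 :> nat by move=> /(arc_eq1 bM aM).
have : b.2 <> a.2 :> nat by move=> /(arc_eq2 bM aM).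
lia.
Qed.

Lemma nested_aboveE a b : a \in M -> b \in M -> nested_above b a = covers b a.1.
Proof.
move=> aM bM; rewrite /covers /nested_above.
have [->|/eqP ba] := eqVneq b a; first by have := arc_lt aM; lia.
have := arc_lt aM; have := arc_lt bM.
have := @arc_nc a b aM bM; have := @arc_nc b a bM aM.
have := arc_neq12 aM bM; have := arc_neq12 bM aM.
have : b.1 <> a.1 :> nat by move=> /(arc_eq1 bM aM).
have : b.2 <> a.2 :> nat by move=> /(arc_eq2 bM aM).
lia.
Qed.

(* Both the gaps enclosed by a given arc only and the gaps enclosed by no arc
   are reached by jumping over arcs and unmatched positions. *)
Lemma chain_ind (P : nat -> Prop) lo c : lo <= c <= N ->
  (forall b, b \in M -> lo <= b.1 -> covers b c = false) ->
  (forall b, b \in M -> b.1 < lo -> lo <= b.2 -> c <= b.2) ->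
  P lo ->
  (forall i, lo <= i < c -> on_no_arc M i -> P i -> P i.+1) ->
  (forall b, b \in M -> lo <= b.1 -> b.2 < c -> P b.1 -> P b.2.+1) ->
  P c.
Proof.
move=> loc hc hlo P0 PS PM.
(* Strong induction through a bound [e], since a jump over an arc goes from [b.2.+1] back to
   [b.1]. *)
suff : forall e d, d <= e -> lo <= d <= c ->
    (forall b, b \in M -> lo <= b.1 -> covers b d = false) -> P d.
  by move=> /(_ c c); apply => //; case/andP: loc => ->; rewrite leqnn.
elim=> [|e IH] d de ldc hd.
  by have -> : d = lo by lia.
have [->//|ld] : d = lo \/ lo < d by lia.
case: d => // d in de ldc hd ld *.
have dN : d < N by lia.
have [i id] : exists i : 'I_N, i = d :> nat by exists (Ordinal dN).
have [ni|] := boolP (on_no_arc M i).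
  rewrite -id; apply: (PS i) => //; first by lia.
  apply: IH; [lia|lia|move=> b bM _; exact: (@covers_unmatched b i)].
rewrite negb_and !negbK => /orP[/startsP[b bM bi]|/endsP[b bM bi]].
  by have := hd b bM; have := arc_lt bM; rewrite /covers bi id; lia.
have ed : d = b.2 by rewrite bi id.
have lob : lo <= b.1.
  rewrite leqNgt; apply/negP => blo; have := hlo b bM blo; rewrite -ed; lia.
rewrite ed; apply: PM => //; first by move: ldc => /andP[_]; rewrite ed.
have ltb := arc_lt bM; rewrite -ed in ltb.
apply: IH; [lia|lia|].
by move=> b' bM' /(hd b' bM'); rewrite ed covers_arc.
Qed.

Section Depth.

Definition depth c := #|[set b in M | covers b c]|.

Lemma depthS i : depth i.+1 + ends M i = depth i + starts M i.
Proof.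
have [/startsP[a aM <-]|ns] := boolP (starts M i).
  rewrite starts_ends ?starts_arc // addn0 addn1 /depth (cardsD1 a) inE aM.
  rewrite covers_start // eqxx /= add1n; congr _.+1.
  apply: eq_card => b; rewrite !inE.
  case bM: (b \in M); rewrite ?andbF //= covers_start //.
  by case: eqVneq => //= ->; rewrite /covers ltnn.
have [/endsP[a aM <-]|ne] := boolP (ends M i).
  rewrite addn0 addn1 /depth [in RHS](cardsD1 a) inE aM.
  rewrite [in RHS]covers_end // eqxx /= add1n; congr _.+1.
  apply: eq_card => b; rewrite !inE.
  case bM: (b \in M); rewrite ?andbF //= covers_end //.
  by case: eqVneq => //= ->; rewrite /covers ltnn andbF.
rewrite !addn0; apply: eq_card => b; rewrite !inE.
case bM: (b \in M) => //=.
have ni : on_no_arc M i by rewrite /on_no_arc ns.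
by rewrite (covers_unmatched ni) // (covers_unmatchedS ni).
Qed.

Lemma depth_ends c : c <= N -> depth c + cnt (ends M) c = cnt (starts M) c.
Proof.
move: c; apply: gap_ind => [|i IH].
  rewrite !cnt0 addn0; apply: eq_card0 => b.
  by rewrite !inE /covers ltn0 andbF.
by rewrite !cntS; have := depthS i; lia.
Qed.

Lemma cnt_total c : c <= N ->
  cnt (starts M) c + cnt (ends M) c + cnt (on_no_arc M) c = c.
Proof.
move: c; apply: gap_ind => [|i IH]; first by rewrite !cnt0.
rewrite !cntS {2}/on_no_arc; have := @starts_ends i.
by case: (starts M i) => [->|_] //; case: (ends M i) => /=; lia.
Qed.

Lemma cnt_starts_leq c : cnt (starts M) c <= #|M|.
Proof.
rewrite -(card_in_imset (f := fun a : Arc N => a.1)) //.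
  apply/subset_leq_card/fintype.subsetP => i; rewrite inE => /andP[_ /startsP[a aM <-]].
  by apply/imsetP; exists a.
by move=> a b aM bM /= e; apply: arc_eq1 => //; rewrite e.
Qed.

Lemma cnt_starts : cnt (starts M) N = #|M|.
Proof.
apply/eqP; rewrite eqn_leq cnt_starts_leq -(card_in_imset (f := fun a : Arc N => a.1)) //.
  apply/subset_leq_card/fintype.subsetP => i /imsetP[a aM ->].
  by rewrite inE ltn_ord starts_arc.
by move=> a b aM bM /= e; apply: arc_eq1 => //; rewrite e.
Qed.

Lemma depthN : depth N = 0.
Proof.
by apply: eq_card0 => b; rewrite !inE /covers [N <= _]leqNgt !ltn_ord andbF.
Qed.

Lemma cnt_ends : cnt (ends M) N = #|M|.
Proof. by rewrite -cnt_starts -depth_ends // depthN. Qed.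

End Depth.

Section Word.
Variable n : nat.
Hypothesis cardM : #|M| <= minn n (N - n).
Hypothesis nN : n <= N.
Let k := #|M|.
Let T := cnt (word n M).
Let kle : k <= minn n (N - n) := cardM.
Let cntk : cnt (ends M) N = k := cnt_ends.

Lemma wordE i :
  word n M i = ends M i || (on_no_arc M i && (cnt (on_no_arc M) i < n - k)).
Proof.
rewrite /word ffunE /wM.
have := @starts_ends i; have := cntS (ends M) i; have := cnt_mono (ends M) (ltn_ord i).
rewrite -/k cntk [on_no_arc M i]/on_no_arc.
change (J_end M i) with (cnt (ends M) i); change (J_not M i) with (cnt (on_no_arc M) i).
have kn : k <= n by lia.
case: (starts M i) => [_ _ ->|] //=.
  by apply/negbTE; lia.
case: (ends M i) => /=; first lia.
by case: ifP => /=; lia.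
Qed.

Lemma word_starts i : starts M i -> word n M i = false.
Proof. by move=> si; rewrite wordE starts_ends // /on_no_arc si. Qed.

Lemma word_arc a : a \in M -> word n M a.1 = false /\ word n M a.2.
Proof.
by move=> aM; rewrite word_starts ?starts_arc // wordE ends_arc.
Qed.

Lemma cnt_word c : c <= N ->
  T c = cnt (ends M) c + minn (cnt (on_no_arc M) c) (n - k).
Proof.
move: c; apply: gap_ind => [|i IH]; first by rewrite /T !cnt0 min0n.
rewrite /T !cntS -/T IH wordE.
case e: (ends M i) => /=.
  have -> : on_no_arc M i = false by rewrite /on_no_arc e andbF.
  lia.
by case: (on_no_arc M i) => /=; lia.
Qed.

Lemma cnt_wordN : T N = n.
Proof.
rewrite cnt_word // cntk; have := cnt_total (leqnn N).
have := depth_ends (leqnn N); rewrite depthN cntk; lia.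
Qed.

(** The four cases of [wM] are really two: the letters T take the rows from 0 on and the letters B
    the rows from [n] on, each in the order of reading. *)
Lemma wME i : wM n M i = if word n M i then T i else n + (i - T i).
Proof.
have iN := ltnW (ltn_ord i).
rewrite cnt_word // wordE /wM -/k.
change (J_end M i) with (cnt (ends M) i); change (J_not M i) with (cnt (on_no_arc M) i).
change (J_beg M i) with (cnt (starts M) i).
have := cnt_total iN; have := @starts_ends i; rewrite [on_no_arc M i]/on_no_arc.
case: (starts M i) => [-> //|_] /=; first lia.
case: (ends M i) => //=; by case: ifP => /=; lia.
Qed.

(** No position under an arc is unmatched, so along it the height is [depth] up to a constant. *)
Lemma arc_warc a : a \in M -> warc (word n M) a.1 a.2.
Proof.
move=> aM; have lt := arc_lt aM; have aN := ltn_ord a.2.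
have eq0 c : a.1 <= c <= a.2.+1 -> cnt (on_no_arc M) a.1 = cnt (on_no_arc M) c.
  case/andP=> ac ca; apply: (eq_cnt_out ac) => i ni /andP[ai ic].
  have n1 : i <> a.1 :> nat.
    by move=> /val_inj e; move: ni; rewrite e /on_no_arc (starts_arc aM).
  have n2 : i <> a.2 :> nat.
    by move=> /val_inj e; move: ni; rewrite e /on_no_arc (ends_arc aM) andbF.
  have := @arc_std a i aM; rewrite ni; lia.
apply/warcP; split => //.
  have := cnt_word (ltn_ord a.2); have := cnt_word (ltnW (ltn_ord a.1)).
  rewrite -/T => -> ->.
  have := cnt_total (ltn_ord a.2); have := cnt_total (ltnW (ltn_ord a.1)).
  have := depth_ends (ltn_ord a.2); have := depth_ends (ltnW (ltn_ord a.1)).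
  have -> : depth a.2.+1 = depth a.1.
    by apply: eq_card => b; rewrite !inE; case bM: (b \in M) => //=; rewrite covers_arc.
  rewrite -(eq0 a.2.+1); lia.
move=> c ac; have cN : c <= N by lia.
have := cnt_word cN; have := cnt_word (ltnW (ltn_ord a.1)).
rewrite -/T => -> ->.
have := cnt_total cN; have := cnt_total (ltnW (ltn_ord a.1)).
have := depth_ends cN; have := depth_ends (ltnW (ltn_ord a.1)).
have : depth a.1 < depth c.
  rewrite /depth [X in _ < X](cardsD1 a) inE aM /covers ac add1n ltnS.
  apply/subset_leq_card/fintype.subsetP => b; rewrite !inE => /andP[bM].
  rewrite bM; case: eqVneq => [->|ba] /=; first by rewrite /covers ltnn.
  move=> /andP[b1 b2]; have := arc_nc aM bM; have := arc_neq12 aM bM; lia.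
rewrite -(eq0 c); lia.
Qed.

(** The doubtful case is an unmatched B at [a.1]. All unmatched letters T precede it, so from there
    on the path stays above H(a.1). *)
Lemma warc_arc a : warc (word n M) a.1 a.2 -> a \in M.
Proof.
move=> h; have [w1 w2] := warc_letters h.
have [/startsP[b bM e]|ns] := boolP (starts M a.1).
  have := arc_warc bM; rewrite e => /(warc_first h) e2.
  suff -> : a = b by [].
  by case: a b e e2 {h w1 w2 bM} => a1 a2 [b1 b2] /= -> ->.
have ni : on_no_arc M a.1.
  by move: w1; rewrite wordE /on_no_arc ns /=; case: (ends M a.1).
move: w1; rewrite wordE ni; case: (ends M _) => //=; rewrite -leqNgt => hn.
exfalso; case/warcP: h => lt e _; have aN := ltn_ord a.2.
have := cnt_word (ltn_ord a.2); have := cnt_word (ltnW (ltn_ord a.1)).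
have := cnt_total (ltn_ord a.2); have := cnt_total (ltnW (ltn_ord a.1)).
have := depth_ends (ltn_ord a.2); have := depth_ends (ltnW (ltn_ord a.1)).
have -> : depth a.1 = 0.
  apply: eq_card0 => b; rewrite !inE; case bM: (b \in M) => //=.
  exact: covers_unmatched.
have := cntS (on_no_arc M) a.1; rewrite ni.
have := cnt_mono (on_no_arc M) lt.
have := cnt_mono (on_no_arc M) (leqnSn a.2).
rewrite -/T in e *; lia.
Qed.

Lemma arcs_word : arcs (word n M) = M.
Proof.
apply/setP => a; rewrite inE; apply/idP/idP; [exact: warc_arc|exact: arc_warc].
Qed.

End Word.
End Matching.

Section WordMatching.
Variables (N : nat) (m : pred 'I_N).
Implicit Types (i t : 'I_N) (a b : Arc N).
Let M := arcs m.

Lemma in_arcs a : (a \in arcs m) = warc m a.1 a.2.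
Proof. by rewrite inE. Qed.

Lemma arcs_std : std_noncrossing (arcs m).
Proof.
apply/and3P; split.
- apply/andP; split; first by apply/'forall_implyP => a; rewrite in_arcs => /warcP[].
  apply/'forall_implyP => a; rewrite in_arcs => wa.
  apply/'forall_implyP => b; rewrite in_arcs => wb; apply/implyP => ab.
  have [a1 a2] := warc_letters wa; have [b1 b2] := warc_letters wb.
  apply/and4P; split; apply/eqP => e.
  + move: wa; rewrite e => /warc_first /(_ wb) e2.
    by case/negP: ab; case: a b e e2 {wb a1 a2 b1 b2} => a1 a2 [b1 b2] /= -> ->.
  + by move: a1; rewrite e b2.
  + by move: b1; rewrite -e a2.
  + move: wa; rewrite e => /warc_last /(_ wb) e1.
    by case/negP: ab; case: a b e e1 {wb a1 a2 b1 b2} => a1 a2 [b1 b2] /= -> ->.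
- apply/'forall_implyP => a; rewrite in_arcs => wa.
  apply/'forall_implyP => b; rewrite in_arcs => wb.
  by apply/negP => /and3P[]; apply: warc_nc wa wb.
apply/'forall_implyP => -[a1 a2]; rewrite in_arcs /= => wa.
apply/forallP => i; apply/implyP => /= /andP[ai ia].
case/warcP: (wa) => lt e h; rewrite /on_no_arc negb_and !negbK.
have aN := ltn_ord a2.
have [mi|mi] := boolP (m i); apply/orP.
  right; have [||t wt _] := @warc_end N m i a1 mi; [lia|by have := h i.+1; lia|].
  by apply/existsP; exists (t, i); rewrite in_arcs /= wt eqxx.
left; have [||t wt _] := @warc_start N m i a2.+1 mi; [lia|by have := h i; lia|].
by apply/existsP; exists (i, t); rewrite in_arcs /= wt eqxx.
Qed.

Lemma arcs_letters i : m i = ends M i || on_no_arc M i && m i.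
Proof.
rewrite /on_no_arc.
have [/endsP[a aM <-]|_] := boolP (ends M i).
  by move: aM; rewrite in_arcs => /warc_letters[].
have [/startsP[a aM <-]|_] := boolP (starts M i) => //=.
by move: aM; rewrite in_arcs => /warc_letters[/negbTE ->].
Qed.

(** If a B at [i] came before a T at [t], compare the height after [t] with the height before [i]:
    if it is at most the latter, the B has a partner, otherwise the T has one. *)
Lemma arcs_unmatched i t :
  on_no_arc M i -> on_no_arc M t -> ~~ m i -> m t -> t < i.
Proof.
move=> /andP[ni _] /andP[_ nt] mi mt; rewrite ltnNge leq_eqVlt; apply/negP.
case/orP=> [/eqP/val_inj e|it]; first by move: mi; rewrite e mt.
have [le|lt] := leqP (t.+1 + 2 * cnt m i) (i + 2 * cnt m t.+1).
  have [||t' wt _] := @warc_start N m i t.+1 mi; [by have := ltn_ord t; lia|exact: le|].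
  by case/existsP: ni; exists (i, t'); rewrite in_arcs /= wt eqxx.
have [||i' wi _] := @warc_end N m t i mt; try lia.
by case/existsP: nt; exists (i', t); rewrite in_arcs /= wi eqxx.
Qed.

Let U : pred 'I_N := fun i => on_no_arc M i && m i.

Let cntU c : c <= N -> cnt m c = cnt (ends M) c + cnt U c.
Proof.
move: c; apply: gap_ind => [|i IH]; first by rewrite !cnt0.
rewrite !cntS IH {1}arcs_letters /U /on_no_arc.
by case: (ends M i); rewrite ?andbF //=; lia.
Qed.

Variable n : nat.
Hypothesis cntm : cnt m N = n.

Let cardMU : n = #|M| + cnt U N.
Proof. by rewrite -(cnt_ends arcs_std) -cntm cntU. Qed.

Let leU c : cnt U c <= cnt (on_no_arc M) c.
Proof.
apply/subset_leq_card/fintype.subsetP => j; rewrite !inE.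
by case/and3P => -> ->.
Qed.

Lemma card_arcs : #|arcs m| <= minn n (N - n).
Proof.
have := cnt_total arcs_std (leqnn N); rewrite (cnt_starts arcs_std) (cnt_ends arcs_std).
by have := leU N; have := cardMU; rewrite /M; lia.
Qed.

(** By [arcs_unmatched] the unmatched letters read T..TB..B, and the number of these T is n - k, the
    threshold used by [wM]. *)
Lemma word_arcs : word n (arcs m) =1 m.
Proof.
have nN : n <= N by rewrite -cntm; apply: cnt_leq.
move=> i; rewrite (wordE arcs_std card_arcs nN) [RHS]arcs_letters -/M.
congr orb; case ni: (on_no_arc M i) => //=.
have -> : n - #|M| = cnt U N by rewrite {1}cardMU; lia.
have iN := ltn_ord i.
case mi: (m i).
  have -> : cnt (on_no_arc M) i = cnt U i.
    apply: eq_cnt => j ji; rewrite /U; case nj: (on_no_arc M j) => //=.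
    apply/esym/negPn/negP => mj.
    by have := arcs_unmatched nj ni mj mi; lia.
  apply: leq_trans (cnt_mono U iN).
  by rewrite cntS /U ni mi addn1.
apply/negbTE; rewrite -leqNgt; apply: leq_trans (leU i).
rewrite (@eq_cnt_out N U i N) ?(ltnW iN) // => j /andP[nj mj] /andP[ij _].
by have := arcs_unmatched ni nj (negbT mi) mj; lia.
Qed.

Lemma arcs_inj_word (M' : {set Arc N}) : std_noncrossing M' ->
  #|M'| <= minn n (N - n) -> word n M' =1 m -> M' = arcs m.
Proof.
have nN : n <= N by rewrite -cntm; apply: cnt_leq.
move=> sM' cM' wM'; rewrite -(arcs_word sM' cM' nN).
apply/setP => a; rewrite !inE; apply/idP/idP => h; apply: (eq_warc _ h) => j _; by rewrite wM'.
Qed.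

End WordMatching.

Section Cut.
Variables (N n : nat) (M : {set Arc N}).
Hypothesis stdM : std_noncrossing M.
Hypothesis cardM : #|M| <= minn n (N - n).
Hypothesis nN : n <= N.
Implicit Types (A : {set Arc N}) (a b : Arc N) (i : 'I_N).

Lemma cnt_cut_word A : cnt (cut_word n M A) N = n.
Proof.
rewrite -[RHS](cnt_wordN stdM cardM nN) /cnt.
pose s := (\prod_(a in A) tperm a.1 a.2)%g.
rewrite -(card_imset _ (@perm_inj _ s)); apply: eq_card => j.
apply/imsetP/idP => [[i + ->]|]; rewrite !inE; first by rewrite !ltn_ord ffunE.
move=> /andP[_ wj]; exists ((s^-1)%g j); last by rewrite permKV.
by rewrite inE ltn_ord ffunE -/s permKV.
Qed.

(** [pick] succeeds by [word_arcs] and has a single candidate by [arcs_inj_word], so the default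
    value of [cut] does not occur. *)
Lemma cutE A : cut n M A = arcs (cut_word n M A).
Proof.
rewrite /cut; case: pickP => [M' /and3P[sM' cM' /eqP wM']|/(_ (arcs (cut_word n M A)))] /=.
  by apply: (arcs_inj_word (cnt_cut_word A)) => // i; rewrite wM'.
rewrite arcs_std card_arcs ?cnt_cut_word //=; case/negP.
apply/eqP/ffunP => i; exact: (word_arcs (cnt_cut_word A)).
Qed.

Lemma prod_tperm A a : A \subset M -> a \in A ->
  ((\prod_(b in A) tperm b.1 b.2)%g a.1 = a.2) *
  ((\prod_(b in A) tperm b.1 b.2)%g a.2 = a.1).
Proof.
move=> AM aA.
(* The supports are disjoint, so the product acts on [i] through the only arc with an end at [i];
   stating this for lists permits induction. *)
have key (s : seq (Arc N)) i : uniq s -> {subset s <= M} ->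
    (\prod_(b <- s) tperm b.1 b.2)%g i =
    if [pick b in s | (b.1 == i) || (b.2 == i)] is Some b then
      if b.1 == i then b.2 else b.1 else i.
  elim: s i => [|b s IH] i /=; first by rewrite big_nil perm1; case: pickP.
  move=> /andP[bs us] sM; rewrite big_cons permM.
  have bM : b \in M by apply: sM; rewrite inE eqxx.
  have sM' : {subset s <= M} by move=> c cs; apply: sM; rewrite inE cs orbT.
  have out j : (b.1 == j) || (b.2 == j) ->
      [pick c in s | (c.1 == j) || (c.2 == j)] = None.
    move=> bj; case: pickP => // c /andP[cs cj].
    suff e : b = c by move: bs; rewrite e cs.
    apply: (arc_eq stdM) => //; first exact: sM'.
    by case/orP: bj => /eqP->; case/orP: cj => /eqP->; [constructor 1|constructor 2|constructor 3|constructor 4].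
  rewrite {}IH //; have b12 : b.1 != b.2.
    by apply/eqP => e; have := arc_lt stdM bM; rewrite e ltnn.
  case: tpermP => [->|->|/eqP i1 /eqP i2].
  - rewrite out ?eqxx ?orbT //; case: pickP => [c /andP[cs cj]|/(_ b)].
      suff <- : b = c by rewrite eqxx.
      apply: (arc_eq stdM) => //; first exact: sM.
      by case/orP: cj => /eqP->; [constructor 1|constructor 2].
    by rewrite inE !eqxx.
  - rewrite out ?eqxx //; case: pickP => [c /andP[cs cj]|/(_ b)].
      suff <- : b = c by rewrite (negbTE b12).
      apply: (arc_eq stdM) => //; first exact: sM.
      by case/orP: cj => /eqP->; [constructor 3|constructor 4].
    by rewrite inE !eqxx orbT.
  rewrite (@eq_pick _ _ (fun c => (c \in b :: s) && ((c.1 == i) || (c.2 == i)))) //.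
  move=> c /=; rewrite in_cons; case cb: (c == b) => //=; move/eqP: cb => ->.
  by rewrite ![_ == i]eq_sym (negbTE i1) (negbTE i2) (negbTE bs).
pose s := [seq b <- index_enum (Arc N) | b \in A].
have pE j : (\prod_(b in A) tperm b.1 b.2)%g j = (\prod_(b <- s) tperm b.1 b.2)%g j.
  by rewrite big_filter.
have mem_s b : (b \in s) = (b \in A) by rewrite mem_filter mem_index_enum andbT.
have us : uniq s by rewrite filter_uniq ?index_enum_uniq.
have sM : {subset s <= M} by move=> b; rewrite mem_s => /(fintype.subsetP AM).
have aM : a \in M by apply: (fintype.subsetP AM).
split; rewrite pE key //; (case: pickP => [c /andP[cA cj]|/(_ a)]);
  rewrite ?mem_s ?aA ?eqxx ?orbT //.
- suff <- : a = c by rewrite eqxx.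
  apply: (arc_eq stdM) => //; first exact: sM.
  by case/orP: cj => /eqP->; [constructor 1|constructor 2].
suff <- : a = c.
  by case: eqP => // e; have := arc_lt stdM aM; rewrite e ltnn.
apply: (arc_eq stdM) => //; first exact: sM.
by case/orP: cj => /eqP->; [constructor 3|constructor 4].
Qed.

Lemma prod_tperm_out A i : A \subset M ->
  (forall a, a \in A -> a.1 != i /\ a.2 != i) ->
  (\prod_(b in A) tperm b.1 b.2)%g i = i.
Proof.
move=> AM h; rewrite -big_filter; set s := [seq _ <- _ | _].
have : forall a : Arc N, a \in s -> a.1 != i /\ a.2 != i.
  by move=> a; rewrite mem_filter => /andP[+ _]; apply: h.
elim: s => [|b s IH] hs; first by rewrite big_nil perm1.
rewrite big_cons permM; have [b1 b2] := hs b (mem_head _ _).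
by rewrite tpermD // IH // => a as_; apply: hs; rewrite inE as_ orbT.
Qed.

Lemma cut_wordE A i :
  cut_word n M A i = word n M ((\prod_(a in A) tperm a.1 a.2)%g i).
Proof. by rewrite /cut_word ffunE. Qed.

Lemma cut_word_arc A a : A \subset M -> a \in A ->
  (cut_word n M A a.1 = true) * (cut_word n M A a.2 = false).
Proof.
move=> AM aA; have aM : a \in M by apply: (fintype.subsetP AM).
have [w1 w2] := word_arc stdM cardM nN aM.
by rewrite !cut_wordE !(prod_tperm AM aA) w1 w2.
Qed.

Lemma cut_word_out A i : A \subset M ->
  (forall a, a \in A -> a.1 != i /\ a.2 != i) -> cut_word n M A i = word n M i.
Proof. by move=> AM h; rewrite cut_wordE prod_tperm_out. Qed.

Lemma cut0 : cut n M finset.set0 = M.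
Proof.
rewrite cutE -[RHS](arcs_word stdM cardM nN).
apply/setP => a; rewrite !inE; apply/idP/idP => h; apply: (eq_warc _ h) => j _;
  by rewrite cut_word_out ?finset.sub0set // => b; rewrite inE.
Qed.

End Cut.

(** * The stack of values read along a word *)

Section Cover.
Variables (N : nat) (M : {set Arc N}).
Hypothesis stdM : std_noncrossing M.
Implicit Types (a b : Arc N) (i : 'I_N) (c : nat).

(** The innermost arc around the gap [c]. It extends [parent] from arcs to gaps: the arcs nested
    above [a] are those around the gap before [a]. *)
Definition cov c : option (Arc N) :=
  [pick b in M | covers b c && [forall d in M, covers d c ==> (d.1 <= b.1)]].

Lemma cov_SomeP c b : cov c = Some b ->
  [/\ b \in M, covers b c & forall d, d \in M -> covers d c -> d.1 <= b.1].
Proof.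
rewrite /cov; case: pickP => // e /and3P[bM bc /'forall_implyP h] [<-].
by split => // d dM; apply/implyP/h.
Qed.

Lemma cov_Some c b : b \in M -> covers b c ->
  (forall d : Arc N, d \in M -> covers d c -> d.1 <= b.1) -> cov c = Some b.
Proof.
move=> bM bc h; rewrite /cov; case: pickP => [b' /and3P[b'M b'c /'forall_implyP h']|/(_ b)].
  congr Some; apply: (arc_eq1 stdM) => //; apply/eqP.
  by rewrite eqn_leq h //; have /implyP -> := h' b bM.
by rewrite bM bc /= => /negP; case; apply/'forall_implyP => d dM; apply/implyP/h.
Qed.

Lemma cov_None c : (forall b, b \in M -> covers b c = false) -> cov c = None.
Proof.
by move=> h; rewrite /cov; case: pickP => // b /and3P[bM]; rewrite h.
Qed.

Lemma cov_NoneP c b : cov c = None -> b \in M -> covers b c = false.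
Proof.
move=> cN bM; apply/negP => bc.
pose P : pred (Arc N) := [pred d | (d \in M) && covers d c].
have Pb : P b by apply/andP.
case: (@arg_maxnP _ b P (fun d : Arc N => d.1 : nat) Pb) => d /andP[dM dc] h.
by rewrite (@cov_Some c d) // in cN => e eM ec; apply: h; apply/andP.
Qed.

Lemma eq_cov c c' :
  (forall b, b \in M -> covers b c = covers b c') -> cov c = cov c'.
Proof.
move=> h; apply: eq_pick => b /=; case bM: (b \in M) => //=; rewrite h //.
congr andb; apply: eq_forallb_in => d dM; by rewrite h.
Qed.

Lemma parentE a : a \in M -> parent M a = cov a.1.
Proof.
move=> aM; apply: eq_pick => b /=; case bM: (b \in M) => //=.
rewrite (nested_aboveE stdM) //.
by congr andb; apply: eq_forallb_in => d dM; rewrite (nested_aboveE stdM).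
Qed.

Lemma cov_start a : a \in M -> cov a.1.+1 = Some a.
Proof.
move=> aM; apply: cov_Some => // [|d dM]; rewrite (covers_start stdM) ?eqxx //.
by case/orP => [/eqP -> //|/andP[/ltnW]].
Qed.

Lemma cov_end a : a \in M -> cov a.2 = Some a.
Proof.
move=> aM; apply: cov_Some => // [|d dM]; rewrite (covers_end stdM) ?eqxx //.
rewrite -(covers_arc stdM) //.
by case/orP => [/eqP -> //|/andP[/ltnW]].
Qed.

Lemma cov_arc a : a \in M -> cov a.2.+1 = cov a.1.
Proof. by move=> aM; apply: eq_cov => b bM; rewrite -(covers_arc stdM). Qed.

Lemma cov_unmatched i : on_no_arc M i -> cov i = None.
Proof. by move=> ni; apply: cov_None => b bM; apply: (covers_unmatched stdM). Qed.

Lemma cov_unmatchedS i : on_no_arc M i -> cov i.+1 = None.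
Proof. by move=> ni; apply: cov_None => b bM; apply: (covers_unmatchedS stdM). Qed.

Lemma covN : cov N = None.
Proof.
by apply: cov_None => b bM; rewrite /covers [N <= _]leqNgt !ltn_ord andbF.
Qed.

End Cover.

Section Stack.
Variables (N : nat) (F : nmodType).
Implicit Types (m : pred 'I_N) (x : 'I_N -> F) (i t : 'I_N) (c j k : nat).

(* Reading the word m, a letter B at position i pushes x i on an infinite stack
   of zeros, and a letter T pops. *)
Fixpoint stack m x (c : nat) : nat -> F :=
  if c is c'.+1 then
    if insub c' is Some i then fun j =>
      if m i then stack m x c' j.+1 else if j is j'.+1 then stack m x c' j' else x i
    else stack m x c'
  else fun=> 0%R.

Lemma stackS m x i j : stack m x i.+1 j =
  if m i then stack m x i j.+1 else if j is j'.+1 then stack m x i j' else x i.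
Proof. by rewrite /= valK. Qed.

Lemma eq_stack m m' x x' c :
  c <= N -> (forall i, i < c -> m i = m' i) ->
  (forall i, i < c -> ~~ m i -> x i = x' i) -> stack m x c =1 stack m' x' c.
Proof.
move: c; apply: gap_ind => [//|i IH] hm hx.
have {}IH : stack m x i =1 stack m' x' i.
  by apply: IH => j ji; [apply: hm|apply: hx]; apply: ltnW.
move=> j; rewrite !stackS -hm //; case: ifP => [_|/negbT mi]; first exact: IH.
by case: j => [|j]; [apply: hx|apply: IH].
Qed.

(** Until the arc is closed the height does not go below H(i), so nothing present on the stack at
    [i] is popped: it lies under [k] newer values. *)
Lemma stack_above m x i t c j k : warc m i t -> i <= c <= t.+1 ->
  c + 2 * cnt m i = i + 2 * cnt m c + k -> stack m x c (j + k) = stack m x i j.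
Proof.
move=> /warcP[it e h]; have tN := ltn_ord t.
have H : forall c, c <= N -> i <= c <= t.+1 -> forall k,
    c + 2 * cnt m i = i + 2 * cnt m c + k -> stack m x c (j + k) = stack m x i j.
  apply: gap_ind => [|d IH idt k'].
    rewrite leqn0 => /andP[/eqP i0 _] k'; rewrite !i0 !cnt0 => k'0.
    by have -> : k' = 0; [lia|rewrite addn0].
  have [id|id] : i = d.+1 :> nat \/ i <= d by lia.
    by rewrite id => k'0; have -> : k' = 0; [lia|rewrite addn0].
  rewrite stackS cntS; have := h d; case: (m d) => /= hd hk.
    by rewrite -addnS; apply: IH; lia.
  case: k' hk => [|k'] hk.
    have := @cnt_leq N m d; have [->|] : i = d :> nat \/ i < d by lia.
      by lia.
    by lia.
  by rewrite addnS; apply: IH; lia.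
by move=> ict; apply: H => //; lia.
Qed.

Lemma stack_arc m x i t : warc m i t -> stack m x t.+1 =1 stack m x i.
Proof.
move=> w j; have [it e _] := warcP _ _ _ w.
by rewrite -[j in LHS]addn0; apply: stack_above w _ _; lia.
Qed.

(** There are at most as many nonzero levels as letters B read. *)
Lemma stack_bot m x c j : c <= N -> c <= cnt m c + j -> stack m x c j = 0%R.
Proof.
move=> cN; move: c cN j; apply: gap_ind => // i IH j.
have := cnt_leq m (ltnW (ltn_ord i)).
rewrite cntS stackS; case: (m i) => /= h hj; first by apply: IH; lia.
by case: j hj => [|j] hj; [lia|apply: IH; lia].
Qed.

(** Backwards from the end: each T still to come removes one level, so a value deeper than their
    number would be left on the final stack. *)
Lemma stack_top m x c j : c <= N -> stack m x N =1 (fun=> 0%R) ->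
  cnt m N <= cnt m c + j -> stack m x c j = 0%R.
Proof.
move=> cN stN; suff H : forall e c, c <= N -> N - c <= e ->
    forall j, cnt m N <= cnt m c + j -> stack m x c j = 0%R.
  exact: (H (N - c)).
elim=> [|e IH] {cN j} d dN de j hj.
  by have -> : d = N by lia.
have [->//|ltd] : d = N \/ d < N by lia.
have [i id] : exists i : 'I_N, i = d :> nat by exists (Ordinal ltd).
have := stackS m x i; have := cntS m i; rewrite id; have := cnt_mono m ltd.
case: (m i) => h1 h2 h3.
  by case: j hj => [|j] hj; [lia|rewrite -h3; apply: IH; lia].
by rewrite -[LHS](h3 j.+1); apply: IH; lia.
Qed.

End Stack.

Arguments stack {N F} m x c _ : simpl never.

Lemma iter_obind_None (T : Type) (f : T -> option T) j : iter j (obind f) None = None.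
Proof. by elim: j => //= j ->. Qed.

Section StackOfMatching.
Variables (N n : nat) (F : nmodType) (M : {set Arc N}).
Hypothesis stdM : std_noncrossing M.
Hypothesis cardM : #|M| <= minn n (N - n).
Hypothesis nN : n <= N.
Implicit Types (a b : Arc N) (u : Arc N -> F) (i : 'I_N) (c j : nat).

Definition xof (M' : {set Arc N}) u i : F :=
  if [pick b in M' | b.1 == i] is Some b then u b else 0%R.

Lemma xof_start u a : a \in M -> xof M u a.1 = u a.
Proof.
move=> aM; rewrite /xof; case: pickP => [b /andP[bM /eqP e]|/(_ a)].
  by congr u; apply: (arc_eq1 stdM) => //; rewrite e.
by rewrite aM eqxx.
Qed.

Lemma xof_out u i : ~~ starts M i -> xof M u i = 0%R.
Proof.
move=> ns; rewrite /xof; case: pickP => // b /andP[bM /eqP e].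
by move: ns; rewrite -e starts_arc.
Qed.

(** An arc pushes at its start and pops at its end, so the stack lists the values of the arcs around
    the gap, innermost first. This is the chain of ancestors that [f_mx] writes into a column.
    Unmatched positions move zeros only. *)
Lemma stack_cov u c j : c <= N ->
  stack (word n M) (xof M u) c j = oapp u 0%R (iter j (obind (parent M)) (cov M c)).
Proof.
move=> cN; move: c cN j; apply: gap_ind => [|i IH] j.
  by rewrite cov_None ?iter_obind_None // => b bM.
rewrite stackS (wordE stdM cardM nN).
have [/endsP[a aM ai]|ne] := boolP (ends M i).
  by rewrite -ai in IH *; rewrite /= cov_arc // -parentE // IH cov_end // iterSr.
have [/startsP[a aM ai]|ns] := boolP (starts M i).
  rewrite -ai in IH *; rewrite [on_no_arc _ _]/on_no_arc starts_arc //= cov_start //.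
  by case: j => [|j]; [rewrite xof_start|rewrite iterSr IH /= parentE].
have ni : on_no_arc M i by rewrite /on_no_arc ns.
rewrite (cov_unmatchedS stdM ni) iter_obind_None.
case: ifP => _; first by rewrite IH (cov_unmatched stdM ni) iter_obind_None.
by case: j => [|j]; [rewrite xof_out|rewrite IH (cov_unmatched stdM ni) iter_obind_None].
Qed.

Lemma stack_covN u : stack (word n M) (xof M u) N =1 (fun=> 0%R).
Proof.
by move=> j; rewrite stack_cov // covN iter_obind_None.
Qed.

Lemma stack_cov0 u c : c <= N -> cov M c = None ->
  stack (word n M) (xof M u) c =1 (fun=> 0%R).
Proof.
by move=> cN c0 j; rewrite stack_cov // c0 iter_obind_None.
Qed.

End StackOfMatching.

(** * Cutting arcs *)

Section CutOne.
Variables (N : nat) (m m' : pred 'I_N) (a : Arc N).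
Hypothesis wa : warc m a.1 a.2.
Hypothesis m'1 : m' a.1.
Hypothesis m'2 : ~~ m' a.2.
Hypothesis m'out : forall i, i != a.1 -> i != a.2 -> m' i = m i.
Implicit Types (b p : Arc N) (i : 'I_N) (c d : nat).

Local Notation M := (arcs m).
Local Notation M' := (arcs m').
Local Notation stdM := (arcs_std m).
#[local] Lemma aM : a \in M. Proof. by rewrite in_arcs. Qed.
#[local] Lemma m1 : m a.1 = false. Proof. by have [/negbTE] := warc_letters wa. Qed.
#[local] Lemma m2 : m a.2. Proof. by have [] := warc_letters wa. Qed.

(** In terms of heights, the cut lowers the path by 2 at the gaps under [a] and nowhere else. *)
Lemma cnt_cut1 c : c <= N -> cnt m' c = cnt m c + (a.1 < c <= a.2).
Proof.
have [lt _ _] := warcP _ _ _ wa.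
move: c; apply: gap_ind => [|i IH]; first by rewrite !cnt0.
rewrite !cntS IH; case: (eqVneq i a.1) => [->|i1]; first by rewrite m'1 m1; lia.
case: (eqVneq i a.2) => [->|i2]; first by rewrite (negbTE m'2) m2; lia.
rewrite m'out //; move: i1 i2; rewrite -!val_eqE /=; lia.
Qed.

Section Parent.
Variable p : Arc N.
Hypothesis pE : parent M a = Some p.

#[local] Lemma pM : p \in M. Proof. by move: pE; rewrite (parentE stdM aM) => /cov_SomeP[]. Qed.
#[local] Lemma pa : covers p a.1. Proof. by move: pE; rewrite (parentE stdM aM) => /cov_SomeP[]. Qed.
#[local] Lemma pmax b : b \in M -> covers b a.1 -> b.1 <= p.1.
Proof. by move: pE; rewrite (parentE stdM aM) => /cov_SomeP[_ _]; apply. Qed.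
#[local] Lemma wp : warc m p.1 p.2. Proof. by rewrite -in_arcs pM. Qed.

Lemma parent_nested : p.1 < a.1 /\ a.2 < p.2.
Proof. by move: pa; rewrite -(nested_aboveE stdM aM pM) => /andP. Qed.

(** The B that [height_start] finds before [a.1] starts an arc around [a]; no such arc starts after
    [p], so this B is at [p.1]. *)
Lemma parent_height : a.1 + 2 * cnt m p.1 = (p.1 + 2 * cnt m a.1).+1.
Proof.
have [pa1 ap2] := parent_nested.
case/warcP: (wp) => plt pe ph; case/warcP: (wa) => alt ae ah.
have [||i [pi_ mi hi imax]] := @height_start N m p.1 a.1.
- by rewrite pa1 ltnW.
- by apply: ph; rewrite pa1 ltnW // (ltn_trans alt).
case/andP: pi_ => pi_ ia; have hip : i < p.2.
  by apply: ltn_trans ia _; apply: ltn_trans alt ap2.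
move: (pi_); rewrite leq_eqVlt => /orP[/eqP -> //|pd'].
have [|| t wt tp] := @warc_start N m i p.2.+1 mi.
- by rewrite ltnS (ltnW hip) /=.
- by have := ph i; rewrite pd' (ltnW hip) => /(_ isT); clear -pe; lia.
have [_ te th] := warcP _ _ _ wt.
suff : covers (i, t) a.1.
  move=> /(pmax (b := (i, t))); rewrite in_arcs /= => /(_ wt).
  by rewrite leqNgt pd'.
rewrite /covers /= ia leqNgt; apply/negP => ta.
have /= it : i < t by have [] := warcP _ _ _ wt.
have := imax t.+1; rewrite ltnS (ltnW it) ta => /(_ isT).
by clear -te hi; lia.
Qed.

(** Cutting [a] splits its parent: the new T at [a.1] closes the arc opened at [p.1], and the new B
    at [a.2] is closed at [p.2]. These two arcs inherit the value of [p] in the recursion for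
    [lambda]. *)
Lemma cut_left : (p.1, a.1) \in M'.
Proof.
have [pa1 ap2] := parent_nested; have := parent_height.
case/warcP: (wp) => plt pe ph; case/warcP: (wa) => alt ae ah hp.
have aN := ltn_ord a.1; have aN2 := ltn_ord a.2; rewrite in_arcs; apply/warcP; split => //=.
  rewrite (cnt_cut1 aN) (cnt_cut1 (ltnW (ltn_ord p.1))) cntS m1 leqnn alt.
  have -> : (a.1 < p.1) = false by rewrite ltnNge ltnW.
  by clear -hp; lia.
move=> c /andP[pc ca]; rewrite (cnt_cut1 (ltnW (ltn_ord p.1))).
rewrite (cnt_cut1 (leq_trans ca (ltnW aN))).
have := ph c; rewrite pc (leq_trans ca) ?(ltnW (ltn_trans alt ap2)) // => /(_ isT).
have -> : (a.1 < c) = false by rewrite ltnNge ca.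
have -> : (a.1 < p.1) = false by rewrite ltnNge ltnW.
by rewrite /= !addn0.
Qed.

Lemma cut_right : (a.2, p.2) \in M'.
Proof.
have [pa1 ap2] := parent_nested; have := parent_height.
case/warcP: (wp) => plt pe ph; case/warcP: (wa) => alt ae ah hp.
have pN := ltn_ord p.2; have aN := ltn_ord a.2.
have := cntS m a.2; rewrite m2 => cS.
rewrite in_arcs; apply/warcP; split => //=.
  rewrite (cnt_cut1 (ltnW aN)) (cnt_cut1 pN) alt leqnn.
  have -> : (p.2 < a.2) = false by rewrite ltnNge ltnW.
  rewrite andbF /=.
  by clear -pe ae hp cS; lia.
move=> c /andP[ac cp]; have cN : c <= N by apply: leq_trans cp (ltnW pN).
rewrite (cnt_cut1 (ltnW aN)) (cnt_cut1 cN) alt leqnn.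
have -> : (c <= a.2) = false by rewrite leqNgt ac.
rewrite andbF /=.
have pc : p.1 < c by apply: ltn_trans pa1 (ltn_trans alt ac).
have := ph c; rewrite pc cp => /(_ isT).
by clear -pe ae hp cS; lia.
Qed.

End Parent.

(** Among the remaining arcs only those around [p] notice the drop by 2, and under [a] the path is
    at least 3 above the start of such an arc. *)
Lemma cut_other b : b \in M -> b <> a -> parent M a <> Some b -> b \in M'.
Proof.
rewrite !in_arcs => wb ba pb; have bM : b \in M by rewrite in_arcs.
have alt := arc_lt stdM aM; have blt := arc_lt stdM bM.
have [cb|ncb] := boolP (covers b a.1); last first.
  apply: eq_warc wb => j bj; rewrite m'out //; apply/eqP => e; subst j.
    case/negP: ncb; move: bj; rewrite /covers => /andP[].
    rewrite leq_eqVlt => /orP[/eqP e|-> -> //].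
    by case: ba; apply: (arc_eq1 stdM bM aM).
  case/negP: ncb; rewrite (covers_arc stdM aM bM) /covers ltnS.
  move: bj => /andP[-> /=]; rewrite leq_eqVlt => /orP[/eqP e|//].
  by case: ba; apply: (arc_eq2 stdM bM aM).
case pE: (parent M a) => [p|]; last first.
  by move: pE; rewrite (parentE stdM aM) => /(cov_NoneP stdM) /(_ bM); rewrite cb.
have [pM pc pmax] : [/\ p \in M, covers p a.1 &
    forall b, b \in M -> covers b a.1 -> b.1 <= p.1].
  by move: pE; rewrite (parentE stdM aM) => /cov_SomeP.
have bp : b.1 < p.1.
  rewrite ltn_neqAle pmax // andbT; apply/eqP => e; case: pb; rewrite pE.
  by congr Some; apply/esym/(arc_eq1 stdM).
have [pa1 ap2] := parent_nested pE; have hp := parent_height pE.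
have := cb; rewrite -(nested_aboveE stdM aM bM) => /andP[ba1 ab2].
case/warcP: (wb) => _ be bh; case/warcP: (wa) => _ ae ah.
have bN := ltn_ord b.2; apply/warcP; split => //.
  by rewrite !cnt_cut1 //; lia.
move=> c cb'; rewrite !cnt_cut1; [|lia|lia].
have := bh c; have := bh p.1; have := ah c; lia.
Qed.

Variable F : nmodType.
Implicit Types (u : Arc N -> F) (x : 'I_N -> F).

(** The T now at [a.1] pops the top value and the B now at [a.2] pushes it back, by the hypothesis
    on [x']; in between it is enough to follow the levels below it. *)
Lemma stack_cut_out x x' c : c <= N -> (c <= a.1) || (a.2 < c) ->
  (forall i, ~~ m' i -> x' i = if i == a.2 then stack m x a.1 0 else x i) ->
  stack m' x' c =1 stack m x c.
Proof.
move=> cN hc hx.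
have [alt ae ah] := warcP _ _ _ wa.
have lo d : d <= a.1 -> stack m' x' d =1 stack m x d.
  move=> da; apply: eq_stack => [|i id|i id mi].
  - by apply: leq_trans da (ltnW (ltn_ord _)).
  - by apply: m'out; apply/eqP => e; move: id; rewrite e; lia.
  - by rewrite hx //; case: eqP => // e; move: id; rewrite e; lia.
case/orP: hc => [|ac]; first exact: lo.
(* Here [k.+1] is the old height above H(a.1), hence [k] is the new height above H(a.1) - 1, the
   level reached after the pop. *)
have mid d : d <= N -> a.1 < d <= a.2 -> forall k j,
    d + 2 * cnt m a.1 = a.1 + 2 * cnt m d + k.+1 ->
    stack m' x' d (j + k) = stack m x a.1 j.+1.
  move: d; apply: gap_ind => // i IH ia k j.
  have [ei|ia'] : i = a.1 :> nat \/ a.1 < i by lia.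
    move/val_inj: ei => ->; rewrite cntS m1 stackS m'1 lo // => hk.
    by have -> : k = 0; [lia|rewrite addn0].
  have i1 : i != a.1 by apply/eqP => e; move: ia'; rewrite e ltnn.
  have i2 : i != a.2 by apply/eqP => e; move: ia; rewrite e ltnn andbF.
  rewrite stackS cntS (m'out i1 i2); case: ifP => [mi|/negbT mi] /= hk.
    by rewrite -addnS; apply: IH; lia.
  have hi := ah i; case: k hk => [|k] hk; first by lia.
  by rewrite addnS; apply: IH; lia.
have end_ : stack m' x' a.2.+1 =1 stack m x a.1.
  case=> [|j]; rewrite stackS (negbTE m'2).
    by rewrite hx // eqxx.
  rewrite -[j in LHS]addn0; apply: mid; [exact: ltnW|lia|].
  by have := cntS m a.2; rewrite m2; lia.
suff hi : forall d, d <= N -> a.2 < d -> stack m' x' d =1 stack m x d by apply: hi.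
apply: gap_ind => // i IH ia.
have [ei|ia'] : i = a.2 :> nat \/ a.2 < i by lia.
  by move/val_inj: ei => -> j; rewrite end_ (stack_arc _ wa).
have i1 : i != a.1 by apply/eqP => e; move: ia'; rewrite e; lia.
have i2 : i != a.2 by apply/eqP => e; move: ia'; rewrite e ltnn.
move=> j; rewrite !stackS (m'out i1 i2); case: ifP => [_|/negbT mi]; first exact: IH.
by case: j => [|j]; [rewrite hx ?m'out // (negbTE i2)|apply: IH].
Qed.

Variable n : nat.
Hypothesis cntm : cnt m N = n.

(* The recursion defining lambda, in terms of the values pushed on the stack. *)
Lemma xof_cut u i : ~~ m' i ->
  xof M' (fun b => if b \in M then if b == a then 0%R else u b
          else if parent M a is Some p then
            if (b.1 == p.1) || (b.2 == p.2) then u p else 0%R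
          else 0%R) i =
  if i == a.2 then stack m (xof M u) a.1 0 else xof M u i.
Proof.
set u' := fun b => _; move=> m'i.
have nN : n <= N by rewrite -cntm cnt_leq.
have stdM' : std_noncrossing M' := arcs_std m'.
case: eqVneq => [e|i2].
  subst i; have -> : stack m (xof M u) a.1 0 = oapp u 0%R (parent M a).
    have cM : #|M| <= minn n (N - n) by apply: card_arcs.
    rewrite (parentE stdM aM) -(stack_cov stdM cM nN u 0 (ltnW (ltn_ord _))).
    by apply: eq_stack => //; [exact/ltnW|move=> j _; rewrite word_arcs].
  have a2out b : b.1 = a.2 -> (b \in M) = false.
    move=> e; apply/negP; rewrite in_arcs => /warc_letters[].
    by rewrite e m2.
  case pE: (parent M a) => [p|] /=.
    have := @xof_start N F M' stdM' u' _ (cut_right pE); rewrite /= => ->.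
    by rewrite /u' a2out // pE eqxx orbT.
  rewrite /xof; case: pickP => // b /andP[bM' /eqP e].
  by rewrite /u' a2out // pE.
have i1 : i != a.1 by apply/eqP => e; move: m'i; rewrite e m'1.
have [/startsP[b bM e]|ns] := boolP (starts M i).
  subst i; have ba : b <> a by move=> ba; move: i1; rewrite ba eqxx.
  (* When [b] is the parent of [a], the arc starting at [b.1] is now [(b.1, a.1)], which is not in M
     and receives [u b] through the clause on the parent. *)
  rewrite (xof_start stdM) //; case: (parent M a =P Some b) => [pE|/(cut_other bM ba) bM'].
    have := @xof_start N F M' stdM' u' _ (cut_left pE); rewrite /= => ->.
    have -> : u' (b.1, a.1) = u b => //.
    rewrite /u' pE eqxx /= ifF //; apply/negP; rewrite in_arcs => /warc_letters[_].
    by rewrite m1.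
  rewrite (xof_start stdM' _ bM') /u' bM; case: eqP => // e.
rewrite (xof_out _ ns) /xof; case: pickP => // b /andP[bM' /eqP e]; rewrite /u'.
have -> : (b \in M) = false.
  by apply/negP => bM; move: ns; rewrite -e starts_arc.
case pE: (parent M a) => [p|] //.
have pM : p \in M by move: pE; rewrite (parentE stdM aM) => /cov_SomeP[].
case: eqP => [e1|_] /=; first by move: ns; rewrite -e e1 starts_arc.
case: eqP => [e2|//]; move: i2.
have := arc_eq2 stdM' bM' (cut_right pE); rewrite /= e2 => /(_ erefl) e'.
by rewrite -e e' eqxx.
Qed.

End CutOne.

Lemma nested_above_asym N (a b : Arc N) : nested_above a b -> ~~ nested_above b a.
Proof. by rewrite /nested_above => /andP[ab _]; rewrite negb_and -leqNgt (ltnW ab). Qed.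

Lemma nested_above_trans N (a b d : Arc N) :
  nested_above a b -> nested_above b d -> nested_above a d.
Proof.
move=> /andP[ab ba] /andP[bd db]; apply/andP; split.
  exact: ltn_trans ab bd.
exact: ltn_trans db ba.
Qed.

Section CutMany.
Variables (N n : nat) (M : {set Arc N}).
Hypothesis stdM : std_noncrossing M.
Hypothesis cardM : #|M| <= minn n (N - n).
Hypothesis nN : n <= N.
Implicit Types (A : {set Arc N}) (a b : Arc N) (i : 'I_N) (c : nat) (rs : seq (Arc N)).

(** An arc that is neither [b] nor nested in [b] has no end between the ends of [b], so the letters
    there are intact. This is what the nesting order provides: each arc is still present when its
    turn to be cut comes. *)
Lemma warc_cut A b : A \subset M -> b \in M ->
  (forall a, a \in A -> a <> b /\ ~~ nested_above b a) ->
  warc (cut_word n M A) b.1 b.2.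
Proof.
move=> AM bM h; apply: eq_warc (arc_warc stdM cardM nN bM) => j bj.
rewrite cut_word_out // => a aA.
have aM : a \in M by apply: (fintype.subsetP AM).
have [ab nab] := h a aA; move: nab; rewrite /nested_above negb_and -!leqNgt.
have := arc_lt stdM aM; have := arc_lt stdM bM.
have := @arc_nc N M stdM a b aM bM; have := @arc_nc N M stdM b a bM aM.
have := arc_neq12 stdM aM bM; have := arc_neq12 stdM bM aM.
have : b.1 <> a.1 :> nat by move=> /(arc_eq1 stdM bM aM)/esym.
have : b.2 <> a.2 :> nat by move=> /(arc_eq2 stdM bM aM)/esym.
by move=> *; split; apply/eqP => e; subst j; lia.
Qed.

Lemma arc_outside a b : a \in M -> b \in M -> ~~ nested_above a b ->
  (b.1 <= a.1) || (a.2 < b.1) /\ (b.2.+1 <= a.1) || (a.2 < b.2.+1).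
Proof.
move=> aM bM; rewrite /nested_above.
have := @arc_nc N M stdM a b aM bM; have := @arc_nc N M stdM b a bM aM.
have := arc_neq12 stdM aM bM; have := arc_neq12 stdM bM aM.
have := arc_lt stdM aM; have := arc_lt stdM bM.
have : b.1 = a.1 :> nat -> b.2 = a.2 :> nat by move=> /(arc_eq1 stdM bM aM) ->.
by clear; move=> *; split; lia.
Qed.

Lemma cut_word_setU1 A a i : (a |: A)%SET \subset M -> i != a.1 -> i != a.2 ->
  cut_word n M (a |: A)%SET i = cut_word n M A i.
Proof.
move=> aAM i1 i2; have AM : A \subset M by apply: fintype.subset_trans aAM; apply: subsetU1.
have [/existsP[b /andP[bA bi]]|nb] := boolP [exists b in A, (b.1 == i) || (b.2 == i)].
  have bA' : b \in (a |: A)%SET by rewrite inE bA orbT.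
  have [h1 h2] := cut_word_arc stdM cardM nN AM bA.
  have [h1' h2'] := cut_word_arc stdM cardM nN aAM bA'.
  by case/orP: bi => /eqP <-; rewrite ?h1 ?h2 ?h1' ?h2'.
have out b : b \in A -> b.1 != i /\ b.2 != i.
  move=> bA; apply/andP; rewrite -negb_or; apply: contra nb => bi.
  by apply/existsP; exists b; rewrite bA.
rewrite !cut_word_out // => b.
rewrite !inE => /orP[/eqP->|]; last exact: out.
by rewrite ![_ == i]eq_sym i1 i2.
Qed.

Variables (F : nmodType) (v : Arc N -> F).

Definition lam_val rs b : F := oapp v 0%R (lambda_rev n M rs b).

Lemma lam_val_cons rs a : lam_val (a :: rs) =
  (fun b => if b \in cut n M [set x in rs]%SET then
            if b == a then 0%R else lam_val rs b
          else if parent (cut n M [set x in rs]%SET) a is Some p then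
            if (b.1 == p.1) || (b.2 == p.2) then lam_val rs p else 0%R
          else 0%R).
Proof.
apply: boolp.funext => b; rewrite /lam_val /=; case: ifP => _; first by case: ifP.
by case: (parent _ _) => // p; case: ifP.
Qed.

Definition cut_seq_word rs : pred 'I_N := cut_word n M [set x in rs]%SET.
Definition cut_seq_val rs : 'I_N -> F := xof (cut n M [set x in rs]%SET) (lam_val rs).

(** The claims concern the arcs of [M], cut or not, and for this reason survive each cut: nothing
    changes outside of the arc [a] being cut, and an arc of [M] nested in [a] is still an arc of the
    current word. *)
Lemma cut_seq_inv rs : uniq rs -> {subset rs <= M} ->
  pairwise (fun a b => ~~ nested_above a b) rs ->
  let m := cut_seq_word rs in let x := cut_seq_val rs in
  [/\ forall b, b \in M -> b.2.+1 + 2 * cnt m b.1 = b.1 + 2 * cnt m b.2.+1 /\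
        stack m x b.2.+1 =1 stack m x b.1,
      forall c, c <= N -> cov M c = None ->
        cnt m c = cnt (word n M) c /\ stack m x c =1 (fun=> 0%R)
    & forall b, b \in M -> b \notin rs -> x b.1 = v b].
Proof.
elim: rs => [|a rs IH].
  move=> _ _ _ m x.
  have e0 : [set x in [::]]%SET = finset.set0 :> {set Arc N} by apply/setP => b; rewrite !inE.
  have mE : m =1 word n M.
    move=> i; rewrite /m /cut_seq_word e0 cut_word_out ?finset.sub0set //.
    by move=> b; rewrite inE.
  have xE : x = xof M v by rewrite /x /cut_seq_val e0 (cut0 stdM cardM nN).
  have cE c : cnt m c = cnt (word n M) c by apply: eq_cnt => i _; apply: mE.
  have sE c : c <= N -> stack m x c =1 stack (word n M) (xof M v) c.
    by move=> cN; apply: eq_stack => // i _ _; rewrite xE.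
  split=> [b bM|c cN c0|b bM _]; last by rewrite xE xof_start.
    have wb := arc_warc stdM cardM nN bM; have [_ e _] := warcP _ _ _ wb.
    rewrite !cE; split=> // j.
    by rewrite !sE ?(ltnW (ltn_ord _)) // (stack_arc _ wb).
  by split=> // j; rewrite sE // stack_cov0.
move=> /= /andP[ars urs] sM /andP[/allP aall prs].
have aM : a \in M by apply: sM; rewrite inE eqxx.
have sM' : {subset rs <= M} by move=> b brs; apply: sM; rewrite inE brs orbT.
have [I1 I2 I3] := IH urs sM' prs; move: I1 I2 I3.
set m := cut_seq_word rs; set x := cut_seq_val rs => I1 I2 I3.
set m' := cut_seq_word (a :: rs); set x' := cut_seq_val (a :: rs).
pose A := [set b in rs]%SET.
have eA : [set b in a :: rs]%SET = (a |: A)%SET by apply/setP => b; rewrite !inE.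
have AM : A \subset M by apply/fintype.subsetP => b; rewrite inE; apply: sM'.
have aAM : (a |: A)%SET \subset M.
  by apply/fintype.subsetP => b; rewrite !inE => /orP[/eqP-> //|]; apply: sM'.
have aA' : a \in (a |: A)%SET by rewrite !inE eqxx.
have wa : warc m a.1 a.2.
  apply: warc_cut => // b; rewrite inE => brs; split; last exact: aall.
  by move=> e; move: ars; rewrite -e brs.
have [h1 h2] := cut_word_arc stdM cardM nN aAM aA'.
have m'1 : m' a.1 by rewrite /m' /cut_seq_word eA h1.
have m'2 : ~~ m' a.2 by rewrite /m' /cut_seq_word eA h2.
have m'out i : i != a.1 -> i != a.2 -> m' i = m i.
  by move=> i1 i2; rewrite /m' /cut_seq_word eA cut_word_setU1.
have cntE := cnt_cut1 wa m'1 m'2 m'out.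
have xE i : ~~ m' i -> x' i = if i == a.2 then stack m x a.1 0 else x i.
  move=> mi; rewrite /x' /cut_seq_val lam_val_cons.
  have -> : cut n M [set b in a :: rs]%SET = arcs m' by rewrite cutE.
  rewrite !(cutE stdM cardM nN [set x in rs]%SET).
  rewrite (xof_cut wa m'1 m'2 m'out (cnt_cut_word stdM cardM nN A)) //.
  by rewrite /x /cut_seq_val cutE.
have stE c : c <= N -> (c <= a.1) || (a.2 < c) -> stack m' x' c =1 stack m x c.
  by move=> cN hc; apply: (stack_cut_out wa m'1 m'2 m'out).
have alt := arc_lt stdM aM; have aN := ltn_ord a.2.
split=> [b bM|c cN c0|b bM].
- have bN := ltn_ord b.2; have blt := arc_lt stdM bM.
  have [nab|nab] := boolP (nested_above a b).
    have wb : warc m' b.1 b.2.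
      rewrite /m' /cut_seq_word eA; apply: warc_cut => // d.
      rewrite !inE => /orP[/eqP->|drs].
        split=> [e|]; first by move: nab; rewrite e /nested_above ltnn.
        exact: nested_above_asym.
      have nad := aall d drs; split=> [e|]; first by move: nad; rewrite e nab.
      by apply: contra nad; apply: nested_above_trans.
    by have [_ e _] := warcP _ _ _ wb; split=> //; apply: stack_arc.
  have [o1 o2] := arc_outside aM bM nab.
  have [e1 e2] := I1 b bM; split.
    rewrite (cntE _ bN) (cntE _ (ltnW (ltn_ord b.1))).
    have -> : (a.1 < b.1 <= a.2) = false by clear -o1; lia.
    have -> : (a.1 < b.2.+1 <= a.2) = false by clear -o2; lia.
    by rewrite !addn0.
  by move=> j; rewrite !stE ?(ltnW (ltn_ord _)) // e2.
- have ca : covers a c = false by apply: (cov_NoneP stdM).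
  have oc : (c <= a.1) || (a.2 < c) by move: ca; rewrite /covers; clear; lia.
  have [e1 e2] := I2 c cN c0; split.
    rewrite cntE // e1; have -> : (a.1 < c <= a.2) = false by clear -oc; lia.
    exact: addn0.
  by move=> j; rewrite stE // e2.
rewrite inE negb_or => /andP[/eqP ba brs].
have b1a1 : b.1 != a.1 by apply/eqP => e; apply: ba; apply: (arc_eq1 stdM) => //; rewrite e.
have b1a2 : b.1 != a.2 by apply/eqP => e; apply: (arc_neq12 stdM bM aM); rewrite e.
rewrite xE ?(negbTE b1a2) ?I3 // m'out // /m /cut_seq_word.
rewrite (cut_word_out n AM) ?(word_arc stdM cardM nN bM).1 //.
move=> d; rewrite inE => drs; have dM := sM' _ drs.
split; apply/eqP => e; last by apply: (arc_neq12 stdM bM dM); rewrite e.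
by move: brs; rewrite -(_ : d = b) ?drs //; apply: (arc_eq1 stdM) => //; rewrite e.
Qed.

End CutMany.

(** * X-stable flags and their words *)

Import GRing.Theory.
Local Open Scope ring_scope.

Section TwoBlocks.
Variables (F : fieldType) (N n : nat).
Hypothesis nN : (n <= N)%N.
Implicit Types (u w e : 'cV[F]_N) (r b t c : nat) (V : {vspace 'cV[F]_N}).

Definition entry u r : F := if insub r is Some i then u i 0 else 0.

(* The coordinates of u in the two Jordan blocks, continued by 0, so that X
   shifts both sequences. *)
Definition fst_block u r : F := if (r < n)%N then entry u r else 0.
Definition snd_block u b : F := entry u (n + b).
Local Notation p := fst_block.
Local Notation q := snd_block.

Lemma entryE u (i : 'I_N) : entry u i = u i 0.
Proof. by rewrite /entry valK. Qed.

Lemma entry_out u r : (N <= r)%N -> entry u r = 0.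
Proof. by move=> Nr; rewrite /entry insubF // ltnNge Nr. Qed.

Lemma entryP a u w r : entry (a *: u + w) r = a * entry u r + entry w r.
Proof. by rewrite /entry; case: insub => [i|]; rewrite ?mxE ?mulr0 ?addr0. Qed.

Lemma fst_blockP a u w r : p (a *: u + w) r = a * p u r + p w r.
Proof. by rewrite /p; case: ifP => _; rewrite ?entryP ?mulr0 ?addr0. Qed.

Lemma snd_blockP a u w r : q (a *: u + w) r = a * q u r + q w r.
Proof. exact: entryP. Qed.

Lemma fst_block0 r : p 0 r = 0.
Proof. by have := fst_blockP (-1) 0 0 r; rewrite scaler0 addr0 mulN1r addNr. Qed.

Lemma snd_block0 r : q 0 r = 0.
Proof. by have := snd_blockP (-1) 0 0 r; rewrite scaler0 addr0 mulN1r addNr. Qed.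

Lemma fst_blockD u w r : p (u + w) r = p u r + p w r.
Proof. by rewrite -[u]scale1r fst_blockP mul1r scale1r. Qed.

Lemma snd_blockD u w r : q (u + w) r = q u r + q w r.
Proof. by rewrite -[u]scale1r snd_blockP mul1r scale1r. Qed.

Lemma fst_blockZ a u r : p (a *: u) r = a * p u r.
Proof. by rewrite -[a *: u]addr0 fst_blockP fst_block0 addr0. Qed.

Lemma snd_blockZ a u r : q (a *: u) r = a * q u r.
Proof. by rewrite -[a *: u]addr0 snd_blockP snd_block0 addr0. Qed.

Lemma fst_blockB u w r : p (u - w) r = p u r - p w r.
Proof. by rewrite fst_blockD -scaleN1r fst_blockZ mulN1r. Qed.

Lemma snd_blockB u w r : q (u - w) r = q u r - q w r.
Proof. by rewrite snd_blockD -scaleN1r snd_blockZ mulN1r. Qed.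

Lemma snd_block_sum (I : Type) (s : seq I) (P : pred I) (f : I -> 'cV[F]_N) r :
  q (\sum_(i <- s | P i) f i) r = \sum_(i <- s | P i) q (f i) r.
Proof. by apply: (big_morph (fun u => q u r)) => [u w|]; rewrite ?snd_blockD ?snd_block0. Qed.

Lemma fst_block_out u r : (n <= r)%N -> p u r = 0.
Proof. by rewrite /p ltnNge => ->. Qed.

Lemma snd_block_out u b : (N - n <= b)%N -> q u b = 0.
Proof. by move=> h; apply: entry_out; lia. Qed.

Lemma block_ext u w : (forall r, p u r = p w r) -> (forall b, q u b = q w b) -> u = w.
Proof.
move=> hp hq; apply/colP => i; rewrite -!entryE.
have [lt|ge] := ltnP i n; first by have := hp i; rewrite /p lt.
by have := hq (i - n)%N; rewrite /q subnKC.
Qed.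

Definition block_vec (f g : nat -> F) : 'cV[F]_N :=
  \col_i if (i < n)%N then f i else g (i - n)%N.

Lemma fst_block_vec f g r : (r < n)%N -> p (block_vec f g) r = f r.
Proof.
move=> rn; have rN : (r < N)%N by apply: leq_trans nN.
by rewrite /p rn (entryE _ (Ordinal rN)) mxE /= rn.
Qed.

Lemma snd_block_vec f g b : (n + b < N)%N -> q (block_vec f g) b = g b.
Proof.
move=> bN; rewrite /q (entryE _ (Ordinal bN)) mxE /=.
by rewrite ltnNge leq_addr /= addKn.
Qed.

Lemma fst_block_vec0 f g r : (forall r, (n <= r)%N -> f r = 0) -> p (block_vec f g) r = f r.
Proof.
by move=> f0; have [/fst_block_vec -> //|ge] := ltnP r n; rewrite fst_block_out ?f0.
Qed.

Lemma snd_block_vec0 f b : q (block_vec f (fun=> 0)) b = 0.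
Proof.
have [lt|ge] := ltnP (n + b) N; first by rewrite snd_block_vec.
by rewrite snd_block_out //; lia.
Qed.

Definition jordan : 'M[F]_N :=
  \matrix_(r, c) ((c == r.+1 :> nat) && (c != n :> nat))%:R.
Local Notation X := jordan.

Lemma entryX u (i : 'I_N) :
  (X *m u) i 0 = if i.+1 == n then 0 else entry u i.+1.
Proof.
rewrite mxE; case: eqP => [en|nn].
  rewrite big1 // => c _; rewrite mxE -en.
  by rewrite andbN mul0r.
have [lt|ge] := ltnP i.+1 N.
  rewrite (entryE _ (Ordinal lt)) (bigD1 (Ordinal lt)) //= mxE /= eqxx.
  rewrite (introN eqP nn) mul1r big1 ?addr0 // => c cne.
  by rewrite mxE -val_eqE /= in cne *; rewrite (negbTE cne) mul0r.
rewrite entry_out // big1 // => c _; rewrite mxE.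
by case: eqP (ltn_ord c) => [->|]; rewrite ?mul0r // ltnNge ge.
Qed.

Lemma fst_blockX u r : p (X *m u) r = p u r.+1.
Proof.
rewrite /p; have [lt|ge] := ltnP r.+1 n.
  have rN : (r < N)%N by lia.
  by rewrite (ltnW lt) (entryE _ (Ordinal rN)) entryX /= (ltn_eqF lt).
have [rn|//] := ltnP r n; have rN : (r < N)%N by lia.
by rewrite (entryE _ (Ordinal rN)) entryX /= (_ : r.+1 == n) //; lia.
Qed.

Lemma snd_blockX u b : q (X *m u) b = q u b.+1.
Proof.
rewrite /q; have [lt|ge] := ltnP (n + b) N.
  rewrite (entryE _ (Ordinal lt)) entryX /= addnS.
  by rewrite (_ : (_ == n) = false) //; lia.
by rewrite !entry_out //; lia.
Qed.

Definition jordan_exp k : 'M[F]_N := iter k (mulmx X) 1%:M.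
Local Notation Xp := jordan_exp.

Lemma jordan_expS k u : Xp k.+1 *m u = X *m (Xp k *m u).
Proof. by rewrite mulmxA. Qed.

Lemma jordan_exp0 u : Xp 0 *m u = u.
Proof. exact: mul1mx. Qed.

Lemma fst_block_exp k u r : p (Xp k *m u) r = p u (r + k)%N.
Proof.
elim: k r => [|k IH] r; first by rewrite jordan_exp0 addn0.
by rewrite jordan_expS fst_blockX IH addSnnS.
Qed.

Lemma snd_block_exp k u b : q (Xp k *m u) b = q u (b + k)%N.
Proof.
elim: k b => [|k IH] b; first by rewrite jordan_exp0 addn0.
by rewrite jordan_expS snd_blockX IH addSnnS.
Qed.

Lemma jordan_expN u : Xp N *m u = 0.
Proof.
by apply: block_ext => r; rewrite ?fst_block_exp ?snd_block_exp ?fst_block0 ?snd_block0 ?fst_block_out ?snd_block_out //; lia.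
Qed.

Lemma jordan_expD k l u : Xp (k + l) *m u = Xp k *m (Xp l *m u).
Proof.
by apply: block_ext => r; rewrite ?fst_block_exp ?snd_block_exp; congr (_ u _); lia.
Qed.

(* With E = {q = 0} the first Jordan block, V :&: E and the image of V modulo E
   are the coordinate spaces of dimensions t and b. Every X-stable subspace has
   such a form, since X has a single Jordan block on E and modulo E. *)
Record normal_form V t b : Prop := NormalForm {
  nf_fst : forall u, u \in V -> (forall j, q u j = 0) ->
    forall r, (t <= r)%N -> p u r = 0;
  nf_snd : forall u, u \in V -> forall j, (b <= j)%N -> q u j = 0;
  nf_mem : forall u, (forall j, q u j = 0) ->
    (forall r, (t <= r)%N -> p u r = 0) -> u \in V;
  nf_proj : forall u, (forall j, (b <= j)%N -> q u j = 0) ->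
    exists2 e, forall j, q e j = 0 & u - e \in V }.

(** If a bound failed, V' would contain the basis vector of row t + k of E, or a vector whose second
    block is the basis vector of row b + k, and [Xp k] would send it outside of V. With [k = 0] this
    compares nested spaces. *)
Lemma nf_Xp_leq V V' t b t' b' k :
  (forall u, u \in V' -> Xp k *m u \in V) ->
  normal_form V t b -> normal_form V' t' b' -> (t' <= n)%N -> (b' <= N - n)%N ->
  (t' <= t + k)%N /\ (b' <= b + k)%N.
Proof.
move=> VV' nf nf' t'n b'n; split; rewrite leqNgt; apply/negP => lt.
  pose e := block_vec (fun r => (r == t + k)%N%:R) (fun=> 0).
  have pe r : p e r = (r == t + k)%N%:R.
    by apply: fst_block_vec0 => {}r nr; rewrite gtn_eqF //; lia.
  have qe j : q e j = 0 by apply: snd_block_vec0.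
  have eV' : e \in V'.
    by apply: (nf_mem nf') => // r t'r; rewrite pe gtn_eqF //; lia.
  have := nf_fst nf (VV' e eV'); move=> /(_ _ t (leqnn t)).
  rewrite fst_block_exp pe eqxx => h; have /eqP : (1 : F) = 0 by apply: h => j; rewrite snd_block_exp qe.
  by rewrite oner_eq0.
pose f := block_vec (fun=> 0) (fun j => (j == b + k)%N%:R).
have qf j : q f j = (j == b + k)%N%:R.
  have [/snd_block_vec -> //|ge] := ltnP (n + j) N.
  by rewrite snd_block_out ?gtn_eqF //; lia.
have [|e qe feV'] := nf_proj nf' (u := f).
  by move=> j b'j; rewrite qf gtn_eqF //; lia.
have := nf_snd nf (VV' _ feV') (leqnn b); rewrite snd_block_exp snd_blockB qe qf eqxx subr0 => /eqP.
by rewrite oner_eq0.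
Qed.

Lemma nf_uniq V t b t' b' : normal_form V t b -> normal_form V t' b' ->
  (t <= n)%N -> (b <= N - n)%N -> (t' <= n)%N -> (b' <= N - n)%N ->
  t = t' /\ b = b'.
Proof.
move=> nf nf' tn bn tn' bn'; have id u : u \in V -> Xp 0 *m u \in V by rewrite jordan_exp0.
by have := nf_Xp_leq id nf nf' tn' bn'; have := nf_Xp_leq id nf' nf tn bn; lia.
Qed.

(** An inclusion between spaces of equal dimension, read on V :&: E and on the image modulo E. *)
Lemma nf_sub V V' t b : normal_form V t b -> normal_form V' t b ->
  (forall u, u \in V -> u \in V') -> forall u, u \in V' -> u \in V.
Proof.
move=> nf nf' VV' u uV'.
have [e qe ueV] := nf_proj nf (nf_snd nf' uV').
have eV' : e \in V'.
  by rewrite -[e](subKr u) memvB // VV'.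
rewrite -[u](subrK e) memvD //; apply: (nf_mem nf) => // r tr.
exact: (nf_fst nf' eV').
Qed.

(** Up to a vector of E that lies in V, such a [u] is the image under [Xp k] of its second block
    moved down by [k], and this preimage is in V'. *)
Lemma nf_back V V' t b k : normal_form V t b -> (b + k <= N - n)%N ->
  (forall u, u \in V' -> Xp k *m u \in V) ->
  (forall u, (forall j, (b + k <= j)%N -> q u j = 0) -> (forall r, p u r = 0) -> u \in V') ->
  forall u, (forall j, (b <= j)%N -> q u j = 0) -> (forall r, (t <= r)%N -> p u r = 0) ->
  u \in V.
Proof.
move=> nf bk XV EV' u qu pu.
pose s := block_vec (fun=> 0) (fun j => if (k <= j)%N then q u (j - k)%N else 0).
have ps r : p s r = 0 by rewrite fst_block_vec0.
have qs j : q s (j + k)%N = q u j.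
  have [lt|ge] := ltnP (n + (j + k)) N; first by rewrite snd_block_vec // leq_addl addnK.
  by rewrite snd_block_out ?qu //; move: ge bk; clear; lia.
have sV' : s \in V'.
  apply: EV' => // j bj; have kj : (k <= j)%N by apply: leq_trans bj; rewrite leq_addl.
  by rewrite -(subnK kj) qs qu // leq_subRL // addnC.
rewrite -[u](subrK (Xp k *m s)) memvD ?XV //; apply: (nf_mem nf) => [j|r tr].
  by rewrite snd_blockB snd_block_exp qs subrr.
by rewrite fst_blockB fst_block_exp ps pu // subrr.
Qed.

(** Either V can correct [w] to a vector of E, which enlarges V :&: E, or [w] enlarges the image
    modulo E. As X sends V' into V, the new coordinate can only be the next one. *)
Lemma nf_step V V' t b w : normal_form V t b ->
  (forall u, u \in V -> u \in V') -> w \in V' -> w \notin V ->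
  (forall u, u \in V' -> exists a, u - a *: w \in V) ->
  (forall u, u \in V' -> X *m u \in V) ->
  normal_form V' t.+1 b /\ (t < n)%N \/ normal_form V' t b.+1 /\ (b < N - n)%N.
Proof.
move=> nf VV' wV' wV gen XV.
have [[e [qe weV]]|ne] := boolp.pselect (exists e, (forall j, q e j = 0) /\ w - e \in V).
  left; have eV' : e \in V' by rewrite -[e](subKr w) memvB // VV'.
  have eV : e \notin V.
    by apply: contra wV => eV; rewrite -[w](subrK e) memvD.
  have pe r : (t < r)%N -> p e r = 0.
    case: r => // r tr; rewrite -fst_blockX; apply: (nf_fst nf (XV _ eV')) => // j.
    by rewrite snd_blockX qe.
  have pet : p e t != 0.
    apply: contra eV => /eqP pet; apply: (nf_mem nf) => // r.
    by rewrite leq_eqVlt => /orP[/eqP <-|/pe].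
  have gen' u : u \in V' -> exists a, u - a *: e \in V.
    move=> /gen[a ua]; exists a.
    have -> : u - a *: e = (u - a *: w) + a *: (w - e).
      by rewrite scalerBr addrA subrK.
    by rewrite memvD // memvZ.
  split; last by rewrite ltnNge; apply: contra pet => /fst_block_out ->.
  split.
  - move=> u /gen'[a ua] qu r tr.
    have : p (u - a *: e) r = 0.
      by apply: (nf_fst nf ua _ (ltnW tr)) => j; rewrite snd_blockB snd_blockZ qu qe mulr0 subr0.
    by rewrite fst_blockB fst_blockZ pe // mulr0 subr0.
  - move=> u /gen'[a ua] j bj; have := nf_snd nf ua bj.
    by rewrite snd_blockB snd_blockZ qe mulr0 subr0.
  - move=> u qu pu; pose a := p u t / p e t.
    rewrite -[u](subrK (a *: e)) memvD ?memvZ //.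
    apply: VV'; apply: (nf_mem nf) => [j|r]; first by rewrite snd_blockB snd_blockZ qu qe mulr0 subr0.
    rewrite leq_eqVlt fst_blockB fst_blockZ => /orP[/eqP <-|tr]; first by rewrite divfK ?subrr.
    by rewrite pu // pe // mulr0 subr0.
  by move=> u /(nf_proj nf)[d qd ud]; exists d => //; apply: VV'.
right; have qw j : (b < j)%N -> q w j = 0.
  by case: j => // j bj; rewrite -snd_blockX; apply: (nf_snd nf (XV _ wV')).
have qwb : q w b != 0.
  apply/eqP => qwb; have [|e qe we] := nf_proj nf (u := w).
    by move=> j; rewrite leq_eqVlt => /orP[/eqP <-|/qw].
  by apply: ne; exists e.
split; last by rewrite ltnNge; apply: contra qwb => /snd_block_out ->.
split.
- move=> u uV' qu; have [a ua] := gen u uV'.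
  have := nf_snd nf ua (leqnn b); rewrite snd_blockB snd_blockZ qu sub0r => /eqP.
  rewrite oppr_eq0 mulf_eq0 (negbTE qwb) orbF => /eqP a0.
  by apply: (nf_fst nf) => //; move: ua; rewrite a0 scale0r subr0.
- move=> u /gen[a ua] j bj; have := nf_snd nf ua (ltnW bj).
  by rewrite snd_blockB snd_blockZ qw // mulr0 subr0.
- by move=> u qu pu; apply: VV'; apply: (nf_mem nf).
move=> u qu; pose a := q u b / q w b; have [|e qe ue] := nf_proj nf (u := u - a *: w).
  move=> j; rewrite leq_eqVlt snd_blockB snd_blockZ => /orP[/eqP <-|bj]; first by rewrite divfK ?subrr.
  by rewrite qu // qw // mulr0 subr0.
exists e => //; rewrite -[u](subrK (a *: w)) addrAC memvD ?memvZ //.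
by rewrite VV'.
Qed.

Record full_flag (U : nat -> {vspace 'cV[F]_N}) : Prop := FullFlag {
  flag_0 : forall u, u \in U 0 -> u = 0;
  flag_N : forall u, u \in U N;
  flag_step : forall c, (c < N)%N -> exists w,
    [/\ w \in U c.+1, w \notin U c & forall u, u \in U c.+1 -> exists a, u - a *: w \in U c];
  flag_mono : forall c u, u \in U c -> u \in U c.+1 }.

Definition flag_word (U : nat -> {vspace 'cV[F]_N}) (m : pred 'I_N) : Prop :=
  cnt m N = n /\ forall c, (c <= N)%N -> normal_form (U c) (cnt m c) (c - cnt m c).

Lemma flag_monoW U c d u : full_flag U -> (c <= d)%N -> u \in U c -> u \in U d.
Proof.
by move=> fU /subnK <-; elim: (d - c)%N => //= k IH /IH; apply: flag_mono.
Qed.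

Lemma flag_word_exists U : full_flag U ->
  (forall c, (c < N)%N -> forall u, u \in U c.+1 -> X *m u \in U c) ->
  exists m, flag_word U m.
Proof.
move=> fU XU.
have H : forall c, (c <= N)%N -> exists m : pred 'I_N, forall d, (d <= c)%N ->
    [/\ normal_form (U d) (cnt m d) (d - cnt m d), (cnt m d <= n)%N
      & (d - cnt m d <= N - n)%N].
  apply: gap_ind => [|i [m hm]].
    exists pred0 => d; rewrite leqn0 => /eqP->; rewrite cnt0; split=> //; split.
    - by move=> u /(flag_0 fU) -> _ r _; rewrite fst_block0.
    - by move=> u /(flag_0 fU) -> r _; rewrite snd_block0.
    - move=> u qu pu; rewrite (_ : u = 0) ?mem0v //.
      by apply: block_ext => j; rewrite ?qu ?pu ?fst_block0 ?snd_block0.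
    move=> u qu; exists u => [j|]; rewrite ?qu // subrr mem0v //.
  have [nfi hin hiN] := hm i (leqnn _).
  have [w [wU wU' gen]] := flag_step fU (ltn_ord i).
  have cm := cnt_leq m (ltnW (ltn_ord i)).
  (* The letter [beta] is also given to the positions after [i], which does not affect the gaps up
     to [i.+1]. *)
  have ext (beta : bool) : normal_form (U i.+1) (cnt m i + beta) (i.+1 - (cnt m i + beta)) ->
      (cnt m i + beta <= n)%N -> (i.+1 - (cnt m i + beta) <= N - n)%N ->
      exists m : pred 'I_N, forall d, (d <= i.+1)%N ->
    [/\ normal_form (U d) (cnt m d) (d - cnt m d), (cnt m d <= n)%N
      & (d - cnt m d <= N - n)%N].
    move=> nfS h1 h2; pose m' : pred 'I_N := fun j => if (j < i)%N then m j else beta.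
    have m'E d : (d <= i)%N -> cnt m' d = cnt m d.
      by move=> di; apply: eq_cnt => j jd; rewrite /m' (leq_trans jd di).
    exists m' => d; rewrite leq_eqVlt => /orP[/eqP->|di]; last by rewrite m'E //; apply: hm.
    by rewrite cntS m'E // (_ : m' i = beta) // /m' ltnn.
  case: (nf_step nfi (fun u => @flag_mono U fU i u) wU wU' gen (XU i (ltn_ord i))) => [[nfS h]|[nfS h]].
    by apply: (ext true); rewrite addn1 ?subSS.
  by apply: (ext false); rewrite addn0 ?subSn.
have [m hm] := H N (leqnn N).
exists m; split; last by move=> c /hm[].
have [nfN h1 h2] := hm N (leqnn N).
have nff : normal_form (U N) n (N - n).
  split=> [u _ _ r nr|u _ j nj|u _ _|u _]; rewrite ?fst_block_out ?snd_block_out //.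
    exact: flag_N.
  by exists 0 => [j|]; [rewrite snd_block0|apply: flag_N].
by have [] := nf_uniq nfN nff h1 h2 (leqnn _) (leqnn _).
Qed.

Lemma flag_word_leq U m c : flag_word U m -> (c <= N)%N ->
  (cnt m c <= n)%N /\ (c - cnt m c <= N - n)%N.
Proof.
move=> [mN _] cN; have := cnt_mono m cN; rewrite mN => h; split=> //.
have := @cnt_sub N m c N; rewrite cN leqnn mN => /(_ isT); lia.
Qed.

Lemma flag_word_uniq U m m' : flag_word U m -> flag_word U m' -> m =1 m'.
Proof.
move=> wm wm'.
have E c : (c <= N)%N -> cnt m c = cnt m' c.
  move=> cN; have [h1 h2] := flag_word_leq wm cN; have [h1' h2'] := flag_word_leq wm' cN.
  by have [] := nf_uniq (wm.2 c cN) (wm'.2 c cN) h1 h2 h1' h2'.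
move=> i; have := E _ (ltn_ord i); rewrite !cntS (E _ (ltnW (ltn_ord i))).
by move=> /addnI; case: (m i); case: (m' i).
Qed.

End TwoBlocks.

Section Lattice.
Variables (F : fieldType) (N n : nat).
Hypothesis nN : (n <= N)%N.
Implicit Types (u w e : 'cV[F]_N) (r b t c k : nat) (V : {vspace 'cV[F]_N}) (S : nat -> F).
Local Notation p := (@fst_block F N n).
Local Notation q := (@snd_block F N n).
Local Notation X := (jordan F N n).
Local Notation Xp := (jordan_exp F N n).

(* The space spanned by the first t vectors of the first block and by the
   vectors X^j h for j < b, where h has coordinates S from row t on in the first
   block and is the b-th basis vector in the second one. *)
Definition lattice t b S u : Prop :=
  (forall j, (b <= j)%N -> q u j = 0) /\
  (forall r, (t <= r)%N -> p u r = \sum_(i < b) q u i * S (r - t + (b - i.+1))%N).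

Lemma lattice_nf V t b S : (forall u, u \in V <-> lattice t b S u) ->
  (forall j, (n <= t + j)%N -> S j = 0) -> normal_form n V t b.
Proof.
move=> VE S0; split.
- move=> u /VE[_ hp] qu r tr; rewrite hp // big1 // => i _.
  by rewrite qu mul0r.
- by move=> u /VE[].
- move=> u qu pu; apply/VE; split=> // r tr; rewrite pu // big1 // => i _.
  by rewrite qu mul0r.
move=> u qu.
(* The defect of [u] in the equations of the lattice is the correction in E; it stays inside the
   first block because [S] vanishes beyond it. *)
pose f r := if (t <= r)%N then p u r - \sum_(i < b) q u i * S (r - t + (b - i.+1))%N else 0.
have f0 r : (n <= r)%N -> f r = 0.
  move=> nr; rewrite /f; case: ifP => // tr; rewrite fst_block_out // big1 ?subrr // => i _.
  by rewrite S0 ?mulr0 //; lia.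
exists (block_vec N n f (fun=> 0)) => [j|]; first exact: snd_block_vec0.
apply/VE; split=> [j bj|r tr]; first by rewrite snd_blockB snd_block_vec0 // qu // subrr.
rewrite fst_blockB fst_block_vec0 // /f tr opprB addrC subrK; apply: eq_bigr => i _.
by rewrite snd_blockB snd_block_vec0 // subr0.
Qed.

(** X loses the coordinate [q u 0], whose terms involve only values of [S] from [b] on, that is,
    zeros. *)
Let lattice_shift t b S u : (forall j, (b <= j)%N -> S j = 0) ->
  (forall j, (b < j)%N -> q u j = 0) ->
  (forall r, (t <= r)%N -> p u r.+1 = \sum_(i < b.+1) q u i * S (r - t + (b - i))%N) ->
  lattice t b S (X *m u).
Proof.
move=> S0 qu pu; split=> [j bj|r tr]; first by rewrite snd_blockX // qu.
rewrite fst_blockX // pu // big_ord_recl S0 ?mulr0 ?add0r; last by rewrite subn0 leq_addl.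
by apply: eq_bigr => i _; rewrite snd_blockX.
Qed.

Lemma lattice_XT t b S S' u : (forall j, (b <= j)%N -> S j = 0) ->
  (forall j, S' j = S j.+1) -> lattice t.+1 b S' u -> lattice t b S (X *m u).
Proof.
move=> S0 SS [qu pu]; apply: lattice_shift => // [j /ltnW|r tr]; first exact: qu.
rewrite pu // big_ord_recr /= qu // mul0r addr0; apply: eq_bigr => i _.
by rewrite SS; congr (_ * S _); have := ltn_ord i; lia.
Qed.

Lemma lattice_XB t b S S' u : (forall j, (b <= j)%N -> S j = 0) ->
  (forall j, S' j.+1 = S j) -> lattice t b.+1 S' u -> lattice t b S (X *m u).
Proof.
move=> S0 SS [qu pu]; apply: lattice_shift => // r tr.
rewrite pu ?(leq_trans tr) //; apply: eq_bigr => i _.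
by rewrite -SS; congr (_ * S' _); have := ltn_ord i; lia.
Qed.

Lemma lattice_Xp t b S S' k u : (forall j, (b <= j)%N -> S j = 0) ->
  (forall j, S' j = S j) -> lattice (t + k) (b + k) S' u -> lattice t b S (Xp k *m u).
Proof.
move=> S0 SS [qu pu]; split=> [j bj|r tr].
  by rewrite snd_block_exp // qu // leq_add2r.
rewrite fst_block_exp // pu ?leq_add2r // [(b + k)%N]addnC big_split_ord /=.
rewrite big1 ?add0r => [|i _]; last by rewrite SS S0 ?mulr0 //; have := ltn_ord i; lia.
apply: eq_bigr => i _; rewrite snd_block_exp // SS addnC.
by congr (_ * S _); have := ltn_ord i; lia.
Qed.

(** The coordinate in row [t] becomes free and the equations start one row further down: a pop. *)
Lemma lattice_colT t b S S' w u : (forall j, S' j = S j.+1) ->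
  (forall r, p w r = (r == t)%:R) -> (forall j, q w j = 0) ->
  lattice t.+1 b S' u <-> exists a, lattice t b S (u - a *: w).
Proof.
move=> SS pw qw; split=> [[qu pu]|[a [qu pu]]].
  exists (p u t - \sum_(i < b) q u i * S (b - i.+1)%N); split=> [j bj|r].
    by rewrite snd_blockB snd_blockZ qw mulr0 subr0 qu.
  rewrite leq_eqVlt fst_blockB fst_blockZ pw => /orP[/eqP<-|tr].
    rewrite eqxx mulr1 subKr subnn; apply: eq_bigr => i _.
    by rewrite snd_blockB snd_blockZ qw mulr0 subr0.
  rewrite gtn_eqF // mulr0 subr0 pu //; apply: eq_bigr => i _.
  rewrite snd_blockB snd_blockZ qw mulr0 subr0 SS; congr (_ * S _); lia.
have quE j : q (u - a *: w) j = q u j by rewrite snd_blockB snd_blockZ qw mulr0 subr0.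
split=> [j bj|r tr]; first by rewrite -quE qu.
have := pu r (ltnW tr); rewrite fst_blockB fst_blockZ pw gtn_eqF // mulr0 subr0 => ->.
apply: eq_bigr => i _; rewrite quE SS; congr (_ * S _); lia.
Qed.

(** The vector [w] is the new generator h. Its image under X agrees with the old one from row [t]
    on, and its entry [S' 0] in row [t] is the value pushed. *)
Lemma lattice_colB t b S S' w u : (forall j, S' j.+1 = S j) ->
  (forall r, (t <= r)%N -> p w r = S' (r - t)%N) -> (forall j, q w j = (j == b)%:R) ->
  lattice t b.+1 S' u <-> exists a, lattice t b S (u - a *: w).
Proof.
move=> SS pw qw; split=> [[qu pu]|[a [qu pu]]].
  exists (q u b); split=> [j|r tr].
    rewrite leq_eqVlt snd_blockB snd_blockZ qw => /orP[/eqP<-|bj]; first by rewrite eqxx mulr1 subrr.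
    by rewrite gtn_eqF // mulr0 subr0 qu.
  rewrite fst_blockB fst_blockZ pw // pu // big_ord_recr /= subnn addn0 addrK; apply: eq_bigr => i _.
  have := ltn_ord i => ib; rewrite snd_blockB snd_blockZ qw ltn_eqF // mulr0 subr0 -SS.
  by congr (_ * S' _); lia.
have quE j : q u j = q (u - a *: w) j + a * (j == b)%:R.
  by rewrite snd_blockB snd_blockZ qw subrK.
split=> [j bj|r tr].
  by rewrite quE qu ?(ltnW bj) // gtn_eqF // mulr0 addr0.
have := pu r tr; rewrite fst_blockB fst_blockZ pw // => /eqP; rewrite subr_eq => /eqP ->.
rewrite big_ord_recr /= quE qu // eqxx mulr1 add0r subnn addn0.
congr (_ + _); apply: eq_bigr => i _; have := ltn_ord i => ib.
rewrite [q u i]quE ltn_eqF // mulr0 addr0 -SS; congr (_ * S' _); lia.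
Qed.

End Lattice.

Section Colspan.
Variables (R : realType) (N : nat).
Local Notation C := (Cplx R).
Implicit Types (g : 'M[C]_N) (u : 'cV[C]_N).

Lemma colspan0 g u : u \in colspan g 0 -> u = 0.
Proof.
rewrite /colspan (_ : [seq _ <- _ | _] = [::]).
  by rewrite span_nil memv0 => /eqP.
by apply/eqP; rewrite -[_ == _]negbK -has_filter; apply/hasPn.
Qed.

Lemma colspanS g (i : 'I_N) : colspan g i.+1 = (colspan g i + <[col i g]>)%VS.
Proof.
apply/eqP; rewrite eqEsubv; apply/andP; split.
  apply/span_subvP => _ /mapP[j + ->]; rewrite mem_filter ltnS leq_eqVlt.
  case/andP => /orP[/eqP/val_inj->|ji] _.
    by apply: (subvP (addvSr _ _)); apply: memv_line.
  apply: (subvP (addvSl _ _)); apply/memv_span/map_f.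
  by rewrite mem_filter ji mem_enum.
rewrite subv_add; apply/andP; split.
  apply/span_subvP => _ /mapP[j + ->]; rewrite mem_filter => /andP[ji _].
  by apply/memv_span/map_f; rewrite mem_filter mem_enum ltnS (ltnW ji).
by rewrite -memvE; apply/memv_span/map_f; rewrite mem_filter mem_enum ltnSn.
Qed.

Lemma colspanSP g (i : 'I_N) u :
  u \in colspan g i.+1 <-> exists a, u - a *: col i g \in colspan g i.
Proof.
rewrite colspanS; split=> [/memv_addP[w wU [_ /vlineP[a ->] ->]]|[a ua]].
  by exists a; rewrite addrK.
by rewrite -[u](subrK (a *: col i g)) memv_add // memvZ // memv_line.
Qed.

Lemma colspan_sub g c d u : (c <= d)%N -> u \in colspan g c -> u \in colspan g d.
Proof.
move=> cd; apply: subvP u; apply/span_subvP => _ /mapP[j + ->].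
rewrite mem_filter => /andP[jc _]; apply/memv_span/map_f.
by rewrite mem_filter mem_enum (leq_trans jc).
Qed.

Lemma col_colspan g (i : 'I_N) c : (i < c)%N -> col i g \in colspan g c.
Proof. by move=> ic; apply/memv_span/map_f; rewrite mem_filter mem_enum ic. Qed.

Lemma colspan_mulP g c u :
  u \in colspan g c <-> exists2 a : 'cV[C]_N, (forall k : 'I_N, (c <= k)%N -> a k 0 = 0) & u = g *m a.
Proof.
have H d : (d <= N)%N -> forall u, u \in colspan g d -> 
    exists2 a : 'cV[C]_N, (forall k : 'I_N, (d <= k)%N -> a k 0 = 0) & u = g *m a.
  move: d; apply: gap_ind => [w /colspan0 ->|i IH w /colspanSP[a /IH[b b0 e]]].
    by exists 0; rewrite ?mulmx0 // => k _; rewrite mxE.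
  exists (b + a *: delta_mx i 0) => [k ik|].
    rewrite !mxE b0 ?(ltnW ik) // add0r eqxx andbT -val_eqE /= gtn_eqF // mulr0 //.
  by rewrite mulmxDr -scalemxAr -colE -e subrK.
split=> [uc|[a a0 ->]].
  have [cN|Nc] := leqP c N; first exact: H.
  have [|a _ e] := H N (leqnn N) u.
    rewrite (_ : colspan g N = colspan g c) //; congr (<<map _ _>>%VS).
    by apply: eq_filter => j; rewrite (ltn_trans _ Nc) ltn_ord.
  by exists a => // k ck; have := ltn_ord k; lia.
have -> : g *m a = \sum_j a j 0 *: col j g.
  by apply/colP => r; rewrite mxE summxE; apply: eq_bigr => j _; rewrite !mxE mulrC.
apply: memv_suml => j _.
have [jc|cj] := ltnP j c; first by apply/memvZ/col_colspan.
by rewrite a0 // scale0r mem0v.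
Qed.

Lemma colspan_unitP g c u : g \in unitmx ->
  u \in colspan g c <-> forall k : 'I_N, (c <= k)%N -> (invmx g *m u) k 0 = 0.
Proof.
move=> gU; rewrite colspan_mulP; split=> [[a a0 ->] k ck|h].
  by rewrite mulKmx // a0.
by exists (invmx g *m u); rewrite // mulKVmx.
Qed.

Lemma colspan_mulmx P g c u : P \in unitmx ->
  u \in colspan (P *m g) c <-> invmx P *m u \in colspan g c.
Proof.
move=> PU; rewrite !colspan_mulP; split=> [[a a0 ->]|[a a0 e]]; exists a => //.
  by rewrite -mulmxA mulKmx.
by rewrite -mulmxA -e mulKVmx.
Qed.

Lemma colspan_full_unit g : (forall u, u \in colspan g N) -> g \in unitmx.
Proof.
move=> h; have ex (i : 'I_N) : exists a : 'cV[C]_N, g *m a = delta_mx i 0.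
  by have [a _ e] := (colspan_mulP _ _ _).1 (h (delta_mx i 0)); exists a.
have {ex} [a ha] := boolp.choice ex.
suff : g *m (\matrix_(r, i) a i r 0) = 1%:M by case/mulmx1_unit.
apply/matrixP => r i; rewrite !mxE.
have /matrixP /(_ r 0) := ha i; rewrite !mxE eqxx andbT => <-.
by apply: eq_bigr => j _; rewrite mxE.
Qed.

Lemma colspan_full_flag g : g \in unitmx -> full_flag (colspan g).
Proof.
move=> gU; split.
- exact: colspan0.
- by move=> u; apply/colspan_unitP => // k; rewrite leqNgt ltn_ord.
- move=> c cN; pose i := Ordinal cN; exists (col i g).
  split; first exact: col_colspan.
    apply/negP => /(colspan_unitP _ _ gU) /(_ i (leqnn _)) /eqP.
    by rewrite colE mulKmx // mxE !eqxx oner_eq0.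
  by move=> u; apply: (colspanSP g i u).1.
by move=> c u; apply: colspan_sub.
Qed.

End Colspan.

(** * The flags of f_mx *)

Section MatchingMatrix.
Variables (R : realType) (N n : nat) (M : {set Arc N}).
Local Notation C := (Cplx R).
Hypothesis nN : (n <= N)%N.
Hypothesis stdM : std_noncrossing M.
Hypothesis cardM : (#|M| <= minn n (N - n))%N.
Variable v : Arc N -> C.
Implicit Types (u : 'cV[C]_N) (c r b : nat) (i : 'I_N).
Local Notation p := (@fst_block C N n).
Local Notation q := (@snd_block C N n).
Local Notation X := (jordan C N n).
Local Notation m := (word n M).
Local Notation T := (cnt m).
Local Notation S := (stack m (xof M v)).
Local Notation f := (f_mx n M v).

#[local] Lemma TN : T N = n.
Proof. exact: (cnt_wordN stdM cardM nN). Qed.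

#[local] Lemma T_lt i : m i -> (T i < n)%N.
Proof. by move=> mi; have := cnt_mono m (ltn_ord i); rewrite cntS mi TN addn1. Qed.

#[local] Lemma T_leq c : (c <= N)%N -> (c - T c <= N - n)%N.
Proof.
by move=> cN; have := @cnt_sub N m c N; rewrite cN leqnn TN => /(_ isT); lia.
Qed.

#[local] Lemma B_lt i : ~~ m i -> (i - T i < N - n)%N.
Proof.
move=> mi; have := T_leq (ltn_ord i); rewrite cntS (negbTE mi) addn0.
by have := cnt_leq m (ltnW (ltn_ord i)); lia.
Qed.

#[local] Lemma S_top c j : (c <= N)%N -> (n <= T c + j)%N -> S c j = 0.
Proof.
by move=> cN h; apply: stack_top => //; [apply: stack_covN|rewrite TN].
Qed.

(** As [r0] is the number of T read so far, the column of a letter B carries the stack just after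
    its push, written downwards from the row of the next pivot of a T. *)
Lemma f_mx_entry (r c : 'I_N) : f r c =
  if m c then (r == T c :> nat)%:R
  else (r == n + (c - T c) :> nat)%N%:R + (if (T c <= r)%N then S c.+1 (r - T c)%N else 0).
Proof.
rewrite mxE (wME stdM cardM nN).
have [/startsP[a aM <-]|ns] := boolP (starts M c); last first.
  rewrite big_pred0 ?addr0 => [|a]; last first.
    by apply/negbTE; apply: contra ns => /andP[aM /eqP <-]; apply: starts_arc.
  case: ifP => // mc; have nc : on_no_arc M c.
    by move: mc; rewrite (wordE stdM cardM nN) /on_no_arc ns; case: (ends M c).
  by rewrite (stack_cov0 stdM cardM nN) ?(cov_unmatchedS stdM) // if_same addr0.
rewrite (big_pred1 a) => [|b]; last first.
  apply/andP/eqP => [[bM /eqP e]|->]; last by rewrite aM eqxx.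
  by apply: (arc_eq1 stdM) => //; rewrite e.
have -> : r0 n M a = T a.1.
  by rewrite (cnt_word stdM cardM nN) // ltnW.
rewrite (word_starts stdM cardM nN) ?starts_arc //; congr (_ + _).
case: ifP => Tr.
  have rN : (r - T a.1 < N)%N by rewrite (leq_ltn_trans (leq_subr _ _)).
  rewrite (big_pred1 (Ordinal rN)) => [|j].
    have -> : S a.1.+1 (r - T a.1)%N = oapp v 0 (iter (r - T a.1) (obind (parent M)) (Some a)) => //.
    by rewrite (stack_cov stdM cardM nN) // -(cov_start stdM aM).
  apply/eqP/eqP => [e|->]; last by rewrite /= subnKC.
  by apply: val_inj; rewrite /= e addKn.
rewrite big_pred0 // => j; apply/eqP => e.
by move: Tr; rewrite e leq_addr.
Qed.

Lemma p_col_f_mx i r : p (col i f) r =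
  if m i then (r == T i)%:R else if (T i <= r)%N then S i.+1 (r - T i)%N else 0.
Proof.
(* By [S_top] the stack ends within the first block, so a column does not run over into the second
   one. *)
have [rn|nr] := ltnP r n; last first.
  rewrite fst_block_out //; case: ifP => [/T_lt lt|mi]; first by rewrite gtn_eqF // (leq_trans lt).
  case: ifP => // tr; rewrite S_top // cntS mi; lia.
have rN := leq_trans rn nN.
rewrite /fst_block rn (entryE _ (Ordinal rN)) mxE f_mx_entry /=.
case: ifP => // _; rewrite ltn_eqF ?add0r //.
by apply: leq_trans rn (leq_addr _ _).
Qed.

Lemma q_col_f_mx i b : q (col i f) b = (~~ m i && (b == (i - T i)%N))%:R.
Proof.
have [bn|nb] := ltnP (n + b) N; last first.
  rewrite (snd_block_out nN); last by lia.
  by case: (boolP (m i)) => //= /B_lt lt; rewrite gtn_eqF //; lia.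
rewrite /snd_block (entryE _ (Ordinal bn)) mxE f_mx_entry /=.
case: ifP => [/T_lt lt|mi] /=; first by rewrite gtn_eqF // ltn_addr.
rewrite eqn_add2l; case: ifP => [Tb|_]; last by rewrite addr0.
by rewrite S_top ?addr0 // cntS mi; lia.
Qed.

Lemma colspan_f_mx c u : (c <= N)%N ->
  u \in colspan f c <-> lattice n (T c) (c - T c) (S c) u.
Proof.
move=> cN; move: c cN u; apply: gap_ind => [|i IH] u.
  rewrite cnt0; split=> [/colspan0 ->|[qu pu]].
    by split=> [j _|r _]; rewrite ?snd_block0 ?fst_block0 // big_ord0.
  have -> : u = 0; last exact: mem0v.
  by apply: (block_ext (n := n)) => j; rewrite ?fst_block0 ?snd_block0 ?qu ?pu // big_ord0.
rewrite colspanSP.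
have -> : (exists a, u - a *: col i f \in colspan f i) <->
    exists a, lattice n (T i) (i - T i) (S i) (u - a *: col i f).
  by split=> -[a h]; exists a; apply/IH.
have iT := cnt_leq m (ltnW (ltn_ord i)).
rewrite cntS; case mi: (m i).
  rewrite addn1 subSS; apply: iff_sym; apply: (lattice_colT nN).
  - by move=> j; rewrite stackS mi.
  - by move=> r; rewrite p_col_f_mx mi.
  by move=> j; rewrite q_col_f_mx mi.
rewrite addn0 subSn //; apply: iff_sym; apply: (lattice_colB nN).
- by move=> j; rewrite stackS mi.
- by move=> r Tr; rewrite p_col_f_mx mi Tr.
by move=> j; rewrite q_col_f_mx mi.
Qed.

Lemma f_mx_unit : f \in unitmx.
Proof.
apply: colspan_full_unit => u; apply/colspan_f_mx => //; rewrite TN; split=> [j|r] h.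
  exact: (snd_block_out nN).
rewrite fst_block_out // big1 // => i _.
by rewrite (stack_covN stdM cardM nN) mulr0.
Qed.

Lemma f_mx_word : flag_word n (colspan f) m.
Proof.
split=> [|c cN]; first exact: TN.
apply: (lattice_nf nN (S := S c)) => [u|j h]; first exact: colspan_f_mx.
exact: S_top.
Qed.

Lemma f_mx_stable c : (c < N)%N -> forall u, u \in colspan f c.+1 -> X *m u \in colspan f c.
Proof.
move=> cN u; have [i ic] : exists i : 'I_N, i = c :> nat by exists (Ordinal cN).
rewrite -ic => /(colspan_f_mx _ (ltn_ord i)) h; apply/(colspan_f_mx _ (ltnW (ltn_ord i))).
have iT := cnt_leq m (ltnW (ltn_ord i)).
have S0 j : (i - T i <= j)%N -> S i j = 0.
  by move=> h'; apply: stack_bot; rewrite ?(ltnW (ltn_ord i)) //; lia.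
move: h; rewrite cntS; case mi: (m i); rewrite ?addn1 ?addn0 ?subSS ?subSn //.
  by apply: (lattice_XT nN) => // j; rewrite stackS mi.
by apply: (lattice_XB nN) => // j; rewrite stackS mi.
Qed.

End MatchingMatrix.

Section ComponentFlags.
Variables (R : realType) (N n : nat) (M : {set Arc N}).
Local Notation C := (Cplx R).
Implicit Types (U : nat -> {vspace 'cV[C]_N}) (u : 'cV[C]_N) (a b : Arc N) (c : nat).
Local Notation p := (@fst_block C N n).
Local Notation q := (@snd_block C N n).
Local Notation X := (jordan C N n).
Local Notation Xp := (jordan_exp C N n).

Definition half_length a := (a.2.+1 - a.1)./2.

(* U c stands for V_c, with positions counted from 0: the spaces V_(init a - 1)
   and V_(term a) of the paper are U a.1 and U a.2.+1. *)
Record component U : Prop := Component {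
  comp_stable : forall c, (c < N)%N -> forall u, u \in U c.+1 -> X *m u \in U c;
  comp_arc : forall a, a \in M -> forall u, u \in U a.2.+1 ->
    Xp (half_length a) *m u \in U a.1;
  comp_top : forall c, (c <= N)%N -> cov M c = None -> forall u, u \in U c ->
    (forall j, (c - cnt (word n M) c <= j)%N -> q u j = 0) /\
    (forall r, (cnt (word n M) c <= r)%N -> p u r = 0) }.

Hypothesis nN : (n <= N)%N.
Hypothesis stdM : std_noncrossing M.
Hypothesis cardM : (#|M| <= minn n (N - n))%N.

Lemma word_cut (A : {set Arc N}) : word n (cut n M A) = cut_word n M A.
Proof.
rewrite cutE //; apply/ffunP => i.
exact: (word_arcs (cnt_cut_word stdM cardM nN A)).
Qed.

Lemma cut_std (A : {set Arc N}) : std_noncrossing (cut n M A).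
Proof. by rewrite cutE // arcs_std. Qed.

Lemma cut_card (A : {set Arc N}) : (#|cut n M A| <= minn n (N - n))%N.
Proof. by rewrite cutE //; apply/card_arcs/cnt_cut_word. Qed.

Lemma arc_half a (m : pred 'I_N) : a \in M ->
  (a.2.+1 + 2 * cnt m a.1 = a.1 + 2 * cnt m a.2.+1)%N ->
  cnt m a.2.+1 = (cnt m a.1 + half_length a)%N.
Proof. by move=> aM; have := arc_lt stdM aM; rewrite /half_length; clear; lia. Qed.

(** By [cut_seq_inv] the stacks before and after an arc of [M] agree, whether it is cut or not,
    while both counts grow by [half_length]; [lattice_Xp] turns this into the arc condition. *)
Lemma cut_f_mx_component (v : Arc N -> C) (rs : seq (Arc N)) :
  uniq rs -> {subset rs <= M} -> pairwise (fun a b => ~~ nested_above a b) rs ->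
  component (colspan (f_mx n (cut n M [set x in rs]%SET) (lam_val n M v rs))).
Proof.
move=> urs rsM prs; set A := [set x in rs]%SET; set M' := cut n M A.
have std' := cut_std A; have card' := cut_card A.
have [] := cut_seq_inv stdM cardM nN v urs rsM prs.
rewrite /cut_seq_val -/A -/M' (_ : cut_seq_word n M rs = word n M' :> pred 'I_N); last first.
  by rewrite /cut_seq_word -/A -word_cut.
move=> I1 I2 _; split.
- exact: f_mx_stable.
- move=> a aM u /(colspan_f_mx nN std' card' _ _ (ltn_ord a.2)) h.
  apply/(colspan_f_mx nN std' card' _ _ (ltnW (ltn_ord a.1))).
  have [e1 e2] := I1 a aM; have ch := arc_half aM e1.
  have aT := cnt_leq (word n M') (ltnW (ltn_ord a.1)).
  apply: (lattice_Xp nN _ e2) => [j h'|].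
    by apply: stack_bot; [exact: ltnW|rewrite -leq_subLR].
  by rewrite -ch -(_ : a.2.+1 - cnt (word n M') a.2.+1 = a.1 - cnt (word n M') a.1 + half_length a)%N //; lia.
move=> c cN c0 u /(colspan_f_mx nN std' card' _ _ cN)[qu pu].
have [<- e2] := I2 c cN c0; split=> // r Tr.
by rewrite pu // big1 // => i _; rewrite e2 mulr0.
Qed.

End ComponentFlags.

(** * The component of a matching *)

Section ComponentWords.
Variables (R : realType) (N n : nat) (M : {set Arc N}).
Local Notation C := (Cplx R).
Implicit Types (U : nat -> {vspace 'cV[C]_N}) (u e z : 'cV[C]_N) (a b : Arc N) (c : nat).
Implicit Types (w : pred 'I_N) (i : 'I_N).
Local Notation p := (@fst_block C N n).
Local Notation q := (@snd_block C N n).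
Local Notation X := (jordan C N n).
Local Notation Xp := (jordan_exp C N n).
Hypothesis nN : (n <= N)%N.
Hypothesis stdM : std_noncrossing M.
Hypothesis cardM : (#|M| <= minn n (N - n))%N.

Lemma arc_length a : a \in M -> a.2.+1 = (a.1 + 2 * half_length a)%N.
Proof.
move=> aM; have lt := arc_lt stdM aM.
have [_ e _] := warcP _ _ _ (arc_warc stdM cardM nN aM).
by have := arc_half stdM aM e; move: e; rewrite /half_length; clear; lia.
Qed.

(** [nf_Xp_leq] bounds the number of T and the number of B along the arc by [half_length a] each,
    and the arc has twice that many letters. *)
Lemma comp_cnt_arc U w a : component n M U -> flag_word n U w -> a \in M ->
  cnt w a.2.+1 = (cnt w a.1 + half_length a)%N.
Proof.
move=> KU wU aM; have i1 := ltnW (ltn_ord a.1); have i2 := ltn_ord a.2.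
have [h1 h2] := flag_word_leq nN wU i2.
have [] := nf_Xp_leq nN (comp_arc KU aM) (wU.2 _ i1) (wU.2 _ i2) h1 h2.
have := cnt_leq w i1; have := cnt_leq w i2; have := arc_length aM.
by clear; lia.
Qed.

(** The prescribed coordinate space belongs to the flag of [f_mx n M (fun=> 0)], whose word is
    known; the inclusion bounds both counts, and their sums are equal. *)
Lemma comp_cnt_top U w c : component n M U -> flag_word n U w -> (c <= N)%N ->
  cov M c = None -> cnt w c = cnt (word n M) c.
Proof.
move=> KU wU cN c0.
have wM := f_mx_word (R := R) nN stdM cardM (fun=> 0).
have UM u : u \in U c -> Xp 0 *m u \in colspan (f_mx n M (fun=> 0 : C)) c.
  move=> /(comp_top KU cN c0)[qu pu]; rewrite jordan_exp0; apply/colspan_f_mx => //.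
  by split=> // r Tr; rewrite pu // big1 // => i _; rewrite (stack_cov0 stdM cardM nN) ?mulr0.
have [h1 h2] := flag_word_leq nN wU cN.
have [] := nf_Xp_leq nN UM (wM.2 c cN) (wU.2 c cN) h1 h2.
have := cnt_leq w cN; have := cnt_leq (word n M) cN.
by clear; lia.
Qed.

Lemma comp_word_unmatched U w i : component n M U -> flag_word n U w ->
  on_no_arc M i -> w i = word n M i.
Proof.
move=> KU wU ni.
have := comp_cnt_top KU wU (ltn_ord i) (cov_unmatchedS stdM ni).
rewrite !cntS (comp_cnt_top KU wU (ltnW (ltn_ord i)) (cov_unmatched stdM ni)).
by move=> /addnI; case: (w i); case: (word n M i).
Qed.

Lemma comp_word_arc U w a : component n M U -> flag_word n U w -> a \in M ->
  w a.2 = ~~ w a.1.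
Proof.
move=> KU wU aM; have lt := arc_lt stdM aM; have aN := ltn_ord a.2.
(* The letters strictly between the ends form a chain of arcs, each with as many T as B, so one T
   and one B remain for the ends. *)
suff : (a.2 + 2 * cnt w a.1.+1 = a.1.+1 + 2 * cnt w a.2)%N.
  have := comp_cnt_arc KU wU aM; have := arc_length aM; rewrite !cntS.
  by case: (w a.1); case: (w a.2) => //= + +; clear; lia.
apply: (@chain_ind N M stdM (fun c => c + 2 * cnt w a.1.+1 = a.1.+1 + 2 * cnt w c)%N
  a.1.+1) => //.
- by rewrite lt ltnW.
- move=> b bM ab; rewrite (covers_end stdM aM bM) -(covers_arc stdM aM bM).
  apply/negP => /orP[/eqP e|/andP[ba _]]; first by move: ab; rewrite e ltnn.
  by move: ba; rewrite ltnNge (ltnW ab).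
- move=> b bM ba ab; rewrite leqNgt; apply/negP => b2a.
  have [e|ne] := eqVneq (b.1 : nat) a.1.
    by move: b2a; rewrite (arc_eq1 stdM bM aM e) ltnn.
  have := arc_nc stdM aM bM; rewrite ltn_neqAle ne ab -ltnS ba /= => /(_ isT isT).
  by rewrite ltnNge (ltnW b2a).
- move=> i ia ni; have := @arc_std N M stdM a i aM; rewrite ni.
  by move: ia => /andP[-> ->] /(_ isT).
move=> b bM _ _; have := comp_cnt_arc KU wU bM; have := arc_length bM.
by clear; lia.
Qed.

Lemma comp_word_cut U w : component n M U -> flag_word n U w ->
  w =1 cut_word n M [set a in M | w a.1]%SET.
Proof.
move=> KU wU; set A := [set a in M | w a.1]%SET.
have AM : A \subset M by apply/fintype.subsetP => a; rewrite inE => /andP[].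
have out b : b \in M -> b \notin A -> w b.1 = false.
  by move=> bM; rewrite inE bM /= => /negbTE.
have not_end b i : b \in M -> b \notin A -> (b.1 == i) || (b.2 == i) ->
    forall a, a \in A -> a.1 != i /\ a.2 != i.
  move=> bM bA bi a aA; have aM : a \in M by apply: (fintype.subsetP AM).
  apply/andP; rewrite -negb_or; apply/negP => ai; move: bA.
  suff -> : b = a by rewrite aA.
  apply: (arc_eq stdM) => //.
  by case/orP: bi => /eqP ->; case/orP: ai => /eqP ->;
    [constructor 1|constructor 2|constructor 3|constructor 4].
move=> i; have [/startsP[b bM e]|ns] := boolP (starts M i).
  have [bA|bA] := boolP (b \in A).
    by rewrite -e (cut_word_arc stdM cardM nN AM bA).1; move: bA; rewrite inE => /andP[].
  rewrite cut_word_out //; last by apply: (not_end b) => //; rewrite e eqxx.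
  by rewrite -e (word_arc stdM cardM nN bM).1 out.
have [/endsP[b bM e]|ne] := boolP (ends M i).
  rewrite -e (comp_word_arc KU wU bM).
  have [bA|bA] := boolP (b \in A).
    by rewrite (cut_word_arc stdM cardM nN AM bA).2; move: bA; rewrite inE => /andP[_ ->].
  rewrite cut_word_out //; last by apply: (not_end b) => //; rewrite eqxx orbT.
  by rewrite (word_arc stdM cardM nN bM).2 out.
have ni : on_no_arc M i by rewrite /on_no_arc ns.
rewrite (comp_word_unmatched KU wU ni) cut_word_out // => a aA.
have aM : a \in M by apply: (fintype.subsetP AM).
by split; apply/eqP => e; [move: ns|move: ne]; rewrite -e ?starts_arc ?ends_arc.
Qed.

(** By [nf_sub] an inclusion is enough at each gap. The next space is forced at the end of an arc by
    the arc condition, at a T by the normal form, and at an unmatched position by [comp_top]. Only a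
    B that starts an arc leaves a freedom, that of the row [cnt w a.1] of the new vector. *)
Lemma comp_uniq U U' w : full_flag U -> full_flag U' ->
  component n M U -> component n M U' -> flag_word n U w -> flag_word n U' w ->
  (forall a, a \in M -> ~~ w a.1 -> exists z z',
    [/\ z \in U a.1.+1, z' \in U' a.1.+1, (forall j, q z j = q z' j),
        q z (a.1 - cnt w a.1) != 0 & forall r, (r <= cnt w a.1)%N -> p z r = p z' r]) ->
  forall c u, (c <= N)%N -> (u \in U c) = (u \in U' c).
Proof.
move=> fU fU' KU KU' wU wU' hz.
have half c : (c <= N)%N -> (forall u, u \in U c -> u \in U' c) ->
    forall u, (u \in U c) = (u \in U' c).
  move=> cN h u; apply/idP/idP; first exact: h.
  exact: nf_sub (wU.2 c cN) (wU'.2 c cN) h _.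
suff H : forall c, (c <= N)%N -> forall d, (d <= c)%N -> forall u, (u \in U d) = (u \in U' d).
  by move=> c u cN; apply: (H c).
apply: gap_ind => [d|i IH d].
  by rewrite leqn0 => /eqP -> u; apply/idP/idP => /flag_0 ->; rewrite ?mem0v.
rewrite leq_eqVlt => /orP[/eqP->|]; last exact: IH.
have iN := ltnW (ltn_ord i); have EQ := IH i (leqnn _).
apply: half => // u uU.
have nfi := wU.2 i iN; have nfS := wU.2 _ (ltn_ord i).
have nfi' := wU'.2 i iN; have nfS' := wU'.2 _ (ltn_ord i).
have ci := cnt_leq w iN.
have [/endsP[a aM ai]|ne] := boolP (ends M i).
  rewrite -ai in uU nfS' *.
  have [e qe ue] := nf_proj nfS' (nf_snd (wU.2 _ (ltn_ord a.2)) uU).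
  have h1 := comp_arc KU aM uU; have h2 := comp_arc KU' aM ue.
  have a1i : (a.1 <= i)%N by rewrite -ai ltnW // (arc_lt stdM).
  rewrite -(IH _ a1i) in h2.
  have h3 : Xp (half_length a) *m e \in U a.1.
    have -> : e = u - (u - e) by rewrite subKr.
    by rewrite mulmxBr memvB.
  (* As [Xp (half_length a) *m e] lies in [U a.1] and in E, the rows of [e] are among those of
     [U' a.2.+1]. *)
  have eU' : e \in U' a.2.+1.
    apply: (nf_mem nfS') => // r; rewrite (comp_cnt_arc KU wU aM) => hr.
    have ler : (half_length a <= r)%N by apply: leq_trans hr; rewrite leq_addl.
    rewrite -(subnK ler) -(fst_block_exp nN).
    apply: (nf_fst (wU.2 _ (ltnW (ltn_ord a.1))) h3) => [j|].
      by rewrite (snd_block_exp nN) qe.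
    by rewrite leq_subRL // addnC.
  by rewrite -[u](subrK e) memvD.
have [mi|mi] := boolP (w i).
  have qu j : (i - cnt w i <= j)%N -> q u j = 0.
    move=> hj; apply: (nf_snd nfS uU); rewrite cntS mi addn1 subSS //.
  have [e qe ue] := nf_proj nfi qu.
  have ueS : u - e \in U i.+1 by apply: flag_mono.
  have eU : e \in U i.+1 by rewrite -[e](subKr u) memvB.
  rewrite -[u](subrK e) memvD //; first by apply: flag_mono => //; rewrite -EQ.
  by apply: (nf_mem nfS') => // r; apply: (nf_fst nfS eU).
have [/startsP[a aM ai]|ns] := boolP (starts M i).
  rewrite -ai in mi EQ uU nfi nfS ci *.
  have [z [z' [zU zU' qz qz0 pz]]] := hz a aM mi.
  (* The image under X of this vector of E lies in [U a.1], which kills the rows after [cnt w a.1];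
     the other rows agree by hypothesis. *)
  have zz' : z - z' = 0.
    apply: (block_ext (n := n)) => j; last by rewrite snd_blockB qz subrr snd_block0.
    rewrite fst_block0; have [jt|tj] := leqP j (cnt w a.1); first by rewrite fst_blockB pz // subrr.
    case: j tj => // r tr; rewrite -(fst_blockX nN).
    have a1N := ltn_ord a.1.
    have Xz : X *m (z - z') \in U a.1.
      rewrite mulmxBr memvB //; first exact: (comp_stable KU).
      by rewrite EQ; apply: (comp_stable KU').
    by apply: (nf_fst nfi Xz) => // j; rewrite (snd_blockX nN) snd_blockB qz subrr.
  move/eqP: zz'; rewrite subr_eq0 => /eqP zz'; subst z'.
  pose a0 := q u (a.1 - cnt w a.1) / q z (a.1 - cnt w a.1).
  have [|e qe ue] := nf_proj nfi (u := u - a0 *: z).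
    move=> j; rewrite leq_eqVlt snd_blockB snd_blockZ => /orP[/eqP <-|hj]; first by rewrite divfK ?subrr.
    have hj' : (a.1.+1 - cnt w a.1.+1 <= j)%N by rewrite cntS (negbTE mi) addn0 subSn.
    by rewrite (nf_snd nfS uU hj') (nf_snd nfS zU hj') mulr0 subrr.
  have ueS : u - a0 *: z - e \in U a.1.+1 by apply: flag_mono.
  have eU : e \in U a.1.+1.
    rewrite -[e](subKr (u - a0 *: z)) memvB //.
    by rewrite memvB // memvZ.
  have eU1 : e \in U a.1.
    apply: (nf_mem nfi) => // r hr; apply: (nf_fst nfS eU) => //.
    by rewrite cntS (negbTE mi) addn0.
  rewrite -[u](subrK (a0 *: z)) memvD ?memvZ //; apply: flag_mono => //.
  by rewrite -EQ -[_ - _](subrK e) memvD.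
have ni : on_no_arc M i by rewrite /on_no_arc ns.
have cS := cov_unmatchedS stdM ni; have iN' := ltn_ord i.
have cw := comp_cnt_top KU wU iN' cS.
have [qu pu] := comp_top KU iN' cS uU; rewrite -cw in qu pu.
have [e qe ue] := nf_proj nfS' qu.
have [_ pue] := comp_top KU' iN' cS ue; rewrite -cw in pue.
rewrite -[u](subrK e) memvD //; apply: (nf_mem nfS') => // r hr.
by have := pue r hr; rewrite fst_blockB pu // sub0r => /eqP; rewrite oppr_eq0 => /eqP.
Qed.

(** The arc conditions hold by induction on the length: the arcs directly under [a] bring [U a.2]
    into [U a.1.+1], one more X leads into [U a.1], and the T at [a.2] only adds a vector of E with
    few enough rows. *)
Lemma word_component U : full_flag U ->
  (forall c, (c < N)%N -> forall u, u \in U c.+1 -> X *m u \in U c) ->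
  flag_word n U (word n M) -> component n M U.
Proof.
move=> fU XU wU; set m := word n M in wU *.
have nf c : (c <= N)%N -> normal_form n (U c) (cnt m c) (c - cnt m c) by apply: wU.2.
have down (i : 'I_N) u : m i -> u \in U i.+1 -> exists e,
    [/\ u - e \in U i, forall j, q e j = 0 & forall r, (cnt m i < r)%N -> p e r = 0].
  move=> mi uU; have nfS := nf _ (ltn_ord i).
  have [j hj|e qe ue] := nf_proj (nf i (ltnW (ltn_ord i))) (u := u).
    by apply: (nf_snd nfS uU); rewrite cntS mi addn1 subSS.
  exists e; split=> // r hr; apply: (nf_fst nfS (u := e)) => //; last by rewrite cntS mi addn1.
  by rewrite -[e](subKr u) memvB // flag_mono.
have arcK : forall k a, (half_length a <= k)%N -> a \in M -> forall u, u \in U a.2.+1 ->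
    Xp (half_length a) *m u \in U a.1.
  elim=> [|k IH] a ak aM u uU.
    by have := arc_length aM; have := arc_lt stdM aM; move: ak; clear; lia.
  have lt := arc_lt stdM aM; have aN := ltn_ord a.2.
  have [m1 m2] := word_arc stdM cardM nN aM.
  pose P c := exists l, [/\ c = (a.1.+1 + 2 * l)%N, cnt m c = (cnt m a.1.+1 + l)%N &
    forall u, u \in U c -> Xp l *m u \in U a.1.+1].
  have [l [l1 l2 l3]] : P a.2.
    apply: (@chain_ind N M stdM P a.1.+1) => //.
    - by rewrite lt ltnW.
    - move=> b bM ab; rewrite (covers_end stdM aM bM) -(covers_arc stdM aM bM).
      apply/negP => /orP[/eqP e|/andP[ba _]]; first by move: ab; rewrite e ltnn.
      by move: ba; rewrite ltnNge (ltnW ab).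
    - move=> b bM ba ab; rewrite leqNgt; apply/negP => b2a.
      have [e|ne] := eqVneq (b.1 : nat) a.1.
        by move: b2a; rewrite (arc_eq1 stdM bM aM e) ltnn.
      have := arc_nc stdM aM bM; rewrite ltn_neqAle ne ab -ltnS ba /= => /(_ isT isT).
      by rewrite ltnNge (ltnW b2a).
    - by exists 0%N; rewrite muln0 !addn0; split=> // u' u'U; rewrite jordan_exp0.
    - move=> i ia ni; have := @arc_std N M stdM a i aM; rewrite ni.
      by move: ia => /andP[-> ->] /(_ isT).
    move=> b bM ab ba [l [l1 l2 l3]]; exists (l + half_length b)%N.
    have wb := arc_warc stdM cardM nN bM; have [_ eb _] := warcP _ _ _ wb.
    split; first by rewrite arc_length // l1; clear; lia.
      by rewrite (arc_half stdM bM eb) l2 addnA.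
    move=> u' u'U; rewrite (jordan_expD nN); apply: l3; apply: IH => //.
    by have := arc_length bM; have := arc_length aM; move: ab ba ak; clear; lia.
  have ha : half_length a = l.+1 by have := arc_length aM; rewrite l1; clear; lia.
  have [e [ue qe pe]] := down a.2 u m2 uU.
  rewrite -[u](subrK e) mulmxDr memvD //.
    by rewrite ha jordan_expS; apply: XU => //; apply: l3.
  apply: (nf_mem (nf _ (ltnW (ltn_ord a.1)))) => [j|r hr].
    by rewrite (snd_block_exp nN) qe.
  rewrite (fst_block_exp nN) pe // l2 cntS m1 addn0 ha addnS ltnS leq_add2r //.
split=> // [a aM|c cN c0 u uU]; first exact: (arcK (half_length a)).
have cov0 b : b \in M -> covers b c = false by apply: (cov_NoneP stdM).
have cross b : b \in M -> (b.1 < c)%N -> (c <= b.2)%N -> False.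
  by move=> bM b1 b2; have := cov0 b bM; rewrite /covers b1 b2.
have arc_cnt b (bM : b \in M) : cnt m b.2.+1 = (cnt m b.1 + half_length b)%N.
  by have [_ eb _] := warcP _ _ _ (arc_warc stdM cardM nN bM); apply: (arc_half stdM bM eb).
(* If no unmatched B precedes [c], then arcs and letters T lead from gap 0 to [c] and bound the rows
   in the first block. Otherwise arcs and letters B lead from [c] to [N], and this chain is followed
   backwards with [nf_back]. *)
have [le|gt] := leqP (cnt (on_no_arc M) c) (n - #|M|).
  have : forall u, u \in U c -> forall r, (cnt m c <= r)%N -> p u r = 0.
    apply: (@chain_ind N M stdM (fun c => forall u, u \in U c ->
      forall r, (cnt m c <= r)%N -> p u r = 0) 0) => //.
    - by move=> b bM _; apply: cov0.
    - by move=> u' /(flag_0 fU) -> r _; rewrite fst_block0.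
    - move=> i /= ic ni IH u' u'U r hr.
      have mi : m i.
        rewrite /m (wordE stdM cardM nN) ni; apply/orP; right.
        apply: leq_trans le; have := cnt_mono (on_no_arc M) ic; rewrite cntS ni addn1 //.
      have [e [ue qe pe]] := down i u' mi u'U.
      rewrite -[u'](subrK e) fst_blockD pe ?addr0; last by move: hr; rewrite cntS mi addn1.
      by apply: IH ue _ _; apply: leq_trans hr; rewrite cntS leq_addr.
    move=> b bM _ _ IH u' u'U r; rewrite arc_cnt // => hr.
    have ler : (half_length b <= r)%N by apply: leq_trans hr; rewrite leq_addl.
    rewrite -(subnK ler) -(fst_block_exp nN); apply: IH; first exact: (arcK (half_length b)).
    by rewrite leq_subRL // addnC.
  move=> pu; split=> [j hj|]; last exact: pu.
  exact: (nf_snd (nf c cN) uU).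
have cN' : (c - cnt m c + 0 <= N - n)%N.
  by rewrite addn0; have [] := flag_word_leq nN wU cN.
suff Ec : forall u, (forall j, (c - cnt m c <= j)%N -> q u j = 0) ->
    (forall r, (cnt m c <= r)%N -> p u r = 0) -> u \in U c.
  have qu := nf_snd (nf c cN) uU; split=> // r hr.
  pose u0 : 'cV[C]_N := block_vec N n (fun=> 0) (q u).
  have pu0 k : p u0 k = 0 by rewrite fst_block_vec0.
  have qu0 j : q u0 j = q u j.
    have [/snd_block_vec -> //|ge] := ltnP (n + j) N.
    by rewrite !(snd_block_out nN) //; move: ge; clear; lia.
  have u0U : u0 \in U c by apply: Ec => // j hj; rewrite qu0 qu.
  have : p (u - u0) r = 0; last by rewrite fst_blockB pu0 subr0.
  apply: (nf_fst (nf c cN)) => //; first exact: memvB.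
  by move=> j; rewrite snd_blockB qu0 subrr.
pose E d := forall u, (forall j, (d - cnt m d <= j)%N -> q u j = 0) ->
  (forall r, (cnt m d <= r)%N -> p u r = 0) -> u \in U d.
suff : E N -> E c by apply=> u' _ _; apply: flag_N.
apply: (@chain_ind N M stdM (fun d => E d -> E c) c) => //.
- by rewrite cN leqnn.
- by move=> b bM _; rewrite /covers [(N <= _)%N]leqNgt !ltn_ord andbF.
- by move=> b bM b1 b2; case: (cross b).
- move=> i ic ni IH h; apply: IH.
  have mi : m i = false.
    rewrite /m (wordE stdM cardM nN) ni; move: ni => /andP[_ /negbTE ->] /=.
    apply/negbTE; rewrite -leqNgt; apply: leq_trans (ltnW gt) _; apply: cnt_mono.
    by case/andP: ic.
  have iN := ltn_ord i; have iT := cnt_leq m (ltnW iN).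
  have cS : (i.+1 - cnt m i.+1 = i - cnt m i + 1)%N.
    by rewrite cntS mi addn0 subSn ?addn1.
  apply: (nf_back (k := 1) nN (nf i (ltnW iN)) (V' := U i.+1)).
  + by rewrite -cS; have [] := flag_word_leq nN wU iN.
  + by move=> u' u'U; rewrite jordan_expS jordan_exp0; apply: XU.
  by move=> u' qu' pu'; apply: h => // j; rewrite cS; apply: qu'.
move=> b bM cb bN IH h; apply: IH.
have bN1 := ltnW (ltn_ord b.1).
have bS : (b.2.+1 - cnt m b.2.+1 = b.1 - cnt m b.1 + half_length b)%N.
  have := arc_length bM; have := arc_cnt b bM; have := cnt_leq m bN1.
  by clear; lia.
apply: (nf_back nN (nf _ bN1) (k := half_length b) (V' := U b.2.+1)).
- by rewrite -bS; have [] := flag_word_leq nN wU (ltn_ord b.2).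
- exact: (arcK (half_length b)).
by move=> u' qu' pu'; apply: h => // j; rewrite bS; apply: qu'.
Qed.

End ComponentWords.

(** * Deformations *)

Lemma linear_mulmx (F : fieldType) (N : nat) (f : 'cV[F]_N -> 'cV[F]_N) :
  (forall a u v, f (a *: u + v) = a *: f u + f v) ->
  exists Y : 'M[F]_N, forall u, Y *m u = f u.
Proof.
move=> fP; exists (\matrix_(i, j) f (delta_mx j 0) i 0) => u.
have f0 : f 0 = 0 by have := fP (-1) 0 0; rewrite scaler0 addr0 scaleN1r addNr.
have -> : f u = f (\sum_j u j 0 *: delta_mx j 0).
  congr f; apply/colP => i; rewrite summxE (bigD1 i) //= !mxE !eqxx mulr1 big1 ?addr0 //.
  by move=> j ji; rewrite !mxE eq_sym (negbTE ji) mulr0.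
have -> : f (\sum_j u j 0 *: delta_mx j 0) = \sum_j u j 0 *: f (delta_mx j 0).
  by elim/big_rec2: _ => // j x y _ <-; rewrite fP.
apply/colP => i; rewrite mxE summxE; apply: eq_bigr => j _.
by rewrite !mxE mulrC.
Qed.

Section Deformation.
Variables (F : fieldType) (N n : nat).
Implicit Types (V W Z : {vspace 'cV[F]_N}) (u x z : 'cV[F]_N).
Local Notation p := (@fst_block F N n).
Local Notation q := (@snd_block F N n).
Local Notation X := (jordan F N n).
Local Notation Xp := (jordan_exp F N n).
Hypothesis nN : (n <= N)%N.

Lemma stable_Xp V : (forall u, u \in V -> X *m u \in V) ->
  forall k u, u \in V -> Xp k *m u \in V.
Proof. by move=> XV; elim=> [|k IH] u uV; rewrite ?jordan_exp0 // jordan_expS XV // IH. Qed.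

(* Z / W is a free module of rank 2 over C[X] / X^k, with generators mapped by
   X^(k-1) to e_t and to a vector outside of W + E; Y is the endomorphism that
   sends the first generator to the second one, and the second one to 0. *)
Lemma shear_exists W Z t b k : (0 < k)%N -> (b + k <= N - n)%N -> (t < n)%N ->
  normal_form n W t b -> normal_form n Z (t + k) (b + k) ->
  (forall u, u \in W -> u \in Z) ->
  (forall u, u \in W -> X *m u \in W) -> (forall u, u \in Z -> X *m u \in Z) ->
  (forall u, u \in Z -> Xp k *m u \in W) ->
  exists Y : 'M[F]_N,
  [/\ forall u, u \in W -> Y *m u = 0, forall u, Y *m u \in Z,
      forall u, u \in Z -> X *m (Y *m u) - Y *m (X *m u) \in W,
      Y *m Y = 0
    & exists e, [/\ forall j, q e j = 0, forall r, (t < r)%N -> p e r = 0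
        & q (Y *m e) b = 1]].
Proof.
move=> k0 bkn tn nfW nfZ WZ XW XZ XkZ.
pose B := (b + k)%N.
have [z zZ qz] : exists2 z, z \in Z & forall j, q z j = (j == B.-1)%:R.
  pose f := block_vec N n (fun=> 0) (fun j => (j == B.-1)%:R : F).
  have qf j : q f j = (j == B.-1)%:R.
    have [/snd_block_vec -> //|ge] := ltnP (n + j) N.
    by rewrite (snd_block_out nN) ?gtn_eqF //; move: ge bkn; rewrite /B; clear -k0; lia.
  have [|e qe fe] := nf_proj nfZ (u := f).
    by move=> j hj; rewrite qf gtn_eqF //; move: hj; rewrite /B; clear -k0; lia.
  by exists (f - e) => // j; rewrite snd_blockB qe subr0 qf.
have XpW := stable_Xp XW; have XpZ := stable_Xp XZ.
(* These vectors lift the basis of the second block to Z and are permuted downwards by X; the first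
   [b] of them lie in W. *)
pose H j := Xp (B.-1 - j) *m z.
have HZ j : H j \in Z by apply: XpZ.
have XkW l : (k <= l)%N -> Xp l *m z \in W.
  by move=> kl; rewrite -(subnK kl) (jordan_expD nN); apply/XpW/XkZ.
have HW j : (j < b)%N -> H j \in W.
  by move=> jb; apply: XkW; move: jb; rewrite /B; clear -k0; lia.
have qH j i : (j < B)%N -> q (H j) i = (i == j)%:R.
  move=> jB; rewrite (snd_block_exp nN) qz; congr (nat_of_bool _)%:R.
  by apply/eqP/eqP; move: jB; rewrite /B; clear; lia.
have XH j : (j.+1 < B)%N -> X *m H j.+1 = H j.
  by move=> jB; rewrite -jordan_expS; congr (Xp _ *m _); move: jB; clear; lia.
have XH0 : X *m H 0 \in W.
  by rewrite -jordan_expS; apply: XkW; rewrite /B; clear -k0; lia.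
have XHb : X *m H b \in W.
  by rewrite -jordan_expS; apply: XkW; rewrite /B; clear -k0; lia.
(* On Z, the projection to E along the span of the [H j]. *)
pose pr x := x - \sum_(j < B) q x j *: H j.
have prP a u v : pr (a *: u + v) = a *: pr u + pr v.
  rewrite /pr scalerBr scaler_sumr addrACA -opprD -big_split /=; congr (_ - _).
  by apply: eq_bigr => j _; rewrite snd_blockP scalerDl scalerA.
have qpr x i : (forall j, (B <= j)%N -> q x j = 0) -> q (pr x) i = 0.
  move=> qx; rewrite snd_blockB snd_block_sum; have [iB|Bi] := ltnP i B.
    rewrite (bigD1 (Ordinal iB)) //= big1 => [|j ji].
      by rewrite snd_blockZ qH // eqxx mulr1 addr0 subrr.
    by move: ji; rewrite -val_eqE snd_blockZ qH //= eq_sym => /negbTE ->; rewrite mulr0.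
  rewrite qx // big1 ?subrr // => j _.
  by rewrite snd_blockZ qH // gtn_eqF ?mulr0 // (leq_trans (ltn_ord j)).
have prW x : x \in W -> forall r, (t <= r)%N -> p (pr x) r = 0.
  move=> xW; apply: (nf_fst nfW).
    rewrite memvB // memv_suml // => j _; have [jb|bj] := ltnP j b.
      by rewrite memvZ // HW.
    by rewrite (nf_snd nfW xW) // scale0r mem0v.
  move=> i; apply: qpr => j Bj; apply: (nf_snd nfW xW).
  by apply: leq_trans Bj; rewrite leq_addr.
have prZ x : x \in Z -> p (pr x) (t + k) = 0.
  move=> xZ; apply: (nf_fst nfZ) (leqnn _) => [|i].
    by rewrite memvB // memv_suml // => j _; rewrite memvZ.
  by apply: qpr; apply: (nf_snd nfZ xZ).
have prX x : x \in Z -> forall r, (t <= r)%N -> p (pr (X *m x)) r = p (pr x) r.+1.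
  move=> xZ r tr; rewrite -(fst_blockX nN).
  (* The error term is in W and in E, so it has no row from [t] on. *)
  suff -> : pr (X *m x) = X *m pr x + q x 0 *: (X *m H 0).
    rewrite fst_blockD fst_blockZ [p (X *m H 0) r](nf_fst nfW) ?mulr0 ?addr0 // => i.
    by rewrite (snd_blockX nN) qH // addn_gt0 k0 orbT.
  rewrite /pr mulmxBr -addrA; congr (_ + _).
  have BE : B = B.-1.+1 by rewrite prednK // addn_gt0 k0 orbT.
  rewrite mulmx_sumr BE big_ord_recr /= [in RHS]big_ord_recl /=.
  rewrite (snd_blockX nN) -BE (nf_snd nfZ xZ) ?leqnn // scale0r addr0 -scalemxAr opprD.
  rewrite addrAC addNr add0r; congr (- _); apply: eq_bigr => j _.
  by rewrite (snd_blockX nN) -scalemxAr /bump add1n XH // -ltn_predRL.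
(* The basis vectors of E in the rows from [t] to t + k - 1 go to the [H j] with [j] from [b] to b +
   k - 1. *)
pose y x := \sum_(l < k) p (pr x) (t + l) *: H (b + l)%N.
have yP a u v : y (a *: u + v) = a *: y u + y v.
  rewrite /y scaler_sumr -big_split /=; apply: eq_bigr => l _.
  by rewrite prP fst_blockP scalerDl scalerA.
have [Y YE] := linear_mulmx yP.
have prH j : (j < B)%N -> pr (H j) = 0.
  move=> jB; rewrite /pr (bigD1 (Ordinal jB)) //= big1 => [|i ij].
    by rewrite qH // eqxx scale1r addr0 subrr.
  by move: ij; rewrite -val_eqE qH //= => /negbTE ->; rewrite scale0r.
exists Y; split.
- move=> u uW; rewrite YE /y big1 // => l _.
  by rewrite prW ?leq_addr // scale0r.
- by move=> u; rewrite YE memv_suml // => l _; rewrite memvZ.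
- move=> u uZ; rewrite !YE /y.
  case: k k0 @B bkn nfZ XkZ zZ qz XpZ H HZ XkW HW qH XH XH0 XHb pr prP qpr prW prZ prX y yP YE prH
    => // k _ B bkn nfZ XkZ zZ qz XpZ H HZ XkW HW qH XH XH0 XHb pr prP qpr prW prZ prX y yP YE prH.
  (* The two sums are shifted against each other: the row after the last one vanishes on Z, and the
     term left over is a multiple of [X *m H b], which lies in W. *)
  rewrite big_ord_recl [in X in _ - X]big_ord_recr /=.
  rewrite prX ?leq_addr // -addnS prZ // scale0r addr0 addn0 addn0.
  rewrite mulmxDr mulmx_sumr -addrA -scalemxAr.
  rewrite (_ : _ - _ = 0) ?addr0 ?memvZ //.
  apply/eqP; rewrite subr_eq0; apply/eqP; apply: eq_bigr => l _.
  rewrite -scalemxAr /bump add1n !addnS XH; last first.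
    by rewrite /B addnS ltnS ltn_add2l ltn_ord.
  by rewrite prX ?leq_addr.
(* The image of Y is in the span of the [H j], which [pr] kills. *)
- apply/row_matrixP => i; rewrite row0; apply/rowP => j; rewrite !mxE.
  have := YE (Y *m delta_mx j 0); rewrite mulmxA -colE => /colP /(_ i).
  rewrite !mxE => ->; rewrite /y summxE big1 // => l _.
  suff -> : pr (Y *m delta_mx j 0) = 0 by rewrite fst_block0 scale0r mxE.
  rewrite YE /y; have pr0 : pr 0 = 0.
    by have := prP (-1) 0 0; rewrite scaler0 addr0 scaleN1r addNr.
  elim/big_rec: _ => // l' x _ prx; rewrite prP prx addr0 prH ?scaler0 //.
  by rewrite /B ltn_add2l.
pose e := block_vec N n (fun r => (r == t)%:R : F) (fun=> 0).
have pe r : p e r = (r == t)%:R.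
  by apply: (fst_block_vec0 nN) => {}r nr; rewrite gtn_eqF // (leq_trans tn).
have qe j : q e j = 0 by apply: (snd_block_vec0 nN).
exists e; split=> // [r tr|]; first by rewrite pe gtn_eqF.
have pre : pr e = e.
  by rewrite /pr big1 ?subr0 // => j _; rewrite qe scale0r.
rewrite YE /y snd_block_sum (bigD1 (Ordinal k0)) //= big1 => [|l l0].
  by rewrite pre pe addn0 eqxx scale1r addn0 qH ?eqxx ?addr0 // -[X in (X < _)%N]addn0 ltn_add2l.
have l0' : l != 0%N :> nat by move: l0; rewrite -val_eqE.
by rewrite pre pe -[X in _ == X]addn0 eqn_add2l (negbTE l0') scale0r snd_block0.
Qed.

End Deformation.

Section DeformFlag.
Variables (R : realType) (N n : nat) (M : {set Arc N}).
Local Notation C := (Cplx R).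
Implicit Types (u e z : 'cV[C]_N) (a b : Arc N) (c : nat) (w : pred 'I_N) (i : 'I_N).
Local Notation p := (@fst_block C N n).
Local Notation q := (@snd_block C N n).
Local Notation X := (jordan C N n).
Local Notation Xp := (jordan_exp C N n).
Hypothesis nN : (n <= N)%N.
Hypothesis stdM : std_noncrossing M.
Hypothesis cardM : (#|M| <= minn n (N - n))%N.

(** Take W = [U a.1] and Z = [U a.2.+1]. As Y has square 0, the matrix 1 + tY has inverse 1 - tY. It
    preserves the spaces up to W and from Z on, and in between the conditions survive because X and
    Y commute on Z modulo W. *)
Lemma component_shear (g : 'M[C]_N) w a : g \in unitmx ->
  component n M (colspan g) -> flag_word n (colspan g) w -> a \in M -> w a.1 ->
  exists Y : 'M[C]_N, (forall t, (1%:M + t *: Y) *m g \in unitmx) /\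
    forall t, t != 0 -> component n M (colspan ((1%:M + t *: Y) *m g)) /\
      exists w', [/\ flag_word n (colspan ((1%:M + t *: Y) *m g)) w',
        forall i, (i < a.1)%N -> w' i = w i & w' a.1 = false].
Proof.
move=> gU KU wU aM wa; set U := colspan g.
have fU : full_flag U by apply: colspan_full_flag.
have a1N := ltnW (ltn_ord a.1); have a2N := ltn_ord a.2.
have a12 := arc_lt stdM aM; have La := arc_length nN stdM cardM aM.
have ca := comp_cnt_arc nN stdM cardM KU wU aM.
set k := half_length a in La ca.
have cw1 := cnt_leq w a1N.
have cw2 : (a.2.+1 - cnt w a.2.+1 = a.1 - cnt w a.1 + k)%N.
  by move: La ca cw1; clear; lia.
have k0 : (0 < k)%N by move: La a12; clear; lia.
have [h1 h2] := flag_word_leq nN wU a2N.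
have tn : (cnt w a.1 < n)%N by move: h1; rewrite ca; move: k0; clear; lia.
rewrite cw2 in h2.
have nfW := wU.2 _ a1N; have nfZ := wU.2 _ a2N; rewrite cw2 ca in nfZ.
have XU c u : (c <= N)%N -> u \in U c -> X *m u \in U c.
  case: c => [_ /(flag_0 fU) ->|c cN uU]; first by rewrite mulmx0 mem0v.
  by apply: flag_mono => //; apply: (comp_stable KU).
have UZ c : (c <= a.2.+1)%N -> forall u, u \in U c -> u \in U a.2.+1.
  by move=> ca2 u; apply: flag_monoW.
have WU c : (a.1 <= c)%N -> forall u, u \in U a.1 -> u \in U c.
  by move=> ca1 u; apply: flag_monoW.
have WZ : forall u, u \in U a.1 -> u \in U a.2.+1 by apply: WU; rewrite leqW // ltnW.
have [Y [YW YZ comm YY [e [qe pe qYe]]]] := shear_exists nN k0 h2 tn nfW nfZ WZ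
  (fun u => XU _ u a1N) (fun u => XU _ u a2N) (comp_arc KU aM).
exists Y; pose P t : 'M[C]_N := 1%:M + t *: Y.
have PP t : P t *m P (- t) = 1%:M.
  rewrite /P mulmxDl mul1mx mulmxDr mulmx1 -scalemxAl -scalemxAr YY !scaler0 addr0.
  by rewrite -addrA scaleNr addNr addr0.
have PU t : P t \in unitmx by have [h _] := mulmx1_unit (PP t); exact: h.
have PV t : invmx (P t) = P (- t).
  by rewrite -[LHS]mulmx1 -(PP t) mulmxA mulVmx // mul1mx.
have PE t u : P t *m u = u + t *: (Y *m u) by rewrite mulmxDl mul1mx -scalemxAl.
split=> [t|t t0]; first by rewrite unitmx_mul PU.
set U' := colspan _.
have U'E c u : u \in U' c <-> P (- t) *m u \in U c.
  by rewrite (colspan_mulmx _ _ _ (PU t)) PV.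
have U'P c u : u \in U c -> P t *m u \in U' c.
  by move=> uU; apply/U'E; rewrite mulmxA -{2}[t]opprK PP mul1mx.
have same c u : (c <= a.1)%N || (a.2 < c)%N -> (u \in U' c) = (u \in U c).
  case/orP => hc; apply/idP/idP.
  - move=> /U'E h; have := YW _ (flag_monoW fU hc h).
    rewrite PE mulmxDr -scalemxAr mulmxA YY mul0mx scaler0 addr0 => Yu.
    by move: h; rewrite PE Yu scaler0 addr0.
  - move=> uU; apply/U'E; rewrite PE YW ?scaler0 ?addr0 //.
    exact: flag_monoW uU.
  - move=> /U'E; rewrite PE => h; rewrite -[u](addrK (- t *: (Y *m u))).
    by rewrite memvB // memvZ // (flag_monoW fU hc).
  move=> uU; apply/U'E; rewrite PE memvD // memvZ //.
  exact: (flag_monoW fU hc).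
have commX l s : s \in U a.2.+1 -> Xp l *m (Y *m s) - Y *m (Xp l *m s) \in U a.1.
  move=> sZ; elim: l => [|l IH]; first by rewrite !jordan_exp0 subrr mem0v.
  have XlZ : Xp l *m s \in U a.2.+1.
    by apply: (@stable_Xp C N n _ _ l s) => // u; apply: XU.
  have -> : Xp l.+1 *m (Y *m s) - Y *m (Xp l.+1 *m s) =
    X *m (Xp l *m (Y *m s) - Y *m (Xp l *m s)) +
    (X *m (Y *m (Xp l *m s)) - Y *m (X *m (Xp l *m s))).
    by rewrite !jordan_expS mulmxBr addrA subrK.
  exact: (memvD (XU _ _ a1N IH) (comm _ XlZ)).
have conj l c d u : (a.1 <= c)%N -> (d <= a.2.+1)%N ->
    (forall s, s \in U d -> Xp l *m s \in U c) -> u \in U' d -> Xp l *m u \in U' c.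
  move=> ac da XdU /U'E; set s := P (- t) *m u => sU; apply/U'E.
  have -> : u = P t *m s.
    by rewrite /s mulmxA PP mul1mx.
  have sZ : s \in U a.2.+1 by apply: UZ sU.
  have := commX l s sZ; set v := _ - _ => vW.
  have -> : Xp l *m (P t *m s) = P t *m (Xp l *m s) + t *: v.
    by rewrite !PE mulmxDr -scalemxAr scalerBr -!addrA; congr (_ + _); rewrite addrC subrK.
  rewrite mulmxDr mulmxA -{2}[t]opprK PP mul1mx memvD ?XdU //.
  rewrite -scalemxAr memvZ // PE YW // scaler0 addr0.
  exact: WU vW.
have gU' : P t *m g \in unitmx by rewrite unitmx_mul PU.
have fU' : full_flag U' by apply: colspan_full_flag.
have stU' c : (c < N)%N -> forall u, u \in U' c.+1 -> X *m u \in U' c.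
  move=> cN u; have [hc|hc] := boolP ((c < a.1)%N || (a.2 < c)%N).
    rewrite !same; first exact: (comp_stable KU).
      by case/orP: hc => [/ltnW|] ->; rewrite ?orbT.
    by case/orP: hc => [->|/leqW ->]; rewrite ?orbT.
  move: hc; rewrite negb_or -!leqNgt => /andP[ac ca2] uU'.
  have := @conj 1%N c c.+1 u ac ca2; rewrite jordan_expS jordan_exp0; apply=> // s sU.
  by rewrite jordan_expS jordan_exp0; apply: (comp_stable KU).
have KU' : component n M U'.
  split=> // [b bM u|c cN c0 u].
    have [nab|nab] := boolP (nested_above a b); last first.
      have [o1 o2] := arc_outside stdM aM bM nab.
      by rewrite !same //; apply: (comp_arc KU).
    case/andP: nab => ab ba; apply: conj; [exact: ltnW|exact: ltnW|].
    exact: (comp_arc KU).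
  rewrite same; first exact: (comp_top KU).
  by have := cov_NoneP stdM c0 aM; rewrite /covers; clear; lia.
split=> //; have [w' wU'] := flag_word_exists nN fU' stU'.
have cntE c : (c <= a.1)%N -> cnt w' c = cnt w c.
  move=> ca1; have cN := leq_trans ca1 a1N.
  have [l1 l2] := flag_word_leq nN wU' cN; have [l3 l4] := flag_word_leq nN wU cN.
  have sub1 u : u \in U' c -> Xp 0 *m u \in U c by rewrite jordan_exp0 same // ca1.
  have sub2 u : u \in U c -> Xp 0 *m u \in U' c by rewrite jordan_exp0 same // ca1.
  have [g1 g2] := nf_Xp_leq nN sub1 (wU.2 _ cN) (wU'.2 _ cN) l1 l2.
  have [g3 g4] := nf_Xp_leq nN sub2 (wU'.2 _ cN) (wU.2 _ cN) l3 l4.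
  by move: g1 g3; clear; lia.
exists w'; split=> // [i ia|].
  have := cntE _ ia; rewrite !cntS (cntE i (ltnW ia)) => /addnI.
  by case: (w' i); case: (w i).
(* Before the deformation, [e] is in the space after the T at [a.1]. For nonzero t the vector (1 +
   tY) e has a nonzero coordinate in the next row of the second block, which a T would forbid. *)
apply/negP => w'a.
have eU : e \in U a.1.+1.
  by apply: (nf_mem (wU.2 _ (ltn_ord a.1))) => //; rewrite cntS wa addn1.
have := nf_snd (wU'.2 _ (ltn_ord a.1)) (U'P _ _ eU) (j := (a.1 - cnt w a.1)%N).
rewrite cntS w'a cntE // addn1 subSS leqnn => /(_ isT).
by rewrite PE snd_blockD snd_blockZ qe qYe add0r mulr1 => /eqP; rewrite (negbTE t0).
Qed.

End DeformFlag.

(** * Topology *)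

Import Order.TTheory GRing.Theory Num.Theory.
Import numFieldNormedType.Exports.
Local Open Scope classical_set_scope.
Local Open Scope ring_scope.

Section PolynomialContinuity.
Variables (K : numFieldType) (T : topologicalType).
Implicit Types (h k : T -> K).

Lemma continuous_mul h k : continuous h -> continuous k -> continuous (fun x => h x * k x).
Proof. by move=> ch ck x; apply: cvgM; [apply: ch|apply: ck]. Qed.

Lemma continuous_add h k : continuous h -> continuous k -> continuous (fun x => h x + k x).
Proof. by move=> ch ck x; apply: cvgD; [apply: ch|apply: ck]. Qed.

Lemma continuous_sum I (s : seq I) (h : I -> T -> K) :
  (forall i, continuous (h i)) -> continuous (fun x => \sum_(i <- s) h i x).
Proof.
move=> ch; elim: s => [|i s IH].
  by under eq_fun do rewrite big_nil; apply: cst_continuous.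
by under eq_fun do rewrite big_cons; apply: continuous_add.
Qed.

Lemma continuous_prod I (s : seq I) (h : I -> T -> K) :
  (forall i, continuous (h i)) -> continuous (fun x => \prod_(i <- s) h i x).
Proof.
move=> ch; elim: s => [|i s IH].
  by under eq_fun do rewrite big_nil; apply: cst_continuous.
by under eq_fun do rewrite big_cons; apply: continuous_mul.
Qed.

Lemma continuous_det m (A : T -> 'M[K]_m) :
  (forall i j, continuous (fun x => A x i j)) -> continuous (fun x => \det (A x)).
Proof.
move=> cA; apply: continuous_sum => s; apply: continuous_mul.
  exact: cst_continuous.
by apply: continuous_prod => i; apply: cA.
Qed.

Lemma continuous_adj m (A : T -> 'M[K]_m) :
  (forall i j, continuous (fun x => A x i j)) ->
  forall i j, continuous (fun x => (\adj (A x)) i j).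
Proof.
move=> cA i j; under eq_fun do rewrite mxE.
apply: continuous_mul; first exact: cst_continuous.
by apply: continuous_det => k l; under eq_fun do rewrite !mxE; apply: cA.
Qed.

Lemma continuous_mulmx m n q (A : T -> 'M[K]_(m, n)) (B : T -> 'M[K]_(n, q)) :
  (forall i j, continuous (fun x => A x i j)) ->
  (forall i j, continuous (fun x => B x i j)) ->
  forall i j, continuous (fun x => (A x *m B x) i j).
Proof.
move=> cA cB i j; under eq_fun do rewrite mxE.
by apply: continuous_sum => k; apply: continuous_mul; [apply: cA|apply: cB].
Qed.

Lemma continuous_mx m n (A : T -> 'M[K]_(m, n)) :
  (forall i j, continuous (fun x => A x i j)) -> continuous A.
Proof.
move=> cA x B [P nP PB]; rewrite nbhs_filterE.
apply: filterS (_ : nbhs x [set y | forall i j, P i j (A y i j)]) => [y /PB //|].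
apply: filter_forall => i; apply: filter_forall => j.
exact: cA (nP i j).
Qed.

Lemma closed_zeros I (D : I -> Prop) (h : I -> T -> K) :
  (forall i, D i -> continuous (h i)) -> closed [set x | forall i, D i -> h i x = 0].
Proof.
move=> ch; rewrite (_ : [set x | _] = \bigcap_(i in D) (h i @^-1` [set 0])).
  apply: closed_bigI => i Di; apply: closed_comp; first by move=> x _; apply: ch.
  exact/accessible_closed_set1/hausdorff_accessible/norm_hausdorff.
by apply/seteqP; split.
Qed.

End PolynomialContinuity.

Local Open Scope quotient_scope.

Lemma pairwise_rev (T : Type) (r : rel T) (s : seq T) :
  pairwise r (rev s) = pairwise (fun x y => r y x) s.
Proof.
by elim: s => //= x s IH; rewrite rev_cons pairwise_rcons all_rev IH.
Qed.

Section FlagTopology.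
Variables (R : realType) (N : nat).
Local Notation C := (Cplx R).
Local Notation flag := (flag R N).
Local Notation GL := (@GL R N).
Implicit Types (x : flag) (g h : GL) (u : 'cV[C]_N).

Lemma flagP x : exists g : GL, x = \pi_flag g.
Proof. by exists (generic_quotient.repr x); rewrite reprK. Qed.

Lemma flag_space_pi g : flag_space (\pi_flag g) = colspan (set_val g).
Proof. by apply: boolp.funext => i; apply: flag_spaceE. Qed.

Lemma eq_flag g h :
  (forall c u, (c <= N)%N -> (u \in colspan (set_val g) c) = (u \in colspan (set_val h) c)) ->
  \pi_flag g = \pi_flag h.
Proof.
move=> gh; apply/(@eqquotP _ _ {eq_quot (eqB_equiv R N)}); apply/upper_mxP => k j jk.
have : col j (set_val h) \in colspan (set_val g) j.+1.
  by rewrite gh // col_colspan.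
move=> /(colspan_unitP _ _ (Defs.GL_unit g)) /(_ k jk); rewrite !mxE => e.
by rewrite -[RHS]e; apply: eq_bigr => l _; rewrite mxE.
Qed.

Lemma continuous_GL (T : topologicalType) (A : T -> GL) :
  continuous (fun t => set_val (A t) : 'M[C]_N) -> continuous A.
Proof.
move=> cA; apply/continuousP => B [D oD <-].
by move/continuousP: cA => /(_ D oD).
Qed.

(** The determinant is a unit, so the adjugate may replace the inverse, and the conditions become
    polynomial in the entries of [g]. *)
Lemma colspan_adjP (g : 'M[C]_N) (A : 'M[C]_N) c d : g \in unitmx ->
  (forall u, u \in colspan g d -> A *m u \in colspan g c) <->
  (forall j k : 'I_N, (j < d)%N && (c <= k)%N -> (\adj g *m A *m g) k j = 0).
Proof.
move=> gU; have dU : (\det g)^-1 != 0 by rewrite invr_eq0 -unitfE -unitmxE.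
have iE (k j : 'I_N) : (invmx g *m A *m g) k j = (\det g)^-1 * (\adj g *m A *m g) k j.
  by rewrite /invmx gU -!scalemxAl mxE.
split=> [h j k /andP[jd ck]|h u /colspan_mulP[a a0 ->]].
  have := h _ (col_colspan g jd) => /(colspan_unitP _ _ gU) /(_ k ck).
  rewrite colE !mulmxA -colE mxE iE => /eqP; rewrite mulf_eq0 (negbTE dU) => /eqP //.
apply/colspan_unitP => // k ck; rewrite !mulmxA mxE big1 // => j _.
have [jd|dj] := ltnP j d; last by rewrite a0 ?mulr0.
by rewrite iE h ?mulr0 ?mul0r // jd.
Qed.

End FlagTopology.

Section ComponentClosed.
Variables (R : realType) (N n : nat) (M : {set Arc N}).
Local Notation C := (Cplx R).
Local Notation flag := (flag R N).
Local Notation GL := (@GL R N).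
Local Notation p := (@fst_block C N n).
Local Notation q := (@snd_block C N n).
Local Notation X := (jordan C N n).
Local Notation Xp := (jordan_exp C N n).
Local Notation T := (cnt (word n M)).
Hypothesis nN : (n <= N)%N.
Implicit Types (x : flag) (u : 'cV[C]_N).

Definition component_set : set flag := [set x | component n M (flag_space x)].

(** The rows that vanish on the coordinate space prescribed at a gap [c] enclosed by no arc. *)
Definition off_top c (r : 'I_N) : bool :=
  if (r < n)%N then (T c <= r)%N else (c - T c <= r - n)%N.

Lemma off_topP c u : ((forall j, (c - T c <= j)%N -> q u j = 0) /\
    (forall r, (T c <= r)%N -> p u r = 0)) <->
  forall r : 'I_N, off_top c r -> u r 0 = 0.
Proof.
split=> [[qu pu] r|h].
  rewrite /off_top; case: ifP => rn hr.
    by have := pu r hr; rewrite /fst_block rn entryE.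
  have := qu _ hr; rewrite /snd_block subnKC ?entryE //.
  by rewrite leqNgt rn.
split=> [j hj|r hr].
  have [lt|ge] := ltnP (n + j) N; last by rewrite (snd_block_out nN) //; move: ge; clear; lia.
  rewrite /snd_block (entryE _ (Ordinal lt)) h // /off_top /=.
  by rewrite ltnNge leq_addr /= addKn.
have [rn|nr] := ltnP r n; last by rewrite fst_block_out.
rewrite /fst_block rn (entryE _ (Ordinal (leq_trans rn nN))) h //.
by rewrite /off_top /= rn.
Qed.

Lemma component_zeros (g : 'M[C]_N) : g \in unitmx -> component n M (colspan g) <->
  [/\ forall i : 'I_N * 'I_N * 'I_N, (i.1.2 < i.1.1.+1)%N && (i.1.1 <= i.2)%N ->
        (\adj g *m X *m g) i.2 i.1.2 = 0,
      forall i : Arc N * 'I_N * 'I_N, (i.1.1 \in M) && ((i.1.2 < i.1.1.2.+1)%N && (i.1.1.1 <= i.2)%N) ->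
        (\adj g *m Xp (half_length i.1.1) *m g) i.2 i.1.2 = 0
    & forall i : nat * 'I_N * 'I_N, [&& (i.1.1 <= N)%N, cov M i.1.1 == None,
         (i.1.2 < i.1.1)%N & off_top i.1.1 i.2] -> g i.2 i.1.2 = 0].
Proof.
move=> gU; split=> [[K1 K2 K3]|[Z1 Z2 Z3]].
  split=> [[[c j] k] /=|[[a j] k] /= /andP[aM]|[[c j] r] /= /and4P[cN /eqP c0 jc hr]].
  - exact: (colspan_adjP X c c.+1 gU).1 (K1 c (ltn_ord c)) j k.
  - exact: (colspan_adjP _ a.1 a.2.+1 gU).1 (K2 a aM) j k.
  have := (off_topP c (col j g)).1 (K3 c cN c0 _ (col_colspan g jc)) r hr.
  by rewrite mxE.
split=> [c cN|a aM|c cN c0 u /colspan_mulP[b b0 ->]].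
- apply: (colspan_adjP X c c.+1 gU).2 => j k jk.
  exact: (Z1 (Ordinal cN, j, k)).
- apply: (colspan_adjP _ a.1 a.2.+1 gU).2 => j k jk.
  by apply: (Z2 (a, j, k)); rewrite /= aM.
apply/off_topP => r hr; rewrite mxE big1 // => j _.
have [jc|cj] := ltnP j c; last by rewrite b0 ?mulr0.
by rewrite (Z3 (c, j, r)) ?mul0r //= cN c0 eqxx jc.
Qed.

Lemma component_set_closed : closed component_set.
Proof.
(* In the quotient topology, a set of flags is closed when its preimage in [GL] is. *)
rewrite -openC; rewrite /open /= /quotient_open -[X in open X]setCK.
apply: closed_openC; rewrite preimage_setC setCK.
have cgl (i j : 'I_N) : continuous (fun g : GL => (set_val g : 'M[C]_N) i j).
  move=> g; apply: (@continuous_comp _ _ _ (fun g : GL => set_val g : 'M[C]_N)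
     (fun g : 'M[C]_N => g i j)); [exact: initial_continuous|exact: coord_continuous].
have cst (A : 'M[C]_N) (i j : 'I_N) : continuous (fun g : GL => A i j).
  exact: cst_continuous.
have cadj A i j : continuous (fun g : GL => (\adj (set_val g) *m A *m (set_val g : 'M[C]_N)) i j).
  have c1 := @continuous_adj C GL N (fun g => set_val g) cgl.
  have c2 := @continuous_mulmx C GL N N N _ _ c1 (cst A).
  exact: (@continuous_mulmx C GL N N N _ _ c2 cgl).
rewrite (_ : _ @^-1` _ = [set g : GL |
  forall i : 'I_N * 'I_N * 'I_N, (i.1.2 < i.1.1.+1)%N && (i.1.1 <= i.2)%N ->
        (\adj (set_val g) *m X *m (set_val g : 'M[C]_N)) i.2 i.1.2 = 0] `&`
   [set g : GL | forall i : Arc N * 'I_N * 'I_N, (i.1.1 \in M) && ((i.1.2 < i.1.1.2.+1)%N && (i.1.1.1 <= i.2)%N) ->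
        (\adj (set_val g) *m Xp (half_length i.1.1) *m (set_val g : 'M[C]_N)) i.2 i.1.2 = 0] `&`
   [set g : GL | forall i : nat * 'I_N * 'I_N, [&& (i.1.1 <= N)%N, cov M i.1.1 == None,
         (i.1.2 < i.1.1)%N & off_top i.1.1 i.2] -> (set_val g : 'M[C]_N) i.2 i.1.2 = 0]).
  apply: closedI; last by apply: closed_zeros => i _; apply: cgl.
  by apply: closedI; apply: closed_zeros => i _; apply: cadj.
apply/seteqP; split=> g /=.
  by rewrite /component_set /= flag_space_pi => /(component_zeros (Defs.GL_unit g))[].
move=> [[Z1 Z2] Z3]; rewrite /component_set /= flag_space_pi.
by apply/(component_zeros (Defs.GL_unit g)).
Qed.

End ComponentClosed.

(** * Cells *)

Section Cells.
Variables (R : realType) (N n : nat) (M : {set Arc N}).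
Local Notation C := (Cplx R).
Local Notation flag := (flag R N).
Local Notation GL := (@GL R N).
Local Notation p := (@fst_block C N n).
Local Notation q := (@snd_block C N n).
Local Notation X := (jordan C N n).
Local Notation Xp := (jordan_exp C N n).
Hypothesis nN : (n <= N)%N.
Hypothesis stdM : std_noncrossing M.
Hypothesis cardM : (#|M| <= minn n (N - n))%N.
Implicit Types (x : flag) (u z : 'cV[C]_N) (A : {set Arc N}) (w : pred 'I_N) (s : seq (Arc N)).

Lemma flag_word_ext (U : nat -> {vspace 'cV[C]_N}) w w' :
  w =1 w' -> flag_word n U w -> flag_word n U w'.
Proof.
move=> ww' [wN nf]; have E c : cnt w' c = cnt w c by apply: eq_cnt => i _; rewrite ww'.
by split=> [|c cN]; rewrite E //; apply: nf.
Qed.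

(** X acts on the line U_(c+1) / U_c by a scalar [a], and X^N = 0 forces a^N = 0. *)
Lemma stable_strict (U : nat -> {vspace 'cV[C]_N}) : full_flag U ->
  (forall c, (c <= N)%N -> forall u, u \in U c -> X *m u \in U c) ->
  forall c, (c < N)%N -> forall u, u \in U c.+1 -> X *m u \in U c.
Proof.
move=> fU XU c cN u uU; have [z [zU zU' gen]] := flag_step fU cN.
have [a Xz] := gen _ (XU _ cN _ zU).
have Xpz k : Xp k *m z - a ^+ k *: z \in U c.
  elim: k => [|k IH]; first by rewrite jordan_exp0 expr0 scale1r subrr mem0v.
  have -> : Xp k.+1 *m z - a ^+ k.+1 *: z =
      X *m (Xp k *m z - a ^+ k *: z) + a ^+ k *: (X *m z - a *: z).
    by rewrite jordan_expS mulmxBr -scalemxAr scalerBr addrA subrK scalerA -exprSr.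
  exact: (memvD (XU _ (ltnW cN) _ IH) (memvZ _ Xz)).
have a0 : a = 0.
  apply/eqP; apply/negPn/negP => a0; case/negP: zU'.
  have := Xpz N; rewrite (jordan_expN nN) sub0r => h.
  rewrite -[z]scale1r -(mulVf (expf_neq0 N a0)) -scalerA memvZ //.
  by rewrite -[_ *: z]opprK memvN.
have [b ub] := gen u uU.
rewrite -[u](subrK (b *: z)) mulmxDr -scalemxAr memvD //.
  exact: (XU _ (ltnW cN)).
by apply: memvZ; move: Xz; rewrite a0 scale0r subr0.
Qed.

Lemma component_setP (g : GL) :
  component_set n M (\pi_flag g) <-> component n M (colspan (set_val g)).
Proof. by rewrite /component_set /= flag_space_pi. Qed.

(** Going through the gaps, the pivot of column [i] reveals the letter: in the first block it gives
    a vector of E with a new nonzero row, which requires a T, and in the second block a new nonzero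
    coordinate modulo E, which requires a B. *)
Lemma cell_component x : springer_schubert_cell R n M x ->
  component_set n M x /\ flag_word n (flag_space x) (word n M).
Proof.
move=> [fib [w0 wE [g0 [g1 g2 g3] [g [ge xe]]]]]; subst x.
have gU : g0 \in unitmx by rewrite -ge; apply: Defs.GL_unit.
have fU := colspan_full_flag gU.
rewrite component_setP flag_space_pi ge.
have XU c : (c <= N)%N -> forall u, u \in colspan g0 c -> X *m u \in colspan g0 c.
  case: c => [_ u /colspan0 ->|c cN u]; first by rewrite mulmx0 mem0v.
  by have := fib c.+1 u cN; rewrite flag_space_pi ge; apply.
have Xstr := stable_strict fU XU.
have [m' wm'] := flag_word_exists nN fU Xstr.
suff mm' : m' =1 word n M.
  by have wm := flag_word_ext mm' wm'; split=> //; apply: word_component.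
suff cntE c : (c <= N)%N -> cnt m' c = cnt (word n M) c.
  move=> i; have := cntE _ (ltn_ord i); rewrite !cntS (cntE _ (ltnW (ltn_ord i))).
  by move=> /addnI; case: (m' i); case: (word n M i).
move: c; apply: gap_ind => [|i IH]; first by rewrite !cnt0.
rewrite !cntS IH; congr (_ + nat_of_bool _)%N.
have colU : col i g0 \in colspan g0 i.+1 by apply: col_colspan.
have nfS := wm'.2 _ (ltn_ord i); rewrite cntS IH in nfS.
have wi := wE i; rewrite (wME stdM cardM nN) in wi.
have iT := cnt_leq (word n M) (ltnW (ltn_ord i)).
case mi: (word n M i) wi => wi.
  case m'i: (m' i) nfS => // nfS; exfalso.
  have tn := f_mx_word (R := R) nN stdM cardM (fun=> 0).
  have ltn : (cnt (word n M) i < n)%N.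
    by have [] := flag_word_leq nN tn (ltn_ord i); rewrite cntS mi addn1.
  have qc j : q (col i g0) j = 0.
    have [lt|ge'] := ltnP (n + j) N; last by rewrite (snd_block_out nN) //; move: ge'; clear; lia.
    rewrite /snd_block (entryE _ (Ordinal lt)) mxE g2 // wi /=.
    exact: leq_trans ltn (leq_addr _ _).
  have := nf_fst nfS colU qc; rewrite addn0 => /(_ _ (leqnn _)).
  rewrite /fst_block ltn -wi entryE mxE g1 => /eqP; by rewrite oner_eq0.
case m'i: (m' i) nfS => // nfS; exfalso.
have := nf_snd nfS colU (j := (i - cnt (word n M) i)%N).
rewrite addn1 subSS leqnn => /(_ isT).
by rewrite /snd_block -wi entryE mxE g1 => /eqP; rewrite oner_eq0.
Qed.

Section Order.
Variables (A : {set Arc N}) (s : seq (Arc N)).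
Hypothesis AM : A \subset M.
Hypothesis sA : nesting_order A s.

#[local] Lemma set_rev : [set b in rev s]%SET = A.
Proof. by apply/setP => b; case: sA => _ sE _; rewrite inE mem_rev sE. Qed.

#[local] Lemma rev_uniq_s : uniq (rev s).
Proof. by rewrite rev_uniq; case: sA. Qed.

#[local] Lemma rev_sub : {subset rev s <= M}.
Proof.
move=> b; rewrite mem_rev; case: sA => _ -> _; exact: (fintype.subsetP AM).
Qed.

#[local] Lemma rev_order : pairwise (fun a b => ~~ nested_above a b) (rev s).
Proof. by rewrite pairwise_rev; case: sA. Qed.

Lemma cut_cellE (v : Arc N -> C) :
  f_mx n (cut n M A) (fun b => vcoord v (lambda n M s b)) =
  f_mx n (cut n M [set b in rev s]%SET) (lam_val n M v (rev s)).
Proof. by rewrite set_rev. Qed.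

Lemma cut_cell_component x : cut_cell R n M A s x ->
  component_set n M x /\ flag_word n (flag_space x) (cut_word n M A).
Proof.
move=> [v _ [h [he xe]]]; subst x; rewrite component_setP flag_space_pi he cut_cellE.
split; first exact: (cut_f_mx_component nN stdM cardM v rev_uniq_s rev_sub rev_order).
rewrite set_rev -(word_cut nN stdM cardM).
by apply: f_mx_word => //; [apply: cut_std|apply: cut_card].
Qed.

Lemma component_cut_cell x : component_set n M x ->
  flag_word n (flag_space x) (cut_word n M A) -> cut_cell R n M A s x.
Proof.
have [g ->] := flagP x; rewrite component_setP flag_space_pi => KU wU.
have gU : (set_val g : 'M[C]_N) \in unitmx by apply: Defs.GL_unit.
set U := colspan (set_val g) in KU wU; set w := cut_word n M A in wU.
have fU : full_flag U by apply: colspan_full_flag.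
(* At an uncut arc, [z] is the new vector of the flag normalized like a column of [f_mx]: a basis
   vector in the second block, and no rows before [cnt w a.1]. Its entry in that row is the value
   pushed, which defines [v a] below. *)
have exz (a : Arc N) : exists z, ~~ w a.1 -> [/\ z \in U a.1.+1,
    forall j, q z j = (j == a.1 - cnt w a.1)%N%:R & forall r, (r < cnt w a.1)%N -> p z r = 0].
  have [wa|wa] := boolP (w a.1); first by exists 0.
  have a1N := ltn_ord a.1; have cw := cnt_leq w (ltnW a1N).
  have nfS := wU.2 _ a1N; rewrite cntS (negbTE wa) addn0 subSn // in nfS.
  have [_ hb] := flag_word_leq nN wU a1N; rewrite cntS (negbTE wa) addn0 subSn // in hb.
  pose f : 'cV[C]_N := block_vec N n (fun=> 0) (fun j => (j == a.1 - cnt w a.1)%N%:R).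
  have qf j : q f j = (j == a.1 - cnt w a.1)%N%:R.
    have [lt|ge'] := ltnP (n + j) N; first by rewrite snd_block_vec.
    by rewrite (snd_block_out nN) ?gtn_eqF //; move: ge' hb; clear; lia.
  have [|e qe fe] := nf_proj nfS (u := f).
    by move=> j hj; rewrite qf gtn_eqF.
  pose y : 'cV[C]_N := block_vec N n (fun r => if (r < cnt w a.1)%N then p (f - e) r else 0) (fun=> 0).
  have qy j : q y j = 0 by apply: snd_block_vec0.
  have py r : p y r = if (r < cnt w a.1)%N then p (f - e) r else 0.
    have [rn|nr] := ltnP r n; first by rewrite fst_block_vec.
    by rewrite !fst_block_out // if_same.
  have yU : y \in U a.1.+1.
    by apply: (nf_mem nfS) => // r hr; rewrite py ltnNge hr.
  exists (f - e - y) => _; split=> [|j|r hr]; first exact: memvB.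
    by rewrite snd_blockB snd_blockB qe qy !subr0 qf.
  by rewrite fst_blockB py hr subrr.
have [zz zzP] := boolp.choice exz.
pose v a : C := if a \in M :\: A then p (zz a) (cnt w a.1) else 0.
exists v => [a /= aMA|]; first by rewrite /v (negbTE aMA).
set f := f_mx n _ _.
have std' := cut_std nN stdM cardM A; have card' := cut_card nN stdM cardM A.
have fE : f = f_mx n (cut n M A) (lam_val n M v (rev s)) by rewrite /f cut_cellE set_rev.
have wE : word n (cut n M A) = w by apply: word_cut.
have f_unit : f \in unitmx by rewrite fE; apply: f_mx_unit.
have h : {h : GL | set_val h = f}.
  by exists (exist _ f (mem_set f_unit)).
case: h => h he; exists h; split=> //.
have KU' : component n M (colspan f).
  rewrite /f cut_cellE.
  exact: (cut_f_mx_component nN stdM cardM v rev_uniq_s rev_sub rev_order).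
have wU' : flag_word n (colspan f) w by rewrite fE -wE; apply: f_mx_word.
have fU' := colspan_full_flag f_unit.
have [_ _ I3] := cut_seq_inv stdM cardM nN v rev_uniq_s rev_sub rev_order.
rewrite /cut_seq_val set_rev in I3.
apply: eq_flag; rewrite he => c u cN.
apply: (comp_uniq nN stdM cardM fU fU' KU KU' wU wU') => // a aM wa.
have [zU qz pz] := zzP a wa.
have aA : a \notin A.
  by apply: contra wa => aA; rewrite (cut_word_arc stdM cardM nN AM aA).1.
exists (zz a), (col a.1 f); split=> //.
- exact: col_colspan.
- by move=> j; rewrite qz fE (q_col_f_mx nN std' card') wE wa.
- by rewrite qz eqxx oner_eq0.
move=> r; rewrite fE (p_col_f_mx nN std' card') wE (negbTE wa).
rewrite leq_eqVlt => /orP[/eqP->|hr]; last by rewrite pz // leqNgt hr.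
rewrite leqnn subnn stackS (negbTE wa) I3 //; last by apply: contra aA => ars; rewrite -set_rev inE.
by rewrite /v inE aA aM.
Qed.

End Order.

(** The stack is written from row [cnt m c] on and within the first block, hence below the pivots of
    the T read before and above the pivots of all B. *)
Lemma canonical_f_mx (w0 : 'S_N) (v : Arc N -> C) :
  (forall i, w0 i = wM n M i :> nat) -> canonical_rep w0 (f_mx n M v).
Proof.
move=> wE; set m := word n M.
have wE' i := etrans (wE i) (wME stdM cardM nN i).
have fw := f_mx_word nN stdM cardM v.
have T_lt (i : 'I_N) : m i -> (cnt m i < n)%N.
  by move=> mi; have [] := flag_word_leq nN fw (ltn_ord i); rewrite cntS mi addn1.
have S0 (i r : 'I_N) : (n <= r)%N -> ~~ m i ->
    (if (cnt m i <= r)%N then stack m (xof M v) i.+1 (r - cnt m i) else 0) = 0.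
  move=> nr mi; case: ifP => // hr; apply: stack_top => //; first exact: stack_covN.
  by rewrite (cnt_wordN stdM cardM nN) cntS (negbTE mi) addn0 subnKC.
split=> [c|r c|c c' cc'].
- have := wE' c; rewrite f_mx_entry // -/m; case mc: (m c) => wc; first by rewrite wc eqxx.
  by rewrite S0 ?mc ?addr0 ?wc ?eqxx // leq_addr.
- rewrite wE' f_mx_entry // -/m; case mc: (m c) => hr; first by rewrite gtn_eqF.
  by rewrite gtn_eqF // add0r S0 ?mc // (leq_trans _ (ltnW hr)) // leq_addr.
have inj : w0 c != w0 c' :> nat.
  apply/eqP => /val_inj /perm_inj e; by move: cc'; rewrite e ltnn.
rewrite f_mx_entry // -/m; have := inj; rewrite (wE' c') -/m.
case mc': (m c') => ne; first by rewrite (negbTE ne).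
rewrite (negbTE ne) add0r.
have [nw|wn] := leqP n (w0 c); first by rewrite S0 ?mc'.
case mc: (m c); last by move: wn; rewrite wE' -/m mc ltnNge leq_addr.
rewrite ifF //; apply/negbTE; rewrite -ltnNge wE' -/m mc.
by have := cnt_mono m cc'; rewrite cntS mc addn1.
Qed.

Lemma perm_word : exists w0 : 'S_N, forall i, w0 i = wM n M i :> nat.
Proof.
set m := word n M.
have fw := f_mx_word (R := R) nN stdM cardM (fun=> 0).
have T_lt (i : 'I_N) : m i -> (cnt m i < n)%N.
  by move=> mi; have [] := flag_word_leq nN fw (ltn_ord i); rewrite cntS mi addn1.
have B_lt (i : 'I_N) : ~~ m i -> (i - cnt m i < N - n)%N.
  move=> mi; have [_] := flag_word_leq nN fw (ltn_ord i).
  by rewrite cntS (negbTE mi) addn0 subSn // cnt_leq // ltnW.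
have wlt i : (wM n M i < N)%N.
  rewrite (wME stdM cardM nN) -/m; case: ifP => [/T_lt lt|/negbT/B_lt lt].
    exact: leq_trans lt nN.
  by move: lt; clear; lia.
pose f i := Ordinal (wlt i).
have lt_neq (i j : 'I_N) : (i < j)%N -> wM n M i <> wM n M j.
  move=> ij; rewrite !(wME stdM cardM nN) -/m.
  have hT := cnt_mono m ij; have hB := @cnt_sub N m i.+1 j; move: hT hB.
  rewrite ij (ltnW (ltn_ord j)) cntS => hT /(_ isT) hB.
  have ci := cnt_leq m (ltnW (ltn_ord i)); have cj := cnt_leq m (ltnW (ltn_ord j)).
  case mi: (m i) hT hB; case mj: (m j) => hT hB e.
  - by move: hT e; clear; lia.
  - by have := T_lt i mi; move: e; clear; lia.
  - by have := T_lt j mj; move: e; clear; lia.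
  by move: hB e ci cj; clear; lia.
have f_inj : injective f.
  move=> i j /(congr1 val) /= e; apply/val_inj.
  by case: (ltngtP i j) => // /lt_neq []; rewrite e.
by exists (perm f_inj) => i; rewrite permE.
Qed.

(** The case of [component_cut_cell] without cuts: the flag comes from some [f_mx n M v], which is a
    canonical representative. *)
Lemma component_cell x : component_set n M x ->
  flag_word n (flag_space x) (word n M) -> springer_schubert_cell R n M x.
Proof.
move=> Kx wx.
have [v _ [h [he xe]]] : cut_cell R n M finset.set0 [::] x.
  apply: component_cut_cell => //; first exact: finset.sub0set.
    by split=> // b; rewrite !inE.
  apply: (flag_word_ext _ wx) => i; rewrite cut_word_out ?finset.sub0set // => b.
  by rewrite inE.
split.
  move=> [|c] // u /andP[_ cN] uU.
  have : X *m u \in flag_space x c by apply: (comp_stable Kx).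
  by rewrite xe flag_space_pi; apply: colspan_sub; apply: leqnSn.
have [w0 wE] := perm_word; exists w0 => //; exists (set_val h).
  by rewrite he (cut0 stdM cardM nN); apply: canonical_f_mx.
by exists h.
Qed.

Lemma component_closure x : component_set n M x -> closure (springer_schubert_cell R n M) x.
Proof.
(* No cut arc starts before N - d; for d = 0 this means that no arc is cut. *)
have H : forall d x w, component_set n M x -> flag_word n (flag_space x) w ->
    (forall a, a \in M -> w a.1 -> (N <= a.1 + d)%N) ->
    closure (springer_schubert_cell R n M) x.
  elim=> [|d IH] {}x w Kx wx hw.
    apply: subset_closure; apply: component_cell => //.
    apply: (flag_word_ext _ wx) => i; rewrite (comp_word_cut nN stdM cardM Kx wx).
    rewrite cut_word_out //.
      by apply/fintype.subsetP => a; rewrite inE => /andP[].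
    move=> a; rewrite inE => /andP[aM /(hw a aM)].
    by rewrite addn0 leqNgt ltn_ord.
  have [[a /andP[/andP[aM wa] /eqP ad]]|na] :=
      boolp.pselect (exists a, (a \in M) && w a.1 && ((a.1 + d).+1 == N)); last first.
    apply: (IH x w) => // a aM wa; have := hw a aM wa.
    rewrite addnS leq_eqVlt => /orP[/eqP e|//].
    by case: na; exists a; rewrite aM wa; apply/eqP/esym.
  have [g xe] := flagP x; subst x; move/component_setP in Kx; rewrite flag_space_pi in wx.
  have gU : (set_val g : 'M[C]_N) \in unitmx by apply: Defs.GL_unit.
  have [Y [YU hY]] := component_shear nN stdM cardM gU Kx wx aM wa.
  pose G t : GL := exist _ ((1%:M + t *: Y) *m set_val g) (mem_set (YU t)).
  have G0 : \pi_flag (G 0) = \pi_flag g.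
    congr (\pi_flag _); apply: val_inj => /=; by rewrite scale0r addr0 mul1mx.
  have cGm : continuous (fun t : C => (1%:M + t *: Y) *m (set_val g : 'M[C]_N)).
    apply: continuous_mx; apply: continuous_mulmx => i j; last exact: cst_continuous.
    under eq_fun do rewrite !mxE.
    apply: continuous_add; first exact: cst_continuous.
    by apply: continuous_mul; [move=> ?; exact: cvg_id|exact: cst_continuous].
  have cG : continuous G by apply: continuous_GL; exact: cGm.
  have cpG : continuous (fun t : C => \pi_flag (G t)).
    by move=> t; apply: continuous_comp; [apply: cG|apply: pi_continuous].
  (* By induction the curve lies in the closure for nonzero t, so it suffices that its value at 0 is
     in the closure of the closure. *)
  rewrite -G0; apply: closed_closure => B nB.
  have [e /= e0 eB] : nbhs (0 : C) ((fun t : C => \pi_flag (G t)) @^-1` B).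
    exact: cpG nB.
  exists (\pi_flag (G (e / 2))); split; last first.
    apply: eB => /=; rewrite /ball_ sub0r normrN gtr0_norm ?divr_gt0 //.
    by rewrite ltr_pdivrMr // ltr_pMr // ltr1n.
  have e2 : e / 2 != 0 by rewrite gt_eqF // divr_gt0.
  have [K' [w' [wU' w'1 w'2]]] := hY (e / 2) e2.
  apply: (IH _ w'); rewrite ?component_setP ?flag_space_pi //.
  move=> b bM w'b; rewrite leqNgt; apply/negP => bd.
  have : (b.1 <= a.1)%N by move: bd; clear -ad; lia.
  rewrite leq_eqVlt => /orP[/eqP e'|ba].
    by move: w'b; rewrite (arc_eq1 stdM bM aM e') w'2.
  have := hw b bM; rewrite -w'1 // w'b => /(_ isT).
  by move: ba; clear -ad; lia.
have [g xe] := flagP x; subst x => Kx.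
have gU : (set_val g : 'M[C]_N) \in unitmx by apply: Defs.GL_unit.
have Kg : component n M (colspan (set_val g)) by apply/component_setP.
have [w wU] := flag_word_exists nN (colspan_full_flag gU) (comp_stable Kg).
by apply: (H N _ w) => //; [rewrite flag_space_pi|move=> a _ _; rewrite leq_addl].
Qed.

End Cells.

Local Open Scope classical_set_scope.

Theorem theorem6p9 (R : realType) (N n : nat) (M : {set Arc N})
    (sigma : {set Arc N} -> seq (Arc N)) :
  (1 <= n <= N - 1)%N ->
  std_noncrossing M ->
  (#|M| <= minn n (N - n))%N ->
  (forall A : {set Arc N}, A \subset M -> nesting_order A (sigma A)) ->
  closure (springer_schubert_cell R n M) =
    \bigcup_(A in [set A : {set Arc N} | A \subset M]) cut_cell R n M A (sigma A)
  /\ trivIset [set A : {set Arc N} | A \subset M]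
       (fun A => cut_cell R n M A (sigma A)).
Proof.
move=> nN1 stdM cardM hs; have nN : (n <= N)%N by lia.
split; last first.
  move=> A A' /= AM A'M [x [xA xA']].
  have [_ w] := cut_cell_component nN stdM cardM AM (hs A AM) xA.
  have [_ w'] := cut_cell_component nN stdM cardM A'M (hs A' A'M) xA'.
  have e := flag_word_uniq nN w w'.
  (* Among the arcs of [M], the cut ones are those whose start reads T, so the word determines the
     set. *)
  have sub (B B' : {set Arc N}) : B \subset M -> B' \subset M ->
      cut_word n M B =1 cut_word n M B' -> B \subset B'.
    move=> BM B'M eB; apply/fintype.subsetP => a aB; apply/negPn/negP => aB'.
    have aM := fintype.subsetP BM _ aB.
    have := eB a.1; rewrite (cut_word_arc stdM cardM nN BM aB).1 cut_word_out //.
      by rewrite (word_arc stdM cardM nN aM).1.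
    move=> b bB'; have bM := fintype.subsetP B'M _ bB'.
    split; apply/eqP => eb; last by apply: (arc_neq12 stdM aM bM); rewrite eb.
    by case/negP: aB'; rewrite -(arc_eq1 stdM bM aM) // eb.
  apply/eqP; rewrite finset.eqEsubset; apply/andP; split.
    exact: (sub _ _ AM A'M e).
  exact: (sub _ _ A'M AM (fun i => esym (e i))).
apply/seteqP; split=> x.
  move=> cx; have Kx : component_set n M x.
    have sK : springer_schubert_cell R n M `<=` component_set n M.
      by move=> y /(cell_component nN stdM cardM)[].
    have := closure_subset sK cx.
    by rewrite -((closure_id _).1 (@component_set_closed R N n M nN)).
  have [g xe] := flagP x.
  have gU : (set_val g : 'M[Cplx R]_N) \in unitmx by apply: Defs.GL_unit.
  have [w wU] := flag_word_exists nN (colspan_full_flag gU)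
    (comp_stable ((component_setP n M g).1 (eq_rect _ _ Kx _ xe))).
  have wx : flag_word n (flag_space x) w by rewrite xe flag_space_pi.
  have AM : [set a in M | w a.1]%SET \subset M.
    by apply/fintype.subsetP => a; rewrite inE => /andP[].
  exists [set a in M | w a.1]%SET => //.
  apply: component_cut_cell => //; first exact: hs.
  exact: flag_word_ext (comp_word_cut nN stdM cardM Kx wx) wx.
move=> [A AM xA].
have [Kx _] := cut_cell_component nN stdM cardM AM (hs A AM) xA.
exact: component_closure.
Qed.
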